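(* Let $n\ge3$, $R>0$ and $\boldsymbol z\sim\mathrm{Unif}(\mathbb S^{n-1}(R))$. Let $\boldsymbol P_{\boldsymbol x}^\perp=\boldsymbol I_n-\boldsymbol x\boldsymbol x^\top/\|\boldsymbol x\|_2^2$ for $\boldsymbol x\ne\boldsymbol 0$. Then for all $\boldsymbol f=(f_1,\dots,f_n)\in W^{1,1}(\mathbb S^{n-1}(R))^n$, $$\mathbb E[\boldsymbol f(\boldsymbol z)^\top\boldsymbol z]=(n-1)^{-1}R^2\,\mathbb E\bigl[\mathrm{trace}\bigl((\nabla\boldsymbol f(\boldsymbol z))^\top\boldsymbol P_{\boldsymbol z}^\perp\bigr)\bigr].$$ Moreover, for all $\boldsymbol f=(f_1,\dots,f_n)\in W^{1,2}(\mathbb S^{n-1}(R))^n$, $$\mathbb E\bigl[\|\boldsymbol f(\boldsymbol z)-\mathbb E[\boldsymbol f(\boldsymbol z)]\|_2^2\bigr]\le (n-2)^{-1}R^2\,\mathbb E\bigl[\|\nabla\boldsymbol f(\boldsymbol z)^\top\boldsymbol P_{\boldsymbol z}^\perp\|_F^2\bigr],$$ and $$\begin{aligned} &\mathbb E\Bigl[\bigl(nR^{-2}\boldsymbol f(\boldsymbol z)^\top\boldsymbol z-\mathrm{trace}[\nabla\boldsymbol f(\boldsymbol z)^\top\boldsymbol P_{\boldsymbol z}^\perp]\bigr)^2\Bigr]\\ &= nR^{-2}\,\mathbb E\bigl[\|\boldsymbol f(\boldsymbol z)\|_2^2\bigr]+\frac{n}{n-2}\,\mathbb E\,\mathrm{trace}\Bigl[\bigl(\nabla\boldsymbol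 f(\boldsymbol z)^\top\boldsymbol P_{\boldsymbol z}^\perp\bigr)^2\Bigr]-\frac{2}{n-2}\,\mathbb E\Bigl[\bigl(\mathrm{trace}[\nabla\boldsymbol f(\boldsymbol z)^\top\boldsymbol P_{\boldsymbol z}^\perp]\bigr)^2\Bigr]\\ &\le nR^{-2}\,\mathbb E\bigl[\|\boldsymbol f(\boldsymbol z)\|_2^2\bigr]+(1-2/n)^{-1}\,\mathbb E\bigl[\|\nabla\boldsymbol f(\boldsymbol z)^\top\boldsymbol P_{\boldsymbol z}^\perp\|_F^2\bigr]. \end{aligned}$$
   Context: $\mathbb S^{n-1}(R)=\{\boldsymbol x\in\mathbb R^n:\|\boldsymbol x\|_2=R\}$, and $\boldsymbol z\sim\mathrm{Unif}(\mathbb S^{n-1}(R))$ means that $\boldsymbol z$ has the law of $R\boldsymbol\zeta/\|\boldsymbol\zeta\|_2$ with $\boldsymbol\zeta\sim N(\boldsymbol 0,\boldsymbol I_n)$. For a smooth $h:\mathbb S^{n-1}(R)\to\mathbb R$, its gradient at $\boldsymbol x\in\mathbb S^{n-1}(R)$ is the vector $\nabla h(\boldsymbol x)\in\mathbb R^n$ of partial derivatives at $\boldsymbol x$ of the extension $\check h(\boldsymbol x)=h(R\boldsymbol x/\|\boldsymbol x\|_2)$, defined on a neighborhood of the sphere. (So $\nabla h(\boldsymbol x)$ is orthogonal to $\boldsymbol x$.) For $\alpha\in\{1,2\}$, $W^{1,\alpha}(\mathbb S^{n-1}(R))$ is the completion of the smooth functions on $\mathbb S^{n-1}(R)$ for the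 norm $\|h\|_{1,\alpha}=\mathbb E[|h(\boldsymbol z)|^\alpha]^{1/\alpha}+\mathbb E[\|\nabla h(\boldsymbol z)\|_2^\alpha]^{1/\alpha}$, with the gradient extended by continuity. $W^{1,\alpha}(\mathbb S^{n-1}(R))^n$ is the space of $\boldsymbol f=(f_1,\dots,f_n)$ with all $f_i\in W^{1,\alpha}(\mathbb S^{n-1}(R))$, and $\nabla\boldsymbol f=(\nabla f_1,\dots,\nabla f_n)\in\mathbb R^{n\times n}$ is the matrix with columns $\nabla f_i$. $\|\cdot\|_F$ is the Frobenius norm. *)

(* Defs.v *)
From HB Require Import structures.
From mathcomp Require Import all_boot all_order all_algebra.
From mathcomp Require Import all_classical all_reals all_analysis measurable_realfun.

Set Implicit Arguments.
Unset Strict Implicit.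
Unset Printing Implicit Defensive.
Import Order.TTheory GRing.Theory Num.Theory.
Import numFieldNormedType.Exports.

Local Open Scope classical_set_scope.
Local Open Scope ring_scope.

(* R^n carries the sigma-algebra generated by its coordinates, i.e. the Borel
   one (same construction as the library's for n.-tuple R). *)
Definition measure_cV_display : measure_display.
Proof. exact: default_measure_display. Qed.

Section measurable_cV.
Context (R : realType) (n : nat).

Let coor (i : 'I_n) (x : 'cV[R]_n) : R := x i ord0.

Let cV_set0 : g_sigma_preimage coor set0.
Proof. exact: sigma_algebra0. Qed.

Let cV_setC A : g_sigma_preimage coor A -> g_sigma_preimage coor (~` A).
Proof. exact: sigma_algebraC. Qed.

Let cV_bigcup (F : (set 'cV[R]_n)^nat) :
  (forall i, g_sigma_preimage coor (F i)) ->
  g_sigma_preimage coor (\bigcup_i F i).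
Proof. exact: sigma_algebra_bigcup. Qed.

HB.instance Definition _ :=
  @isMeasurable.Build measure_cV_display 'cV[R]_n
    (g_sigma_preimage coor) cV_set0 cV_setC cV_bigcup.

Lemma measurable_coor (i : 'I_n) :
  measurable_fun [set: 'cV[R]_n] (fun x => x i ord0).
Proof.
move=> _ Y mY; rewrite setTI; apply: sub_sigma_algebra => /=.
rewrite -bigcup_seq/=; exists i => /=; first by rewrite mem_index_enum.
by exists Y => //; rewrite setTI.
Qed.

Lemma measurable_fun_cV d (T : measurableType d) (f : T -> 'cV[R]_n) :
  (forall i, measurable_fun [set: T] (fun x => f x i ord0)) ->
  measurable_fun [set: T] f.
Proof.
move=> mf _ A; rewrite setTI.
have sub : g_sigma_preimage coor `<=` (fun A => measurable (f @^-1` A)).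
  apply: smallest_sub.
    split.
    - by rewrite /= preimage_set0.
    - by move=> B mB; rewrite /= setTD preimage_setC; exact: measurableC.
    - by move=> F mF; rewrite /= preimage_bigcup; exact: bigcupT_measurable.
  rewrite -bigcup_seq => B [i _ [C mC <-]] /=.
  rewrite setTI; rewrite -[X in measurable X]setTI; exact: mf.
by move=> mA; apply: sub.
Qed.

End measurable_cV.

Definition enorm (R : realType) n (x : 'cV[R]_n) : R :=
  Num.sqrt (\sum_i x i ord0 ^+ 2).

Definition frob (R : realType) m n (A : 'M[R]_(m, n)) : R :=
  Num.sqrt (\sum_i \sum_j A i j ^+ 2).

Section uniform_distribution.
Context (R : realType).

Lemma measurable_enorm n : measurable_fun [set: 'cV[R]_n] (@enorm R n).
Proof.
apply: (@measurableT_comp _ _ _ _ _ _ (@Num.sqrt R)).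
  by apply: continuous_measurable_fun; exact: sqrt_continuous.
apply: measurable_sum => i; apply: measurable_funX; exact: measurable_coor.
Qed.

Definition cons_tuple n (p : measurableTypeR R * n.-tuple R) : n.+1.-tuple R :=
  [the n.+1.-tuple R of p.1 :: p.2].

Lemma measurable_cons_tuple n : measurable_fun [set: _] (@cons_tuple n).
Proof. exact: measurable_cons. Qed.

HB.instance Definition _ n :=
  isMeasurableFun.Build _ _ _ _ (@cons_tuple n) (@measurable_cons_tuple n).

Definition std_normal : probability (measurableTypeR R) R := normal_prob 0 1.

(* law of n independent N(0, 1) variables *)
Fixpoint gaussian_tuple n : probability (n.-tuple R) R :=
  match n with
  | 0%N => dirac [tuple]
  | m.+1 => distribution (std_normal \x gaussian_tuple m)%E (@cons_tuple m)
  end.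

Definition col_tuple n (t : n.-tuple R) : 'cV[R]_n := \col_i tnth t i.

Lemma measurable_col_tuple n : measurable_fun [set: _] (@col_tuple n).
Proof.
apply: measurable_fun_cV => i.
under eq_fun do rewrite mxE; exact: measurable_tnth.
Qed.

HB.instance Definition _ n :=
  isMeasurableFun.Build _ _ _ _ (@col_tuple n) (@measurable_col_tuple n).

(* N(0, I_n) *)
Definition gaussian n : probability 'cV[R]_n R :=
  distribution (gaussian_tuple n) (@col_tuple n).

Definition to_sphere n (r : R) (x : 'cV[R]_n) : 'cV[R]_n :=
  (r / enorm x) *: x.

Lemma measurable_to_sphere n r : measurable_fun [set: _] (@to_sphere n r).
Proof.
apply: measurable_fun_cV => i.
under eq_fun do rewrite mxE.
apply: measurable_funM; last exact: measurable_coor.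
apply: measurable_funM => //.
under eq_fun do rewrite -powR_inv1 ?sqrtr_ge0//.
apply: (@measurableT_comp _ _ _ _ _ _ (fun a : R => a `^ (-1))) => //.
exact: measurable_enorm.
Qed.

HB.instance Definition _ n r :=
  isMeasurableFun.Build _ _ _ _ (@to_sphere n r) (@measurable_to_sphere n r).

(* Unif(S^{n-1}(r)); that r * x / |x| is 0 at x = 0 is immaterial *)
Definition unif_sphere n (r : R) : probability 'cV[R]_n R :=
  distribution (gaussian n) (@to_sphere n r).

End uniform_distribution.

(* Functions on S^{n-1}(r) are encoded as Borel functions on R^n, whose values
   off the sphere play no role. *)
Section sobolev.
Context (R : realType) (n : nat) (r : R).
Implicit Types (h f : 'cV[R]_n -> R) (g : 'cV[R]_n -> 'cV[R]_n) (alpha : R).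

Local Notation mu := (@unif_sphere R n r).

Definition sphere_ext h : 'cV[R]_n -> R := h \o to_sphere r.

Definition partial (i : 'I_n) h : 'cV[R]_n -> R :=
  'D_(delta_mx i ord0) h.

Definition sphere_grad h (x : 'cV[R]_n) : 'cV[R]_n :=
  \col_i partial i (sphere_ext h) x.

(* The extension is C^oo away from 0: its iterated partial derivatives of all
   orders are differentiable there. *)
Definition sphere_smooth h : Prop :=
  measurable_fun [set: 'cV[R]_n] h /\
  forall (s : seq 'I_n) (x : 'cV[R]_n), x != 0 ->
    differentiable (foldr partial (sphere_ext h) s) x.

Definition Lnorm_fun alpha h : \bar R := 'N[mu]_(alpha%:E)[EFin \o h]%E.

Definition Lnorm_vec alpha g : \bar R := Lnorm_fun alpha (@enorm R n \o g).

Definition sobolev_norm alpha h : \bar R :=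
  (Lnorm_fun alpha h + Lnorm_vec alpha (sphere_grad h))%E.

Definition sobolev_cauchy alpha (h : nat -> 'cV[R]_n -> R) : Prop :=
  forall e : R, 0 < e -> exists N, forall i j, (N <= i)%N -> (N <= j)%N ->
    (sobolev_norm alpha (h i \- h j)%R < e%:E)%E.

(* An element of W^{1,alpha}(S^{n-1}(r)), i.e. of the completion of the smooth
   functions, is given by a Cauchy sequence h of smooth functions.  It is
   recorded through Borel representatives of the L^alpha limits of h and of the
   gradients of h: its value as a function and its (extended) gradient. *)
Record sobolev alpha := Sobolev {
  sobolev_fun :> 'cV[R]_n -> R;
  sobolev_grad : 'cV[R]_n -> 'cV[R]_n;
  measurable_sobolev_fun : measurable_fun [set: 'cV[R]_n] sobolev_fun;
  measurable_sobolev_grad : measurable_fun [set: 'cV[R]_n] sobolev_grad;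
  sobolev_completion : exists h : nat -> 'cV[R]_n -> R,
    [/\ forall k, sphere_smooth (h k),
        sobolev_cauchy alpha h,
        Lnorm_fun alpha (h k \- sobolev_fun) @[k --> \oo] --> 0%E &
        Lnorm_vec alpha (sphere_grad (h k) \- sobolev_grad) @[k --> \oo]
          --> 0%E] }.

End sobolev.

Section sobolev_vector.
Context (R : realType) (n : nat) (r alpha : R).
Variable f : 'I_n -> sobolev n r alpha.

Definition sobolev_vec (x : 'cV[R]_n) : 'cV[R]_n := \col_i f i x.

(* the matrix with columns grad f_i *)
Definition sobolev_gradmx (x : 'cV[R]_n) : 'M[R]_n :=
  \matrix_(i, j) sobolev_grad (f j) x i ord0.

End sobolev_vector.

Definition proj_perp (R : realType) n (x : 'cV[R]_n) : 'M[R]_n :=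
  1%:M - (enorm x ^+ 2)^-1 *: (x *m x^T).

Definition dotp (R : realType) n (x y : 'cV[R]_n) : R := (x^T *m y) ord0 ord0.

Definition expectation_vec d (T : measurableType d) (R : realType)
    (P : probability T R) n (X : T -> 'cV[R]_n) : 'cV[R]_n :=
  \col_i fine ('E_P[fun w => X w i ord0])%E.

Definition is_unif_sphere d (T : measurableType d) (R : realType)
    (P : probability T R) n (z : {RV P >-> 'cV[R]_n}) (r : R) : Prop :=
  forall B : set 'cV[R]_n, measurable B ->
    distribution P z B = unif_sphere n r B.

(* Main.v *)
(* Everything is computed under the Gaussian law of x, a function f on the sphere
   being replaced by its extension to R^n constant on rays.  Write
   D_i f = |x| d_i f and p = x / |x|.  Stein's identity gives
   E[D_i f] = (n - 1) E[p_i f], which is the first claim.  Since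
   D_i D_j - D_j D_i = p_i D_j - p_j D_i, two integrations by parts express
   E[D_i f D_j g] - E[D_j f D_i g] through integrals of p_i f, p_j g, D_i f and
   D_j g; summing over i, j with f = f_i, g = f_j gives the second moment
   identity.  For the variance bound, the one-dimensional Gaussian Poincare
   inequality and Efron-Stein give Var f <= E |grad f|^2 = sum_i E[|x|^-2 (D_i f)^2],
   and E[|x|^-2 k] <= E[k] / (n - 2) for k >= 0 constant on rays, again by
   Stein's identity.  All three statements then pass to L1 and L2 limits. *)
Require Import Defs.
From mathcomp Require Import all_boot all_order all_algebra.
From mathcomp Require Import all_classical all_reals all_analysis.
From mathcomp Require Import measurable_realfun ring lra.
Import Order.TTheory GRing.Theory Num.Theory.
Import numFieldNormedType.Exports.
Set Implicit Arguments.
Unset Strict Implicit.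
Unset Printing Implicit Defensive.
Local Open Scope classical_set_scope.
Local Open Scope ring_scope.

(** * Gaussian measure on the line *)

(** The uniform law is by definition the image of N(0, I_n) under x -> r x / |x|, so Gaussian
    integrals reach it without surface measure or charts. The price is the origin, where a function
    constant on rays is in general discontinuous. One-dimensional facts are therefore applied along
    lines parallel to the i-th axis: such a line misses the origin as soon as some other coordinate
    is nonzero, which holds almost surely when n >= 2. The operator D_i replaces d_i because it
    preserves constancy on rays, and smooth functions of that kind are bounded, by compactness of
    the unit sphere; integrability is then immediate until the limits are taken. Independence of |x|
    and x / |x| enters only as E[|x|^2 k] = n E[k], itself a consequence of Stein's identity. The
    two factors n - 2 have different origins: in the variance bound 1 / (n - 2) is E[|x|^-2], while
    in the second moment identity n - 2 is the n - 1 of integration by parts minus the 1 of the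
    commutator. *)

Section standard_normal_density.
Context {R : realType}.
Notation leb := (@lebesgue_measure R).
Notation pdf := (@normal_pdf R 0 1).

Import HBNNSimple.

(** For indicators this is the definition of [normal_prob]; simple functions and monotone
    convergence along [nnsfun_approx] do the rest. *)
Lemma ge0_integral_normal (F : measurableTypeR R -> \bar R) : measurable_fun setT F ->
  (forall x, 0 <= F x)%E ->
  (\int[std_normal R]_x F x = \int[leb]_x (F x * (pdf x)%:E))%E.
Proof.
move=> mF F0.
have mpdf : measurable_fun setT (fun x => (pdf x)%:E).
  by apply/measurable_EFinP; exact: measurable_normal_pdf.
have pdf0 x : (0 <= (pdf x)%:E)%E by rewrite lee_fin normal_pdf_ge0.
pose f_ := nnsfun_approx measurableT mF.
have cvf x : (EFin \o f_^~ x) @ \oo --> F x by exact: cvg_nnsfun_approx.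
have ndf x : {homo (fun n => (f_ n x)%:E) : n m / (n <= m)%N >-> (n <= m)%E}.
  by move=> n m nm; rewrite lee_fin; exact/lefP/nd_nnsfun_approx.
transitivity (limn (fun n => \int[std_normal R]_x (f_ n x)%:E))%E.
  rewrite -monotone_convergence//=.
  - by apply: eq_integral => x _; apply/esym/cvg_lim => //; exact: cvf.
  - by move=> n; exact/measurable_EFinP.
  - by move=> n x _; rewrite lee_fin.
transitivity (limn (fun n => \int[leb]_x ((f_ n x)%:E * (pdf x)%:E)))%E; last first.
  rewrite -monotone_convergence//=.
  - apply: eq_integral => x _; apply/cvg_lim => //; apply: cvgeZr => //.
    exact: cvf.
  - by move=> n; apply: emeasurable_funM => //; exact/measurable_EFinP/measurable_funTS.
  - by move=> n ? _; rewrite mule_ge0// lee_fin.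
  - by move=> x _ n m nm; rewrite lee_pmul// ?lee_fin//; exact/lefP/nd_nnsfun_approx.
apply: congr_lim; apply/funext => n /=.
under eq_integral do rewrite fimfunE -fsumEFin//.
rewrite ge0_integral_fsum//; last 2 first.
  - by move=> r; exact/measurable_EFinP/measurableT_comp.
  - by move=> m x _; rewrite EFinM nnfun_muleindic_ge0.
under [RHS]eq_integral.
  move=> x xD; rewrite fimfunE -fsumEFin// ge0_mule_fsuml; last first.
    by move=> r; rewrite EFinM nnfun_muleindic_ge0.
  over.
rewrite [RHS]ge0_integral_fsum//; last 2 first.
  - move=> r; apply: emeasurable_funM => //.
    by apply/measurable_EFinP; do 2 apply/measurableT_comp => //.
  - move=> m x _; rewrite EFinM mule_ge0//; last by rewrite nnfun_muleindic_ge0.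
apply: eq_fsbigr => r _.
rewrite integralZl_indic_nnsfun//= integral_indic//= setIT /normal_prob.
under [RHS]eq_integral do rewrite EFinM -muleA.
have [r0|r0] := leP 0%R r.
  rewrite ge0_integralZl//; first last.
  - by move=> x _; rewrite mule_ge0// lee_fin.
  - by apply: emeasurable_funM => //; exact/measurable_EFinP.
  congr (_ * _)%E; rewrite [LHS]integral_mkcond/=; apply: eq_integral => x _.
  rewrite patchE indicE; case: ifPn => xr; first by rewrite mul1e.
  by rewrite mul0e.
(* A negative r is not a value of the nonnegative [f_ n], so its level set is empty and both sides
   vanish. *)
rewrite (_ : f_ n @^-1` [set r] = set0) ?integral_set0 ?mule0; last first.
  rewrite -subset0 => x /= fr; have : (0 <= f_ n x)%R by [].
  by rewrite fr leNgt r0.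
by under eq_integral do rewrite indic0 mul0e mule0; rewrite integral0.
Qed.

Lemma std_normal_set1 (a : R) : std_normal R [set a] = 0%E.
Proof.
rewrite /std_normal/= /normal_prob integral_set1//.
Qed.

Lemma pdfE x : pdf x = normal_peak 1 * expR (- (x ^+ 2 / 2)).
Proof.
by rewrite normal_pdfE ?oner_eq0// /normal_fun subr0 expr1n mulNr.
Qed.

Lemma is_derive_pdf (x : R) : is_derive x 1 pdf (- (x * pdf x)).
Proof.
rewrite (_ : pdf = fun x => normal_peak 1 * expR (- (x ^+ 2 / 2))); last first.
  by apply/funext => y; rewrite pdfE.
have h : is_derive x 1 (fun y : R => - (y ^+ 2 / 2)) (- x).
  apply: is_derive_eq; rewrite -/(GRing.scale _ _) /GRing.scale/=.
  by field.
apply: is_derive_eq; rewrite /GRing.scale/=; ring.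
Qed.

Lemma continuous_pdf : continuous pdf.
Proof. by apply: continuous_normal_pdf; rewrite oner_eq0. Qed.

Lemma pdf_ge0 x : 0 <= pdf x. Proof. exact: normal_pdf_ge0. Qed.

End standard_normal_density.

Lemma dominated_integrable d (T : measurableType d) (R : realType)
    (mu : {measure set T -> \bar R}) (f g : T -> R) :
  measurable_fun setT f -> (forall x, `|f x| <= g x) ->
  mu.-integrable setT (EFin \o g) -> mu.-integrable setT (EFin \o f).
Proof.
move=> mf fg; apply: le_integrable => //; first exact/measurable_EFinP.
by move=> x _; rewrite /= lee_fin (le_trans (fg x))// ler_norm.
Qed.

Lemma bounded_integrable d (T : measurableType d) (R : realType)
    (mu : probability T R) (f : T -> R) (C : R) :
  measurable_fun setT f -> (forall x, `|f x| <= C) ->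
  mu.-integrable setT (EFin \o f).
Proof.
move=> mf fC; apply: (dominated_integrable (g := cst C)) => //.
exact: finite_measure_integrable_cst.
Qed.

Section standard_normal.
Context {R : realType}.
Notation leb := (@lebesgue_measure R).
Notation pdf := (@normal_pdf R 0 1).

Lemma is_derive_continuous (f : R -> R) (df x : R) :
  is_derive x 1 f df -> {for x, continuous f}.
Proof.
by case=> df' _; apply: differentiable_continuous; exact/derivable1_diffP.
Qed.

Lemma continuous_mulr (f g : R -> R) : continuous f -> continuous g ->
  continuous (fun x => f x * g x).
Proof. by move=> cf cg x; apply: continuousM; [exact: cf|exact: cg]. Qed.

Lemma within_continuous_mulr (A : set R) (f g : R -> R) : {within A, continuous f} ->
  {within A, continuous g} -> {within A, continuous (fun x => f x * g x)}.
Proof.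
by move=> cf cg x; apply: (@continuousM R (subspace A)); [exact: cf|exact: cg].
Qed.

Lemma ftc_cc (F f : R -> R) (a b : R) : a < b ->
  (forall x, a <= x <= b -> is_derive x 1 F (f x)) ->
  {within `[a, b], continuous f} ->
  (\int[leb]_(x in `[a, b]) (f x)%:E = (F b - F a)%:E)%E.
Proof.
move=> ab dF cf; rewrite (@continuous_FTC2 _ f F)//.
- split.
  + move=> x; rewrite in_itv/= => /andP[ax xb].
    by have [] : is_derive x 1 F (f x) by apply: dF; rewrite !ltW.
  + apply: cvg_at_right_filter; apply: (@is_derive_continuous _ (f a)).
    by apply: dF; rewrite lexx ltW.
  + apply: cvg_at_left_filter; apply: (@is_derive_continuous _ (f b)).
    by apply: dF; rewrite lexx ltW.
- move=> x; rewrite in_itv/= => /andP[ax xb].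
  have [_ <-] : is_derive x 1 F (f x) by apply: dF; rewrite !ltW.
  by rewrite derive1E.
Qed.

(* With a := (u x - u 0) / x, the function G s - 2 a u s + a^2 s has derivative (u' s - a)^2 >= 0. *)
Lemma sqr_increment_le (u du G : R -> R) (x : R) : G 0 = 0 ->
  (forall s : R, `|s| <= `|x| -> is_derive s 1 u (du s)) ->
  (forall s : R, `|s| <= `|x| -> is_derive s 1 G (du s ^+ 2)) ->
  (u x - u 0) ^+ 2 <= x * G x.
Proof.
move=> G0 duP dG.
have [->|x0] := eqVneq x 0; first by rewrite subrr expr0n mul0r.
pose a := (u x - u 0) / x.
pose H s := G s - (2 * a) * u s + a ^+ 2 * s.
have dH (s : R) : `|s| <= `|x| -> is_derive s 1 H ((du s - a) ^+ 2).
  move=> sx; have h1 := duP s sx; have h2 := dG s sx.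
  apply: is_derive_eq; rewrite /GRing.scale/=; ring.
have uxE : u x = u 0 + a * x by rewrite /a divfK// addrC subrK.
have [xgt0|xlt0|x00] := ltgtP 0 x; last by rewrite x00 eqxx in x0.
- have [|| c _ Hc] := @MVT R H (fun s => (du s - a) ^+ 2) 0 x xgt0.
  + move=> s; rewrite in_itv/= => /andP[s0 sx]; apply: dH.
    by rewrite !gtr0_norm// ltW.
  + apply: derivable_within_continuous => s; rewrite in_itv/= => /andP[s0 sx].
    by have [] : is_derive s 1 H ((du s - a) ^+ 2)
      by apply: dH; rewrite !ger0_norm// ltW.
  have : 0 <= (du c - a) ^+ 2 * (x - 0) by rewrite subr0 mulr_ge0 ?sqr_ge0 ?ltW.
  rewrite -Hc /H G0 uxE => h.
  rewrite (_ : u 0 + a * x - u 0 = a * x); last by ring.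
  rewrite exprMn expr2 mulrCA ler_pM2l//; nra.
(* For x < 0 the mean value theorem runs from x to 0 and gives G x <= a^2 x; multiplication by the
   negative x restores the direction. *)
- have [|| c _ Hc] := @MVT R H (fun s => (du s - a) ^+ 2) x 0 xlt0.
  + move=> s; rewrite in_itv/= => /andP[s0 sx]; apply: dH.
    by rewrite !ltr0_norm// lerN2 ltW.
  + apply: derivable_within_continuous => s; rewrite in_itv/= => /andP[s0 sx].
    by have [] : is_derive s 1 H ((du s - a) ^+ 2)
      by apply: dH; rewrite (ltr0_norm xlt0) ler0_norm// lerN2.
  have : 0 <= (du c - a) ^+ 2 * (0 - x) by rewrite sub0r mulr_ge0 ?sqr_ge0 ?oppr_ge0 ?ltW.
  rewrite -Hc /H G0 uxE => h.
  rewrite (_ : u 0 + a * x - u 0 = a * x); last by ring.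
  rewrite exprMn expr2 mulrCA ler_nM2l//; nra.
Qed.

(** The integral starts at -(M + 1) and is considered up to M + 1, so that every point of [-M, M] is
    interior and the derivative there is two-sided, endpoints included. *)
Lemma continuous_primitive (f : R -> R) (M : R) : continuous f -> 0 < M ->
  exists2 G : R -> R, G 0 = 0 &
    forall x, - M <= x <= M -> is_derive x 1 G (f x).
Proof.
move=> cf M0.
pose F x := (\int[leb]_(t in `[- (M + 1), x]) f t)%R.
exists (fun x => F x - F 0); first by rewrite subrr.
move=> x /andP[Mx xM].
have fi : leb.-integrable `[- (M + 1), M + 1] (EFin \o f).
  apply: continuous_compact_integrable; first exact: segment_compact.
  exact: continuous_subspaceT.
have xM1 : x < M + 1 by lra.
have [||dF F'] := @continuous_FTC1 R f (BLeft (- (M + 1))) x (M + 1) xM1 fi.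
- by have ax : - (M + 1) < x by lra.
- exact: cf.
have h : is_derive x 1 F (f x).
  exact: (DeriveDef dF (etrans (esym (derive1E F x)) F')).
by apply: is_derive_eq; rewrite subr0.
Qed.

Lemma integrable_cc (f : R -> R) (a b : R) : {within `[a, b], continuous f} ->
  leb.-integrable `[a, b] (EFin \o f).
Proof.
by move=> cf; apply: continuous_compact_integrable => //; exact: segment_compact.
Qed.

(* Klaassen's argument: with G' = u'^2 and G 0 = 0 one has (u x - u 0)^2 <= x G x,
   while u'^2 pdf - x G pdf = (G pdf)' has integral (G N - G (- N)) pdf N >= 0. *)
Lemma poincare_normal_cc (u du : R -> R) (N : R) : 0 < N ->
  (forall x : R, is_derive x 1 u (du x)) -> continuous du ->
  (\int[leb]_(x in `[(- N)%R, N]) (((u x - u 0) ^+ 2) * pdf x)%:E <=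
   \int[leb]_(x in `[(- N)%R, N]) ((du x ^+ 2) * pdf x)%:E)%E.
Proof.
move=> N0 duP cdu.
have cu : continuous u by move=> x; exact: is_derive_continuous (duP x).
have cdu2 : continuous (fun x => du x ^+ 2).
  by move=> x; exact: (continuousM (cdu x) (cdu x)).
have cu2 : continuous (fun x => (u x - u 0) ^+ 2).
  have cu1 : continuous (fun x => u x - u 0).
    by move=> x; apply: (@continuousB _ R^o); [exact: cu|exact: cst_continuous].
  by move=> x; exact: (continuousM (cu1 x) (cu1 x)).
have [G G0 dG] := continuous_primitive cdu2 N0.
have key x : - N <= x <= N -> (u x - u 0) ^+ 2 <= x * G x.
  move=> /andP[Nx xN]; apply: sqr_increment_le G0 _ _ => // s sx; apply: dG.
  by rewrite -ler_norml (le_trans sx)// ler_norml Nx.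
have GN : 0 <= G N.
  have := key N; rewrite lexx andbT -(pmulr_rge0 (G N) N0) => h.
  by apply: le_trans (h _); [exact: sqr_ge0|lra].
have GN' : G (- N) <= 0.
  have := key (- N); rewrite lexx/= => h.
  have : 0 <= - N * G (- N) by apply: le_trans (h _); [exact: sqr_ge0|lra].
  by rewrite mulNr oppr_ge0 pmulr_rle0.
have NN : - N < N by lra.
have cG : {within `[- N, N], continuous G}.
  apply: derivable_within_continuous => x; rewrite in_itv/= => xN.
  by have [] := dG x xN.
have cpdf A : {within A, continuous pdf} by apply: continuous_subspaceT; exact: continuous_pdf.
have cA : {within `[- N, N], continuous (fun x => du x ^+ 2 * pdf x)}.
  exact/continuous_subspaceT/(continuous_mulr cdu2)/continuous_pdf.
have cB : {within `[- N, N], continuous (fun x => x * G x * pdf x)}.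
  apply: within_continuous_mulr; last exact: cpdf.
  apply: within_continuous_mulr => //.
  by apply: continuous_subspaceT => y; exact: cvg_id.
have ftc : (\int[leb]_(x in `[(- N)%R, N]) ((du x ^+ 2 * pdf x - x * G x * pdf x)%:E) =
    (G N * pdf N - G (- N) * pdf (- N))%:E)%E.
  apply: (ftc_cc (F := fun x => G x * pdf x)) => //.
    move=> x xN; have h1 := dG x xN; have h2 := is_derive_pdf x.
    apply: is_derive_eq; rewrite /GRing.scale/=; ring.
  exact: (within_continuousB cA cB).
have i1 : leb.-integrable `[- N, N] (EFin \o (fun x => du x ^+ 2 * pdf x)).
  exact: integrable_cc.
have i2 : leb.-integrable `[- N, N] (EFin \o (fun x => (u x - u 0) ^+ 2 * pdf x)).
  exact/integrable_cc/continuous_subspaceT/(continuous_mulr cu2)/continuous_pdf.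
have i3 : leb.-integrable `[- N, N] (EFin \o (fun x => x * G x * pdf x)).
  exact: integrable_cc.
apply: (@le_trans _ _ (\int[leb]_(x in `[(- N)%R, N]) ((x * G x * pdf x)%:E))%E).
  apply: le_integral => //= x; rewrite inE/= in_itv/= => xN.
  by rewrite lee_fin ler_wpM2r ?pdf_ge0// key.
have : (0 <= \int[leb]_(x in `[(- N)%R, N]) ((du x ^+ 2 * pdf x - x * G x * pdf x)%:E))%E.
  rewrite ftc lee_fin subr_ge0 (@le_trans _ _ 0)//.
    by rewrite mulr_le0_ge0 ?pdf_ge0.
  by rewrite mulr_ge0 ?pdf_ge0.
under eq_integral do rewrite EFinB.
rewrite integralB//= sube_ge0//.
by apply/orP; left; exact: integrable_fin_num.
Qed.

(** The successor keeps the half-length positive already at index 0, as [poincare_normal_cc]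
    requires. *)
Definition sym_itv (i : nat) : set R := `[- i.+1%:R, i.+1%:R].

Lemma nondecreasing_sym_itv : nondecreasing_seq sym_itv.
Proof.
move=> n m nm; apply/subsetPset => x; rewrite /sym_itv/=; rewrite !in_itv/= => /andP[nx xn].
have : n.+1%:R <= m.+1%:R :> R by rewrite ler_nat ltnS.
lra.
Qed.

Lemma bigcup_sym_itv : \bigcup_i sym_itv i = setT.
Proof.
apply/seteqP; split => // x _; exists (Num.bound x) => //.
rewrite /sym_itv /= in_itv/= -ler_norml.
have := archi_boundP (normr_ge0 x).
have : (Num.bound x)%:R <= (Num.bound x).+1%:R :> R by rewrite ler_nat.
have := unstable.ltr_norm_bound x.
lra.
Qed.

(** Centering at u 0 is what Klaassen's argument yields, and it is stronger than a bound on the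
    variance. Both sides are extended reals, so the passage from [-N, N] to the line asks for no
    growth condition on u. *)
Lemma poincare_normal (u du : R -> R) :
  (forall x : R, is_derive x 1 u (du x)) -> continuous du ->
  (\int[std_normal R]_x ((u x - u 0) ^+ 2)%:E <=
   \int[std_normal R]_x (du x ^+ 2)%:E)%E.
Proof.
move=> duP cdu.
have cu : continuous u by move=> x; exact: is_derive_continuous (duP x).
have cdu2 : continuous (fun x => du x ^+ 2).
  by move=> x; exact: (continuousM (cdu x) (cdu x)).
have cu2 : continuous (fun x => (u x - u 0) ^+ 2).
  have cu1 : continuous (fun x => u x - u 0).
    by move=> x; apply: (@continuousB _ R^o); [exact: cu|exact: cst_continuous].
  by move=> x; exact: (continuousM (cu1 x) (cu1 x)).
have mdu2 : measurable_fun setT (fun x => (du x ^+ 2)).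
  exact: continuous_measurable_fun.
have mu2 : measurable_fun setT (fun x => (u x - u 0) ^+ 2).
  exact: continuous_measurable_fun.
rewrite !ge0_integral_normal; first last.
- by move=> x; rewrite lee_fin sqr_ge0.
- exact/measurable_EFinP.
- by move=> x; rewrite lee_fin sqr_ge0.
- exact/measurable_EFinP.
have mpdf : measurable_fun setT pdf by exact: measurable_normal_pdf.
have mF : measurable_fun setT (fun x => (((u x - u 0) ^+ 2)%:E * (pdf x)%:E)%E).
  by apply: emeasurable_funM; exact/measurable_EFinP.
have mF' : measurable_fun setT (fun x => ((du x ^+ 2)%:E * (pdf x)%:E)%E).
  by apply: emeasurable_funM; exact/measurable_EFinP.
rewrite -bigcup_sym_itv.
have := @ge0_nondecreasing_set_cvg_integral _ (measurableTypeR R) R sym_itv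
  (fun x => (((u x - u 0) ^+ 2)%:E * (pdf x)%:E)%E) leb nondecreasing_sym_itv.
move=> /(_ _ _ _)/cvge_to_le; apply.
- by move=> i; exact: measurable_itv.
- by move=> i; exact: measurable_funTS.
- by move=> i x _; rewrite mule_ge0// lee_fin ?sqr_ge0 ?pdf_ge0.
apply: nearW => i.
apply: (@le_trans _ _ (\int[leb]_(x in sym_itv i) ((du x ^+ 2)%:E * (pdf x)%:E))%E).
  by have := @poincare_normal_cc u du i.+1%:R (ltr0Sn _ _) duP cdu; under eq_integral do rewrite EFinM; under [X in (_ <= X)%E]eq_integral do rewrite EFinM.
rewrite bigcup_sym_itv; apply: ge0_subset_integral => //.
- exact: measurable_itv.
- by move=> x _; rewrite mule_ge0// lee_fin ?sqr_ge0 ?pdf_ge0.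
Qed.

(** Poincare's inequality for the identity function bounds the second moment without computing a
    Gaussian integral. *)
Lemma normal_sqr_le1 : (\int[std_normal R]_x (x ^+ 2)%:E <= 1)%E.
Proof.
have c1 : continuous (cst (1 : R) : R -> R) by move=> x; exact: cst_continuous.
have := @poincare_normal id (cst 1) (fun x => is_derive_id _ _) c1.
under eq_integral do rewrite /= subr0.
move=> /le_trans; apply; under eq_integral do rewrite expr1n.
by rewrite integral_cst// mul1e probability_le1.
Qed.

Lemma integral_normal (W : R -> R) :
  measurable_fun setT W ->
  (std_normal R).-integrable setT (EFin \o W) ->
  leb.-integrable setT (fun x => (W x * pdf x)%:E) /\
  (\int[std_normal R]_x (W x)%:E = \int[leb]_x (W x * pdf x)%:E)%E.
Proof.
move=> mW iW.
have mpdf : measurable_fun setT pdf by exact: measurable_normal_pdf.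
split.
  apply/integrableP; split; first by apply/measurable_EFinP/measurable_funM.
  have /integrableP[_] := iW; apply: le_lt_trans.
  rewrite ge0_integral_normal//; last first.
    by apply: measurableT_comp => //; exact/measurable_EFinP.
  by under eq_integral do rewrite EFinM abseM [X in (_ * X)%E]gee0_abs ?lee_fin ?pdf_ge0//.
rewrite integralE [RHS]integralE.
rewrite !ge0_integral_normal//; first last.
- by apply: measurable_funepos; exact/measurable_EFinP.
- by apply: measurable_funeneg; exact/measurable_EFinP.
congr (_ - _)%E; apply: eq_integral => x _.
- rewrite !funeposE; have := pdf_ge0 x.
  have [w0|/ltW w0] := leP 0%R (W x) => p0.
    by rewrite !max_l// lee_fin ?mulr_ge0.
  have wp : W x * pdf x <= 0 by rewrite mulr_le0_ge0.
  by rewrite !max_r ?mul0e// lee_fin.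
- rewrite !funenegE; have := pdf_ge0 x.
  have [w0|/ltW w0] := leP 0%R (W x) => p0.
    by rewrite !max_r ?mul0e// -EFinN lee_fin oppr_le0 ?mulr_ge0.
  have wp : W x * pdf x <= 0 by rewrite mulr_le0_ge0.
  by rewrite !max_l -?EFinN ?lee_fin ?oppr_ge0// -EFinM mulNr.
Qed.

Definition lin_growth (u : R -> R) := exists A, forall x, `|u x| <= A * (1 + `|x|).

(** The integrand times the density is the derivative of -u pdf. Over [-N, N] only boundary terms
    remain; linear growth makes them vanish as N grows and supplies the domination for the limit of
    the integrals. *)
Lemma stein_normal (u du : R -> R) :
  (forall x : R, is_derive x 1 u (du x)) -> continuous du ->
  lin_growth u -> lin_growth du ->
  (std_normal R).-integrable setT (fun x => (x * u x - du x)%:E) /\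
  (\int[std_normal R]_x (x * u x - du x)%:E = 0)%E.
Proof.
move=> duP cdu [A uA] [B duB].
have cu : continuous u by move=> x; exact: is_derive_continuous (duP x).
have mdu : measurable_fun setT du by exact: continuous_measurable_fun.
have mu : measurable_fun setT u by exact: continuous_measurable_fun.
have mW : measurable_fun setT (fun x : R => x * u x - du x).
  by apply: measurable_funB => //; exact: measurable_funM.
have A0 : 0 <= A by have := uA 0; rewrite normr0 addr0 mulr1; exact: le_trans.
have B0 : 0 <= B by have := duB 0; rewrite normr0 addr0 mulr1; exact: le_trans.
have bW x : `|x * u x - du x| <= (2 * A + B) * 2 * (1 + x ^+ 2).
  have := uA x; have := duB x; rewrite -(real_normK (num_real x)).
  have := ler_normB (x * u x) (du x); rewrite normrM.
  have := normr_ge0 x; have := normr_ge0 (u x); move: `|_| `|_| `|_| `|_| => a b c e e0 c0 h ha he.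
  have h1 : c * e <= c * (A * (1 + c)) by rewrite ler_wpM2l.
  have h2 : 0 <= A * (1 - c) ^+ 2 by rewrite mulr_ge0// sqr_ge0.
  have h3 : 0 <= B * (1 - c) ^+ 2 by rewrite mulr_ge0// sqr_ge0.
  have h4 : 0 <= A * c ^+ 2 by rewrite mulr_ge0// sqr_ge0.
  have h5 : 0 <= B * c ^+ 2 by rewrite mulr_ge0// sqr_ge0.
  nra.
have iW : (std_normal R).-integrable setT (fun x => (x * u x - du x)%:E).
  apply: (dominated_integrable (mu := std_normal R) (g := fun x => (2 * A + B) * 2 * (1 + x ^+ 2))) => //.
  - have : (std_normal R).-integrable setT (EFin \o (fun x : R => x ^+ 2)).
      apply/integrableP; split; first by apply/measurable_EFinP/measurable_funX.
      under eq_integral do rewrite /= ger0_norm ?sqr_ge0//.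
      by rewrite (le_lt_trans normal_sqr_le1)// ltry.
    move=> i2.
    have i1 : (std_normal R).-integrable setT (EFin \o (cst (1 : R))).
      exact: finite_measure_integrable_cst.
    have i3 := integrableD measurableT i1 i2.
    by have := integrableZl measurableT ((2 * A + B) * 2) i3; apply: eq_integrable.
split => //.
have [iL ->] := integral_normal mW iW.
have mpdf : measurable_fun setT pdf by exact: measurable_normal_pdf.
have mWp : measurable_fun setT (fun x : R => (x * u x - du x) * pdf x) by exact: measurable_funM.
pose f_ n := (fun x => ((x * u x - du x) * pdf x)%:E) \_ (sym_itv n).
have intf n : (\int[leb]_x f_ n x =
    (u (- n.+1%:R) * pdf (- n.+1%:R) - u n.+1%:R * pdf n.+1%:R)%:E)%E.
  have dd (x : R) : is_derive x 1 (fun x => - u x * pdf x) ((x * u x - du x) * pdf x).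
    have h1 := duP x; have h2 := is_derive_pdf x.
    apply: is_derive_eq; rewrite /GRing.scale/=; ring.
  have cc : continuous (fun x : R => (x * u x - du x) * pdf x).
    apply: continuous_mulr; last exact: continuous_pdf.
    move=> x; apply: (@continuousB _ R^o R (fun x : R => x * u x)); last exact: cdu.
    by apply: continuous_mulr => // y; exact: cvg_id.
  rewrite -integral_mkcond /sym_itv.
  rewrite (ftc_cc _ (fun x _ => dd x) (continuous_subspaceT cc)).
    by congr EFin; ring.
  by rewrite (@lt_trans _ _ 0)// ?oppr_lt0 ltr0Sn.
have c1 : (\int[leb]_x f_ n x)%E @[n --> \oo] --> (\int[leb]_x ((x * u x - du x) * pdf x)%:E)%E.
  apply: (@dominated_cvg _ (measurableTypeR R) R leb setT measurableT f_ (fun x => ((x * u x - du x) * pdf x)%:E) (fun x => `|((x * u x - du x) * pdf x)%:E|%E)) => //.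
  - move=> n; apply/(measurable_restrictT _ _).1 => //; first exact: measurable_itv.
    by apply/measurable_funTS/measurable_EFinP.
  - move=> x _; have : setT x by []; rewrite -bigcup_sym_itv => -[N _ xN].
    apply: cvg_near_cst; exists N => // n /= Nn.
    by rewrite /f_ patchE mem_set//; have /subsetPset := nondecreasing_sym_itv Nn; apply.
  - exact: integrable_abse.
  - move=> n x _; rewrite /f_ patchE; case: ifPn => // _; by rewrite abse0 abse_ge0.
have c2 : (\int[leb]_x f_ n x)%E @[n --> \oo] --> 0%E.
  under eq_cvg do rewrite intf.
  apply: cvg_EFin; first by exact: nearW.
  (* For |x| >= 1, |u x| <= 2 A |x| and exp (x^2 / 2) >= x^2 / 2, so |u x pdf x| |x| <= 4 A
     [normal_peak 1]. *)
  pose C := 4 * A * normal_peak (1 : R).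
  have C0 : 0 <= C by rewrite !mulr_ge0 ?normal_peak_ge0.
  have bb (x : R) : 1 <= `|x| -> `|u x * pdf x| <= C / `|x|.
    move=> x1; have xgt0 : 0 < `|x| by rewrite (lt_le_trans ltr01).
    rewrite ler_pdivlMr// normrM (ger0_norm (pdf_ge0 x)) pdfE expRN.
    have : `|x| ^+ 2 / 2 <= expR (x ^+ 2 / 2).
      by rewrite real_normK ?num_real// (le_trans _ (expR_ge1Dx _))// lerDr.
    have := expR_gt0 (x ^+ 2 / 2); move: (expR _) => e e0 xe.
    have -> : `|u x| * (normal_peak 1 / e) * `|x| = (`|u x| * `|x|) * normal_peak 1 / e by ring.
    rewrite ler_pdivrMr//.
    have -> : C * e = (e * 4 * A) * normal_peak 1 by rewrite /C; ring.
    apply: ler_wpM2r; first exact: normal_peak_ge0.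
    apply: (@le_trans _ _ ((`|x| ^+ 2 / 2) * 4 * A)); last by do 2 rewrite ler_wpM2r//.
    apply: (@le_trans _ _ (A * (1 + `|x|) * `|x|)); first by rewrite ler_wpM2r.
    have : A * (`|x| * 1) <= A * (`|x| * `|x|) by rewrite !ler_wpM2l.
    lra.
  have bd n : `|u (- n.+1%:R) * pdf (- n.+1%:R) - u n.+1%:R * pdf n.+1%:R| <= (2 * C) * harmonic n.
    apply: (le_trans (ler_normB _ _)).
    have n1 : 1 <= `|n.+1%:R| :> R by rewrite ger0_norm// ler1n.
    have := bb n.+1%:R n1; have := bb (- n.+1%:R); rewrite normrN => /(_ n1).
    move=> h2 h1.
    rewrite (_ : 2 * C * harmonic n = C / `|n.+1%:R| + C / `|n.+1%:R|); first exact: lerD.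
    by rewrite ger0_norm// /harmonic/=; ring.
  have h0 : (2 * C) * harmonic n @[n --> \oo] --> (0 : R).
    by rewrite -[X in _ --> X](mulr0 (2 * C)); apply: cvgMr; exact: cvg_harmonic.
  apply: (@squeeze_cvgr _ _ _ _ (fun n => - ((2 * C) * harmonic n)) (fun n => (2 * C) * harmonic n)) => //.
    by apply: nearW => n; have := bd n; rewrite ler_norml.
  by rewrite -[X in _ --> X]oppr0; apply: (@cvgN _ R^o).
have /cvg_lim <- // := c1.
exact: (cvg_lim _ c2).
Qed.

End standard_normal.

(** * Means and squared deviations under a probability measure *)

Section probability_integrals.
Context d (T : measurableType d) (R : realType) (P : probability T R).

Lemma integral_prob_cst (c : \bar R) : (\int[P]_x c = c)%E.
Proof.
rewrite integral_cst//; set p := (X in (_ * X)%E).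
have -> : p = 1%E by exact: probability_setT.
by rewrite mule1.
Qed.

Lemma Rintegral_prob_cst (c : R) : \int[P]_x c = c.
Proof. by rewrite /Rintegral integral_prob_cst. Qed.

Lemma Rintegral_le_cst (f : T -> R) (C : R) :
  measurable_fun setT f -> (forall x, `|f x| <= C) -> `|\int[P]_x f x| <= C.
Proof.
move=> mf fC; have fi := bounded_integrable P mf fC.
apply: (le_trans (le_normr_Rintegral measurableT fi)).
apply: (@le_trans _ _ (\int[P]_x C)); last by rewrite Rintegral_prob_cst.
apply: le_Rintegral => //.
- apply: (@bounded_integrable _ _ _ _ _ C) => [|x]; last by rewrite normr_id.
  exact: measurableT_comp.
- exact: finite_measure_integrable_cst.
Qed.

Lemma integral_sqr_sub (f : T -> R) (C c : R) :
  measurable_fun setT f -> (forall x, `|f x| <= C) ->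
  (\int[P]_x ((f x - c) ^+ 2)%:E =
   (\int[P]_x (f x ^+ 2) - 2 * c * \int[P]_x f x + c ^+ 2)%:E)%E.
Proof.
move=> mf fC.
have i1 := bounded_integrable P mf fC.
have i2 : P.-integrable setT (EFin \o (fun x => f x ^+ 2)).
  apply: (@bounded_integrable _ _ _ _ _ (C ^+ 2)) => [|x]; first exact: measurable_funX.
  by rewrite normrX lerXn2r// ?nnegrE// (le_trans _ (fC x)).
have i0 : P.-integrable setT (EFin \o cst (c ^+ 2)) by exact: finite_measure_integrable_cst.
have i3 : P.-integrable setT (EFin \o (fun x => 2 * c * f x)).
  by have := integrableZl measurableT (2 * c) i1; apply: eq_integrable.
have i4 : P.-integrable setT (EFin \o (fun x => f x ^+ 2 - 2 * c * f x)).
  by have := integrableB measurableT i2 i3; apply: eq_integrable.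
have i5 : P.-integrable setT (EFin \o (fun x => f x ^+ 2 - 2 * c * f x + c ^+ 2)).
  by have := integrableD measurableT i4 i0; apply: eq_integrable.
rewrite (eq_integral (EFin \o (fun x => f x ^+ 2 - 2 * c * f x + c ^+ 2))); last first.
  by move=> x _ /=; congr EFin; ring.
rewrite -[LHS]fineK ?integrable_fin_num//; congr EFin; rewrite -/(Rintegral _ _ _).
rewrite RintegralD// RintegralB// RintegralZl//.
by rewrite Rintegral_prob_cst.
Qed.

(** Bias plus variance, the variance being at most the squared deviation from any c'. In the
    Efron-Stein induction c' is the value of the function with one coordinate set to 0. *)
Lemma integral_sqr_mean_le (f : T -> R) (C c c' : R) :
  measurable_fun setT f -> (forall x, `|f x| <= C) ->
  (\int[P]_x ((f x - c) ^+ 2)%:E <=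
   \int[P]_x ((f x - c') ^+ 2)%:E + ((\int[P]_x f x - c) ^+ 2)%:E)%E.
Proof.
move=> mf fC; rewrite !(integral_sqr_sub _ mf fC) -EFinD lee_fin.
move: (\int[P]_x (f x ^+ 2)) (\int[P]_x f x) => a b.
have := sqr_ge0 (b - c'); nra.
Qed.

Lemma sqr_Rintegral_le (f : T -> R) (C : R) :
  measurable_fun setT f -> (forall x, `|f x| <= C) ->
  (((\int[P]_x f x) ^+ 2)%:E <= \int[P]_x (f x ^+ 2)%:E)%E.
Proof.
move=> mf fC; have := integral_sqr_sub (\int[P]_x f x) mf fC.
have := integral_sqr_sub 0 mf fC; under eq_integral do rewrite subr0.
move=> -> h; have : (0 <= \int[P]_x0 ((f x0 - \int[P]_x f x)^+2)%:E)%E.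
  by apply: integral_ge0 => x _; rewrite lee_fin sqr_ge0.
rewrite h !lee_fin; nra.
Qed.

End probability_integrals.

(** * Resampling one coordinate and the Efron-Stein inequality *)

Section tuples.
Context {R : realType}.
Notation gt := (@gaussian_tuple R).
Notation gam := (std_normal R).
Notation ctup := (@Defs.cons_tuple R _).

Definition tupd n (i : 'I_n) (s : R) (t : n.-tuple R) : n.-tuple R :=
  [tuple if j == i then s else tnth t j | j < n].

Lemma tupd_cons0 n (s x : R) (y : n.-tuple R) :
  tupd ord0 s (ctup (x, y)) = ctup (s, y).
Proof.
apply: eq_from_tnth => j; rewrite tnth_mktuple.
case: (unliftP ord0 j) => [j' ->|->]; last by rewrite eqxx.
by rewrite eq_sym (negbTE (neq_lift _ _)) !tnthS.
Qed.

Lemma tupd_cons n (i : 'I_n) (s x : R) (y : n.-tuple R) :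
  tupd (lift ord0 i) s (ctup (x, y)) = ctup (x, tupd i s y).
Proof.
apply: eq_from_tnth => j; rewrite tnth_mktuple.
case: (unliftP ord0 j) => [j' ->|->]; last first.
  by rewrite (negbTE (neq_lift _ _)) !tnth0.
by rewrite (inj_eq (@lift_inj _ _)) !tnthS tnth_mktuple.
Qed.

Lemma measurable_tupd n (i : 'I_n) d (T : measurableType d) (g : T -> R)
    (f : T -> n.-tuple R) : measurable_fun setT g -> measurable_fun setT f ->
  measurable_fun setT (fun w => tupd i (g w) (f w)).
Proof.
move=> mg mf; apply/measurable_fun_tnthP => j.
rewrite (_ : _ \o _ = fun w => if j == i then g w else tnth (f w) j); last first.
  by apply/funext => w /=; rewrite tnth_mktuple.
case: (j == i) => //.
exact: (measurableT_comp (measurable_tnth j) mf).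
Qed.

Lemma ge0_integral_tupleS n (F : n.+1.-tuple R -> \bar R) :
  measurable_fun setT F -> (forall t, 0 <= F t)%E ->
  (\int[gt n.+1]_t F t = \int[gam]_x \int[gt n]_y F (ctup (x, y)))%E.
Proof.
move=> mF F0.
rewrite [LHS]ge0_integral_distribution//.
rewrite fubini_tonelli1//=.
apply: measurableT_comp => //; exact: measurable_cons_tuple.
Qed.

(** Induction on the length. A coordinate of the tail is resampled under the integral over the head;
    when the head itself is resampled, its old value disappears, the integral over it is that of a
    constant, and Tonelli's theorem exchanges the other two. *)
Lemma tuple_resample n (i : 'I_n) (F : n.-tuple R -> \bar R) :
  measurable_fun setT F -> (forall t, 0 <= F t)%E ->
  (\int[gt n]_t F t = \int[gt n]_t \int[gam]_s F (tupd i s t))%E.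
Proof.
elim: n i F => [[]//|n IH] i F mF F0.
have mFu : measurable_fun setT (fun p : n.+1.-tuple R * measurableTypeR R => F (tupd i p.2 p.1)).
  by apply: measurableT_comp => //; exact: measurable_tupd.
have mFc : measurable_fun setT (F \o @Defs.cons_tuple R n).
  apply: measurableT_comp => //; exact: measurable_cons_tuple.
have mI : measurable_fun setT (fun t => \int[gam]_s F (tupd i s t))%E.
  exact: (@measurable_fun_fubini_tonelli_F _ _ _ _ _ gam (fun p => F (tupd i p.2 p.1))).
have I0 t : (0 <= \int[gam]_s F (tupd i s t))%E by exact: integral_ge0.
rewrite (ge0_integral_tupleS mF F0) (ge0_integral_tupleS mI I0).
case: (unliftP ord0 i) => [j|] ->.
  apply: eq_integral => x _.
  have mFx : measurable_fun setT (fun y => F (ctup (x, y))).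
    exact: (measurableT_comp mFc (measurable_pair1 x)).
  rewrite (IH j _ mFx (fun y => F0 _)).
  by apply: eq_integral => y _; apply: eq_integral => s _; rewrite tupd_cons.
under [RHS]eq_integral do under eq_integral do under eq_integral do rewrite tupd_cons0.
rewrite [RHS]integral_prob_cst.
exact: (@fubini_tonelli _ _ _ _ _ gam (gt n) (F \o @Defs.cons_tuple R n) mFc (fun p => F0 _)).
Qed.

Lemma measurable_mean d1 d2 (T1 : measurableType d1) (T2 : measurableType d2)
    (P1 : probability T1 R) (P2 : probability T2 R) (k : T1 * T2 -> R) (C : R) :
  measurable_fun setT k -> (forall p, `|k p| <= C) ->
  measurable_fun setT (fun x => \int[P2]_y k (x, y)).
Proof.
move=> mk kC; apply: measurableT_comp => //.
apply: (@measurable_fubini_F _ _ _ _ _ P1 P2 (EFin \o k)).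
exact: (bounded_integrable (P1 \x P2)%E mk kC).
Qed.

(** Each coordinate is compared with its value at 0, not with an independent copy, because this is
    the left-hand side of [poincare_normal]. The induction separates the head from the tail. *)
Lemma efron_stein_tuple n (k : n.-tuple R -> R) (C : R) :
  measurable_fun setT k -> (forall t, `|k t| <= C) ->
  (\int[gt n]_t ((k t - \int[gt n]_t' k t') ^+ 2)%:E <=
   \sum_(i < n) \int[gt n]_t \int[gam]_s
      ((k (tupd i s t) - k (tupd i 0 t)) ^+ 2)%:E)%E.
Proof.
elim: n k => [|n IH] k mk kC.
  rewrite big_ord0 (eq_integral (cst 0%E)) ?integral0// => t _.
  rewrite /Rintegral (eq_integral (cst (k t)%:E)); last first.
    by move=> u _; rewrite /= (tuple0 u) (tuple0 t).
  by rewrite integral_prob_cst /= subrr expr0n.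
have mkc : measurable_fun setT (k \o @Defs.cons_tuple R n).
  apply: measurableT_comp => //; exact: measurable_cons_tuple.
have mk1 x : measurable_fun setT (fun y => k (ctup (x, y))).
  exact: (measurableT_comp mkc (measurable_pair1 x)).
have mk2 y : measurable_fun setT (fun x => k (ctup (x, y))).
  exact: (measurableT_comp mkc (measurable_pair2 y)).
pose b x := \int[gt n]_y k (ctup (x, y)).
have mb : measurable_fun setT b.
  exact: (@measurable_mean _ _ _ _ gam (gt n) (k \o @Defs.cons_tuple R n) C mkc (fun p => kC _)).
have bC x : `|b x| <= C by exact: Rintegral_le_cst.
pose a y := \int[gam]_x k (ctup (x, y)).
pose m := \int[gam]_x b x.
have mS (f : n.+1.-tuple R -> R) : measurable_fun setT f ->
    measurable_fun setT (fun t => ((f t) ^+ 2)%:E).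
  by move=> mf; apply/measurable_EFinP; exact: measurable_funX.
(* The mean minimizes the squared deviation, so the iterated mean m may replace it. *)
apply: (@le_trans _ _ (\int[gt n.+1]_t ((k t - m) ^+ 2)%:E)%E).
  have := integral_sqr_mean_le (gt n.+1) (\int[gt n.+1]_t' k t') m mk kC.
  by rewrite subrr expr0n adde0.
have mdu (i : 'I_n.+1) : measurable_fun setT
    (fun p : n.+1.-tuple R * measurableTypeR R =>
      ((k (tupd i p.2 p.1) - k (tupd i 0 p.1)) ^+ 2)%:E).
  apply/measurable_EFinP/measurable_funX/measurable_funB.
    by apply: (measurableT_comp mk); exact: measurable_tupd.
  by apply: (measurableT_comp mk); exact: measurable_tupd.
have mdi (i : 'I_n.+1) : measurable_fun setT (fun t => \int[gam]_s
    ((k (tupd i s t) - k (tupd i 0 t)) ^+ 2)%:E)%E.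
  apply: (@measurable_fun_fubini_tonelli_F _ _ _ _ _ gam _ (mdu i)).
  by move=> p; rewrite lee_fin sqr_ge0.
have pdi (i : 'I_n.+1) t : (0 <= \int[gam]_s
    ((k (tupd i s t) - k (tupd i 0 t)) ^+ 2)%:E)%E.
  by apply: integral_ge0 => s _; rewrite lee_fin sqr_ge0.
rewrite big_ord_recl !ge0_integral_tupleS//; first last.
- by move=> t; rewrite lee_fin sqr_ge0.
- by apply/measurable_EFinP/measurable_funX/measurable_funB.
under [X in (_ <= X + _)%E]eq_integral do under eq_integral do under eq_integral do rewrite !tupd_cons0.
rewrite [X in (_ <= X + _)%E]integral_prob_cst.
rewrite (@fubini_tonelli _ _ _ _ _ gam (gt n)
   (fun p => ((k (ctup p) - m) ^+ 2)%:E)); last 2 first.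
- by apply/measurable_EFinP/measurable_funX/measurable_funB.
- by move=> t; rewrite lee_fin sqr_ge0.
(* For a fixed tail y, the deviation of k from m is at most V y, the fluctuation due to the head,
   plus the square of the head average of k - b, which Jensen's inequality bounds by W y. *)
pose V y := (\int[gam]_s ((k (ctup (s, y)) - k (ctup (0%R, y))) ^+ 2)%:E)%E.
pose W y := (\int[gam]_x ((k (ctup (x, y)) - b x) ^+ 2)%:E)%E.
have mV : measurable_fun setT V.
  apply: (@measurable_fun_fubini_tonelli_G _ _ _ _ _ gam
    (fun p => ((k (ctup p) - k (ctup (0%R, p.2))) ^+ 2)%:E)).
    apply/measurable_EFinP/measurable_funX/measurable_funB => //.
    apply: (measurableT_comp mkc); exact: measurable_fun_pair.
  by move=> t; rewrite lee_fin sqr_ge0.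
have mkb : measurable_fun setT
    (fun p : measurableTypeR R * n.-tuple R => ((k (ctup p) - b p.1) ^+ 2)%:E).
  apply/measurable_EFinP/measurable_funX/measurable_funB => //.
  exact: (measurableT_comp mb).
have mW : measurable_fun setT W.
  apply: (@measurable_fun_fubini_tonelli_G _ _ _ _ _ gam _ mkb).
  by move=> t; rewrite lee_fin sqr_ge0.
have V0 y : (0 <= V y)%E by apply: integral_ge0 => s _; rewrite lee_fin sqr_ge0.
have W0 y : (0 <= W y)%E by apply: integral_ge0 => s _; rewrite lee_fin sqr_ge0.
apply: (@le_trans _ _ (\int[gt n]_y (V y + W y))%E).
  apply: ge0_le_integral => //.
  - by move=> y _; apply: integral_ge0 => s _; rewrite lee_fin sqr_ge0.
  - apply: (@measurable_fun_fubini_tonelli_G _ _ _ _ _ gam (fun p => ((k (ctup p) - m) ^+ 2)%:E)).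
      by apply/measurable_EFinP/measurable_funX/measurable_funB.
    by move=> t; rewrite lee_fin sqr_ge0.
  - exact: emeasurable_funD.
  move=> y _; apply: le_trans.
    exact: (integral_sqr_mean_le gam m (k (ctup (0%R, y))) (mk2 y) (fun x => kC _)).
  rewrite leeD2l//.
  have mkby : measurable_fun setT (fun x => k (ctup (x, y)) - b x) by exact: measurable_funB.
  have kb2 x : `|k (ctup (x, y)) - b x| <= C + C.
    by rewrite (le_trans (ler_normB _ _))// lerD.
  have <- : \int[gam]_x (k (ctup (x, y)) - b x) = \int[gam]_x k (ctup (x, y)) - m.
    rewrite RintegralB//.
    - exact: (bounded_integrable gam (mk2 y) (fun x => kC _)).
    - exact: (bounded_integrable gam mb bC).
  exact: (sqr_Rintegral_le gam mkby kb2).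
rewrite ge0_integralD// leeD2l//.
(* With the head integrated last, W becomes for each head x the variance of the tail function y -> k
   (x, y), whose mean is b x; this is where the induction hypothesis applies. *)
rewrite -(@fubini_tonelli _ _ _ _ _ gam (gt n) _ mkb); last first.
  by move=> t; rewrite lee_fin sqr_ge0.
pose Z i x := (\int[gt n]_y \int[gam]_s
      ((k (ctup (x, tupd i s y)) - k (ctup (x, tupd i 0 y))) ^+ 2)%:E)%E.
have ZE (i : 'I_n) : (\int[gam]_x Z i x = \int[gt n.+1]_t \int[gam]_s
    ((k (tupd (lift ord0 i) s t) - k (tupd (lift ord0 i) 0 t)) ^+ 2)%:E)%E.
  rewrite (ge0_integral_tupleS (mdi (lift ord0 i)) (pdi (lift ord0 i))).
  by apply: eq_integral => x _; apply: eq_integral => y _; apply: eq_integral => s _;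
    rewrite !tupd_cons.
under eq_bigr do rewrite -ZE.
have mZ i : measurable_fun setT (Z i).
  rewrite /Z.
  under eq_fun do under eq_integral do under eq_integral do rewrite -!tupd_cons.
  apply: (@measurable_fun_fubini_tonelli_F _ _ _ _ _ (gt n)
    (fun p => \int[gam]_s ((k (tupd (lift ord0 i) s (ctup p)) -
      k (tupd (lift ord0 i) 0 (ctup p))) ^+ 2)%:E)%E).
    exact: (measurableT_comp (mdi (lift ord0 i)) (@measurable_cons_tuple _ _)).
  by move=> p; exact: pdi.
have Z0 i x : (0 <= Z i x)%E.
  by do 2 (apply: integral_ge0 => ? _); rewrite lee_fin sqr_ge0.
rewrite -ge0_integral_sum//.
apply: ge0_le_integral => //.
- by move=> x _; apply: integral_ge0 => y _; rewrite lee_fin sqr_ge0.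
- apply: (@measurable_fun_fubini_tonelli_F _ _ _ _ _ (gt n) _ mkb).
  by move=> t; rewrite lee_fin sqr_ge0.
- exact: emeasurable_sum.
- move=> x _; exact: IH.
Qed.

End tuples.

(** * Differential calculus away from the origin *)

Section calculus.
Context {R : realType} {n : nat}.
Notation V := 'cV[R]_n.
Notation e i := (delta_mx i ord0 : V).
Implicit Types (f g k : V -> R) (x y : V).

Lemma near_neq0 x : x != 0 -> \near x, x != 0.
Proof.
move=> x0; have o : open [set~ (0 : V)].
  by rewrite openC; apply: accessible_closed_set1; apply: hausdorff_accessible; exact: norm_hausdorff.
have : nbhs x [set~ (0 : V)] by apply: open_nbhs_nbhs; split=> //=; exact/eqP.
by apply: filterS => y /eqP.
Qed.

Lemma near_eq_differentiable f g x : (\near x, f x = g x) ->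
  differentiable f x -> differentiable g x.
Proof.
move=> fg df; have /diff_locallyP[cdf dfx] := df.
have fgx : f x = g x by exact: nbhs_singleton fg.
have H : g \o shift x = cst (g x) + 'd f x +o_ (0 : V) id.
  apply/eqaddoP => eps eps0; move/eqaddoP: dfx => /(_ eps eps0).
  have fg0 : \forall h \near (0 : V), f (h + x) = g (h + x).
    by move: fg; rewrite (near_shift 0) subr0.
  apply: filterS2 fg0 => h fgh.
  by rewrite /= -fgx !fctE /= fgh.
apply/diff_locallyP.
have -> : 'd g x = 'd f x :> (V -> R) by apply: diff_unique.
by [].
Qed.

Lemma coord_derive (j : 'I_n) x (v : V) : is_derive x v (fun y : V => y j ord0) (v j ord0).
Proof.
have d2 := @derive_mx R V n 1 id x v (@derivable_id _ _ x v).
apply: DeriveDef; first exact: (diff_derivable (differentiable_coord _ _ _)).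
by move: d2; rewrite derive_id => /matrixP/(_ j ord0); rewrite mxE => <-.
Qed.

(* C^m on R^n minus the origin *)
Fixpoint Cm (m : nat) (f : V -> R) : Prop :=
  if m is m'.+1 then
    (forall x, x != 0 -> differentiable f x) /\ forall i, Cm m' (partial i f)
  else forall x, x != 0 -> {for x, continuous f}.

Definition eq_off0 f g := forall x, x != 0 -> f x = g x.

Lemma eq_off0_near f g x : eq_off0 f g -> x != 0 -> \near x, f x = g x.
Proof. by move=> fg /near_neq0; apply: filterS. Qed.

Lemma eq_off0_partial f g i : eq_off0 f g -> eq_off0 (partial i f) (partial i g).
Proof. by move=> fg x x0; apply: near_eq_derive; exact: eq_off0_near. Qed.

(** Derivative formulas are known only off 0, while [partial i f] is a function on the whole space.
    The complement of 0 being open, equality there is local and passes to all derivatives, so such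
    formulas can be substituted inside [Cm]. *)
Lemma eq_off0_Cm m f g : eq_off0 f g -> Cm m f -> Cm m g.
Proof.
elim: m f g => [|m IH] f g fg /=.
  move=> cf x x0; rewrite /prop_for /continuous_at -(fg _ x0).
  apply: cvg_trans (cf x x0).
  exact: (near_eq_cvg (eq_off0_near fg x0)).
move=> [df pf]; split=> [x x0|i].
  by apply: near_eq_differentiable (df x x0); exact: eq_off0_near.
by apply: IH (pf i); exact: eq_off0_partial.
Qed.

Lemma Cm_continuous m f x : Cm m f -> x != 0 -> {for x, continuous f}.
Proof.
case: m => [|m] /=; first by move=> cf x0; exact: cf.
by move=> [df _] x0; apply/differentiable_continuous/df.
Qed.

Lemma CmS m f : Cm m.+1 f -> Cm m f.
Proof.
elim: m f => [|m IH] f; first by move=> /Cm_continuous cf x; exact: cf.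
by move=> [df pf]; split => // i; apply: IH.
Qed.

Lemma partialD f g i x : differentiable f x -> differentiable g x ->
  partial i (fun x => f x + g x) x = partial i f x + partial i g x.
Proof.
move=> df dg; rewrite /partial -deriveD//; exact: diff_derivable.
Qed.

Lemma partialM f g i x : differentiable f x -> differentiable g x ->
  partial i (fun x => f x * g x) x = partial i f x * g x + f x * partial i g x.
Proof.
move=> df dg; rewrite /partial.
have := @deriveM R V f g x (e i) (diff_derivable df) (diff_derivable dg).
by rewrite /GRing.scale/= => ->; ring.
Qed.

Lemma CmD m f g : Cm m f -> Cm m g -> Cm m (fun x => f x + g x).
Proof.
elim: m f g => [|m IH] f g.
  by move=> cf cg x x0; apply: (@continuousD _ R^o); [exact: cf|exact: cg].
move=> [df pf] [dg pg]; split=> [x x0|i].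
  by apply: (@differentiableD _ _ R^o); [exact: df|exact: dg].
apply: eq_off0_Cm (IH _ _ (pf i) (pg i)) => x x0; rewrite partialD//; [exact: df|exact: dg].
Qed.

Lemma CmM m f g : Cm m f -> Cm m g -> Cm m (fun x => f x * g x).
Proof.
elim: m f g => [|m IH] f g.
  by move=> cf cg x x0; apply: continuousM; [exact: cf|exact: cg].
move=> hf hg; have [df pf] := hf; have [dg pg] := hg; split=> [x x0|i].
  by apply: differentiableM; [exact: df|exact: dg].
apply: eq_off0_Cm (CmD (IH _ _ (pf i) (CmS hg)) (IH _ _ (CmS hf) (pg i))) => x x0.
by rewrite partialM//; [exact: df|exact: dg].
Qed.

Lemma Cm_cst m (c : R) : Cm m (fun=> c).
Proof.
elim: m c => [|m IH] c; first by move=> x _; exact: cst_continuous.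
split=> [x _|i]; first exact: differentiable_cst.
by apply: eq_off0_Cm (IH 0) => x _; rewrite /partial derive_cst.
Qed.

Lemma Cm_coord m j : Cm m (fun x => x j ord0).
Proof.
case: m => [|m]; first by move=> x _; apply/differentiable_continuous/differentiable_coord.
split=> [x _|i]; first exact: differentiable_coord.
apply: eq_off0_Cm (Cm_cst m (e i j ord0)) => x _.
by have [_ <-] := coord_derive j x (e i).
Qed.

(** Bridge from the words of partial derivatives in [sphere_smooth]. Generalizing over the word
    makes the induction work: differentiating once more puts a letter in front. *)
Lemma Cm_foldr f : (forall (s : seq 'I_n) x, x != 0 -> differentiable (foldr (@partial R n) f s) x) ->
  forall m, Cm m f.
Proof.
move=> df m; suff : forall s, Cm m (foldr (@partial R n) f s) by move=> /(_ [::]).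
elim: m => [|m IH] s /=.
  by move=> x x0; apply/differentiable_continuous/df.
by split=> [x x0|i]; [exact: df|exact: (IH (i :: s))].
Qed.

Lemma enorm_ge0 x : 0 <= enorm x. Proof. exact: sqrtr_ge0. Qed.

Lemma sqr_enorm x : enorm x ^+ 2 = \sum_i x i ord0 ^+ 2.
Proof. by rewrite sqr_sqrtr// sumr_ge0// => i _; exact: sqr_ge0. Qed.

Lemma enorm_eq0 x : (enorm x == 0) = (x == 0).
Proof.
rewrite -sqrf_eq0 sqr_enorm psumr_eq0; last by move=> i _; exact: sqr_ge0.
apply/idP/eqP => [/allP h|->]; last by apply/allP => i _; rewrite mxE expr0n/= eqxx.
apply/colP => i; have := h i; rewrite mem_index_enum => /(_ isT).
by rewrite sqrf_eq0 mxE => /eqP.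
Qed.

Lemma enorm_gt0 x : (0 < enorm x) = (x != 0).
Proof. by rewrite lt0r enorm_ge0 andbT enorm_eq0. Qed.

Lemma enorm0 : enorm (0 : V) = 0. Proof. by apply/eqP; rewrite enorm_eq0. Qed.

Lemma enormZ (c : R) x : enorm (c *: x) = `|c| * enorm x.
Proof.
rewrite /enorm; under eq_bigr do rewrite mxE exprMn.
by rewrite -mulr_sumr sqrtrM ?sqr_ge0// sqrtr_sqr.
Qed.

Lemma differentiable_sqr_enorm x : differentiable (fun x => \sum_i (x i ord0) ^+ 2) x.
Proof.
rewrite (_ : (fun x : V => _) = \sum_i (fun x : V => (x i ord0) ^+ 2)).
  by apply: differentiable_sum => i; exact: (differentiableM (differentiable_coord _ _ _) (differentiable_coord _ _ _)).
by apply/funext => y; rewrite fct_sumE.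
Qed.

Lemma differentiable_enorm x : x != 0 -> differentiable (@enorm R n) x.
Proof.
move=> x0; apply: (@differentiable_comp _ _ _ _ (fun x : V => \sum_i (x i ord0) ^+ 2) Num.sqrt).
  exact: differentiable_sqr_enorm.
apply/derivable1_diffP; have [] // := @is_derive1_sqrt R (\sum_i (x i ord0) ^+ 2) _.
by rewrite -sqr_enorm exprn_gt0// enorm_gt0.
Qed.

Lemma partial_sqr_enorm i x : partial i (fun x => \sum_i (x i ord0) ^+ 2) x = 2 * x i ord0.
Proof.
rewrite /partial (_ : (fun x : V => _) = \sum_i (fun x : V => (x i ord0) ^+ 2)); last first.
  by apply/funext => y; rewrite fct_sumE.
rewrite derive_sum; last first.
  by move=> j; apply: diff_derivable; exact: (differentiableM (differentiable_coord _ _ _) (differentiable_coord _ _ _)).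
have E j : 'D_(e i) (fun x : V => (x j ord0) ^+ 2) x = 2 * x j ord0 * (j == i)%:R.
  have h := coord_derive j x (e i).
  have := is_deriveM (f := fun y : V => y j ord0) (g := fun y : V => y j ord0) (x := x) (v := e i).
  move=> /(_ _ _ h h)[_ +]; rewrite /GRing.scale/= !mxE eqxx andbT => h2.
  rewrite -[LHS]/('D_(e i) ((fun y : V => y j ord0) * (fun y : V => y j ord0)) x) h2; ring.
under eq_bigr do rewrite E.
by rewrite (bigD1 i)//= eqxx mulr1 big1 ?addr0// => j /negbTE ->; rewrite mulr0.
Qed.

(** Obtained by differentiating |x| |x| = sum of x_j^2 and cancelling 2 |x|. *)
Lemma partial_enorm i x : x != 0 -> partial i (@enorm R n) x = x i ord0 / enorm x.
Proof.
move=> x0; have d := differentiable_enorm x0.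
have := partialM i d d; rewrite (_ : (fun x : V => enorm x * enorm x) = fun x => \sum_i (x i ord0) ^+ 2); last first.
  by apply/funext => y; rewrite -expr2 sqr_enorm.
rewrite partial_sqr_enorm => h; have : enorm x != 0 by rewrite enorm_eq0.
move=> n0; apply: (mulIf n0); rewrite divfK//.
by apply: (@mulfI _ 2) => //; rewrite h; ring.
Qed.

(** At the origin its value is 0, the inverse of 0. *)
Definition inorm x := (enorm x)^-1.

Lemma measurable_inorm : measurable_fun setT inorm.
Proof.
rewrite /inorm; under eq_fun do rewrite -powR_inv1 ?enorm_ge0//.
apply: (@measurableT_comp _ _ _ _ _ _ (fun a : R => a `^ (-1))) => //.
exact: measurable_enorm.
Qed.

Lemma differentiable_inorm x : x != 0 -> differentiable inorm x.
Proof.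
move=> x0; apply: differentiableV; first exact: differentiable_enorm.
by rewrite enorm_eq0.
Qed.

Lemma partial_inorm i x : x != 0 ->
  partial i inorm x = - (x i ord0 * (inorm x * (inorm x * inorm x))).
Proof.
move=> x0; have n0 : enorm x != 0 by rewrite enorm_eq0.
rewrite /partial deriveV//; last exact/diff_derivable/differentiable_enorm.
rewrite -[X in _ *: X]/(partial i (@enorm R n) x) partial_enorm//.
by rewrite /GRing.scale/= /inorm; field.
Qed.

(** The first derivatives of 1 / |x| are polynomials in the coordinates and 1 / |x| itself, which
    closes the induction. *)
Lemma Cm_inorm m : Cm m inorm.
Proof.
elim: m => [|m IH].
  by move=> x x0; apply/differentiable_continuous/differentiable_inorm.
split=> [x x0|i]; first exact: differentiable_inorm.
have h := CmM (Cm_cst m (-1)) (CmM (Cm_coord m i) (CmM IH (CmM IH IH))).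
apply: eq_off0_Cm h => x x0; rewrite partial_inorm//; ring.
Qed.

Lemma Cm_enorm m : Cm m (@enorm R n).
Proof.
case: m => [|m].
  by move=> x x0; apply/differentiable_continuous/differentiable_enorm.
split=> [x x0|i]; first exact: differentiable_enorm.
apply: eq_off0_Cm (CmM (Cm_coord m i) (Cm_inorm m)) => x x0.
by rewrite partial_enorm.
Qed.

End calculus.

(** * Stein identity and Poincare inequality in R^n *)

Lemma sube_fin0 (R : realType) (x y : \bar R) : x \is a fin_num -> y \is a fin_num ->
  (x - y = 0 -> x = y)%E.
Proof.
by case: x y => [a||] [b||]// _ _ [] /eqP; rewrite subr_eq0 => /eqP ->.
Qed.

Section gaussian_cV.
Context {R : realType}.
Notation gam := (std_normal R).

Section fixed_dim.
Context {n : nat}.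
Notation V := 'cV[R]_n.
Notation e i := (delta_mx i ord0 : V).
Notation G := (gaussian R n).
Implicit Types (x y : V).

Definition upd (i : 'I_n) (s : R) (x : V) : V :=
  \col_j (if j == i then s else x j ord0).

Lemma updE i s x j : upd i s x j ord0 = if j == i then s else x j ord0.
Proof. by rewrite mxE. Qed.

Lemma measurable_upd i d (T : measurableType d) (g : T -> R) (f : T -> V) :
  measurable_fun setT g -> measurable_fun setT f ->
  measurable_fun setT (fun w => upd i (g w) (f w)).
Proof.
move=> mg mf; apply: measurable_fun_cV => j.
under eq_fun do rewrite updE.
case: (j == i) => //.
exact: (measurableT_comp (@measurable_coor R n j) mf).
Qed.

Lemma upd_col_tuple i s (t : n.-tuple R) : upd i s (col_tuple t) = col_tuple (tupd i s t).
Proof. by apply/colP => j; rewrite !mxE tnth_mktuple; case: ifP => // _; rewrite mxE. Qed.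

Lemma ge0_integral_gaussianE (F : V -> \bar R) :
  measurable_fun setT F -> (forall x, 0 <= F x)%E ->
  (\int[G]_x F x = \int[gaussian_tuple R n]_t F (col_tuple t))%E.
Proof. by move=> mF F0; rewrite [LHS]ge0_integral_distribution. Qed.

Lemma measurable_resample i (F : V -> \bar R) :
  measurable_fun setT F -> (forall x, 0 <= F x)%E ->
  measurable_fun setT (fun x => \int[gam]_s F (upd i s x))%E.
Proof.
move=> mF F0.
apply: (@measurable_fun_fubini_tonelli_F _ _ _ _ _ gam (fun p => F (upd i p.2 p.1))) => //.
by apply: measurableT_comp => //; exact: measurable_upd.
Qed.

(** This is how one-dimensional facts enter dimension n: the inner integral runs over the line
    through x parallel to the i-th axis, under the standard normal law. *)
Lemma gaussian_resample i (F : V -> \bar R) :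
  measurable_fun setT F -> (forall x, 0 <= F x)%E ->
  (\int[G]_x F x = \int[G]_x \int[gam]_s F (upd i s x))%E.
Proof.
move=> mF F0.
have I0 x : (0 <= \int[gam]_s F (upd i s x))%E by exact: integral_ge0.
rewrite (ge0_integral_gaussianE mF F0) (ge0_integral_gaussianE (measurable_resample i mF F0) I0).
have mFt : measurable_fun setT (F \o @col_tuple R n).
  exact: (measurableT_comp mF (@measurable_col_tuple R n)).
rewrite (tuple_resample i mFt (fun t => F0 _)).
by apply: eq_integral => t _; apply: eq_integral => s _; rewrite upd_col_tuple.
Qed.

Lemma efron_stein_gaussian (k : V -> R) (C : R) :
  measurable_fun setT k -> (forall x, `|k x| <= C) ->
  (\int[G]_x ((k x - \int[G]_y k y) ^+ 2)%:E <=
   \sum_(i < n) \int[G]_x \int[gam]_s ((k (upd i s x) - k (upd i 0 x)) ^+ 2)%:E)%E.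
Proof.
move=> mk kC.
have mkt : measurable_fun setT (k \o @col_tuple R n).
  exact: (measurableT_comp mk (@measurable_col_tuple R n)).
have := efron_stein_tuple mkt (fun t => kC _).
have -> : \int[G]_y k y = \int[gaussian_tuple R n]_t k (col_tuple t).
  rewrite /Rintegral; congr fine; rewrite [LHS]integral_distribution//; first exact/measurable_EFinP.
  exact: (bounded_integrable (gaussian_tuple R n) mkt (fun t => kC _)).
move: (Rintegral _ _ _) => m.
have m1 : measurable_fun setT (fun x => ((k x - m) ^+ 2)%:E).
  by apply/measurable_EFinP/measurable_funX/measurable_funB.
rewrite (ge0_integral_gaussianE m1 (fun x => _)); last first.
  by move=> x; rewrite lee_fin sqr_ge0.
move=> /le_trans; apply; apply: lee_sum => i _.
have m2 : measurable_fun setT (fun x => \int[gam]_s ((k (upd i s x) - k (upd i 0 x)) ^+ 2)%:E)%E.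
  apply: (@measurable_fun_fubini_tonelli_F _ _ _ _ _ gam (fun p => ((k (upd i p.2 p.1) - k (upd i 0 p.1)) ^+ 2)%:E)) => //.
    apply/measurable_EFinP/measurable_funX/measurable_funB.
      by apply: (measurableT_comp mk); exact: measurable_upd.
    by apply: (measurableT_comp mk); exact: measurable_upd.
  by move=> p; rewrite lee_fin sqr_ge0.
have p2 x : (0 <= \int[gam]_s ((k (upd i s x) - k (upd i 0 x)) ^+ 2)%:E)%E.
  by apply: integral_ge0 => s _; rewrite lee_fin sqr_ge0.
rewrite (ge0_integral_gaussianE m2 p2).
by under [X in (_ <= X)%E]eq_integral do under eq_integral do rewrite !upd_col_tuple.
Qed.

(** Together with [upd_neq0], it makes almost every line in a direction i other than j avoid the
    origin. Resampling coordinate j reduces the claim to a single point of the line. *)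
Lemma ae_coord_neq0 (j : 'I_n) : {ae G, forall x : V, x j ord0 != 0}.
Proof.
have mA : measurable [set x : V | x j ord0 = 0].
  by rewrite -[X in measurable X]setTI; exact: (@measurable_coor R n j measurableT _ (measurable_set1 (0 : R))).
exists [set x : V | x j ord0 = 0]; split => //; last first.
  by move=> x /= /negP; rewrite negbK => /eqP.
have m1 : measurable_fun setT (fun x : V => (\1_[set x : V | x j ord0 = 0] x : R)%:E).
  by apply/measurable_EFinP; exact: measurable_indic.
have := gaussian_resample j m1 (fun x => _); rewrite integral_indic// setIT => ->; last by move=> x; rewrite lee_fin.
rewrite (eq_integral (cst 0%E)) ?integral0// => x _.
rewrite (eq_integral (fun s : measurableTypeR R => (\1_[set (0 : R)] s)%:E)); last first.
  by move=> s _; rewrite !indicE; congr (_%:R%:E); congr nat_of_bool; apply/idP/idP;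
    rewrite !inE /= updE eqxx.
rewrite integral_indic// setIT; exact: std_normal_set1.
Qed.

Lemma upd_neq0 i j s (x : V) : j != i -> x j ord0 != 0 -> upd i s x != 0.
Proof.
move=> ji xj; apply/eqP => /colP/(_ j); rewrite updE (negbTE ji) mxE => x0.
by rewrite x0 eqxx in xj.
Qed.

Lemma updS i (h s : R) (x : V) : upd i (h + s) x = h *: e i + upd i s x.
Proof.
apply/colP => j; rewrite !mxE eqxx andbT.
by case: eqP => _; rewrite ?mulr1// mulr0 add0r.
Qed.

Lemma slice_derive i (k : V -> R) (s : R) (x : V) : differentiable k (upd i s x) ->
  is_derive s 1 (fun s => k (upd i s x)) (partial i k (upd i s x)).
Proof.
move=> dk; have := @diff_derivable _ _ _ _ _ (e i) dk; set y := upd i s x => dky.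
have E : (fun h => h^-1 *: (((fun s => k (upd i s x)) \o shift s) (h *: 1) - k (upd i s x))) =
  (fun h => h^-1 *: ((k \o shift y) (h *: e i) - k y)) :> (R -> R).
  by apply/funext => h; rewrite /= -updS /GRing.scale/= mulr1.
by apply: DeriveDef; rewrite /derivable /partial /derive E.
Qed.

Lemma continuous_upd i (x : V) : continuous (fun s => upd i s x).
Proof.
rewrite (_ : (fun s => _) = (fun s : R => s *: e i + upd i 0 x)); last first.
  by apply/funext => s; rewrite -updS addr0.
move=> s; apply: cvgD; last exact: cvg_cst.
by apply: cvgZr_tmp; exact: cvg_id.
Qed.

Lemma enorm_coord (i : 'I_n) (x : V) : `|x i ord0| <= enorm x.
Proof.
rewrite -(@ler_pXn2r _ 2)// ?nnegrE ?enorm_ge0// sqr_enorm real_normK ?num_real//.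
by rewrite (bigD1 i)//= lerDl sumr_ge0// => j _; exact: sqr_ge0.
Qed.

Lemma enorm_upd_le i s (x : V) : enorm (upd i s x) <= enorm x + `|s|.
Proof.
rewrite -(@ler_pXn2r _ 2)// ?nnegrE ?enorm_ge0// ?addr_ge0 ?enorm_ge0//.
rewrite sqr_enorm (bigD1 i)//= updE eqxx.
under eq_bigr => j ji do rewrite updE (negbTE ji).
rewrite sqrrD sqr_enorm [in leRHS](bigD1 i)//= real_normK ?num_real//.
have := sqr_ge0 (x i ord0); have := mulr_ge0 (enorm_ge0 x) (normr_ge0 s).
move: (\sum_(j < n | _) _) => S; lra.
Qed.

Lemma integrable_coord_sqr (i : 'I_n) : G.-integrable setT (EFin \o (fun x : V => x i ord0 ^+ 2)).
Proof.
have m1 : measurable_fun setT (fun x : V => (x i ord0 ^+ 2)%:E).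
  by apply/measurable_EFinP/measurable_funX; exact: measurable_coor.
apply/integrableP; split => //.
under eq_integral do rewrite /= ger0_norm ?sqr_ge0//.
rewrite (gaussian_resample i m1); last by move=> x; rewrite lee_fin sqr_ge0.
under eq_integral do under eq_integral do rewrite updE eqxx.
rewrite integral_prob_cst.
by apply: le_lt_trans (@normal_sqr_le1 R) _; rewrite ltry.
Qed.

Lemma integrable_enorm_sqr : G.-integrable setT (EFin \o (fun x : V => enorm x ^+ 2)).
Proof.
under eq_fun do rewrite sqr_enorm.
have := @integrable_sum _ _ _ G setT measurableT _ (index_enum 'I_n) xpredT (fun i x => (x i ord0 ^+ 2)%:E)
  (fun i _ => integrable_coord_sqr i).
by apply: eq_integrable => // x _; rewrite /= sumEFin.
Qed.

Definition lin_bound (f : V -> R) (A : R) := forall x, `|f x| <= A * (1 + enorm x).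

(** The coordinate j other than i keeps almost every line in direction i away from the origin, the
    only place where phi may be singular; on such a line [stein_normal] applies. *)
Lemma stein_gaussian (i j : 'I_n) (phi psi : V -> R) (A : R) : j != i ->
  measurable_fun setT phi -> measurable_fun setT psi ->
  (forall x, x != 0 -> differentiable phi x) ->
  (forall x, x != 0 -> partial i phi x = psi x) ->
  (forall x, x != 0 -> {for x, continuous psi}) ->
  lin_bound phi A -> lin_bound psi A ->
  G.-integrable setT (EFin \o (fun x => x i ord0 * phi x - psi x)) /\
  (\int[G]_x (x i ord0 * phi x - psi x)%:E = 0)%E.
Proof.
move=> ji mphi mpsi dphi pphi cpsi phiA psiA.
pose W (x : V) := x i ord0 * phi x - psi x.
have A0 : 0 <= A by have := phiA 0; rewrite enorm0 addr0 mulr1; exact: le_trans.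
have mW : measurable_fun setT W.
  by apply: measurable_funB => //; apply: measurable_funM => //; exact: measurable_coor.
have bW x : `|W x| <= 4 * A * (1 + enorm x ^+ 2).
  have := phiA x; have := psiA x; have := enorm_coord i x; have := enorm_ge0 x.
  have := ler_normB (x i ord0 * phi x) (psi x); rewrite normrM -/(W x).
  move: (`|W x|) (enorm x) (normr_ge0 (x i ord0)) (normr_ge0 (phi x)).
  move: (`|x i ord0|) (`|phi x|) (`|psi x|) => a b c w N a0 b0 h N0 aN ha hb.
  have h1 : a * b <= N * (A * (1 + N)) by rewrite ler_pM.
  have h2 : 0 <= A * (1 - N) ^+ 2 by rewrite mulr_ge0// sqr_ge0.
  have h4 : 0 <= A * N ^+ 2 by rewrite mulr_ge0// sqr_ge0.
  nra.
have iW : G.-integrable setT (EFin \o W).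
  apply: (dominated_integrable mW bW).
  have i1 : G.-integrable setT (EFin \o (cst (1 : R))).
    exact: finite_measure_integrable_cst.
  have i3 := integrableD measurableT i1 integrable_enorm_sqr.
  by have := integrableZl measurableT (4 * A) i3; apply: eq_integrable.
split => //.
(* Resampling is available for nonnegative integrands, so the positive and negative parts of W are
   resampled separately; [stein_normal] says that on almost every line they have equal integrals. *)
rewrite -/(integral _ _ _) integralE.
have mWE : measurable_fun setT (EFin \o W) by exact/measurable_EFinP.
have mp := measurable_funepos mWE; have mn := measurable_funeneg mWE.
rewrite (gaussian_resample i mp (funepos_ge0 _)) (gaussian_resample i mn (funeneg_ge0 _)).
have E : ae_eq G setT (fun x => \int[gam]_s (EFin \o W)^\+ (upd i s x))%E
                      (fun x => \int[gam]_s (EFin \o W)^\- (upd i s x))%E.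
  have := ae_coord_neq0 j; apply: filterS => x xj _.
  pose u s := phi (upd i s x); pose du s := psi (upd i s x).
  have x0 s : upd i s x != 0 by exact: upd_neq0 ji xj.
  have [] := @stein_normal R u du.
  - by move=> s; rewrite /du -pphi//; apply: slice_derive; exact: dphi.
  - move=> s; apply: continuous_comp; first exact: continuous_upd.
    exact: cpsi.
  (* On the line, 1 + |upd i s x| <= 1 + |x| + |s| <= (1 + |x|) (1 + |s|). *)
  - exists (A * (1 + enorm x)) => s; apply: (le_trans (phiA _)).
    rewrite -mulrA ler_wpM2l//; have := enorm_upd_le i s x; have := normr_ge0 s.
    have := enorm_ge0 x; nra.
  - exists (A * (1 + enorm x)) => s; apply: (le_trans (psiA _)).
    rewrite -mulrA ler_wpM2l//; have := enorm_upd_le i s x; have := normr_ge0 s.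
    have := enorm_ge0 x; nra.
  move=> iw; rewrite integralE.
  have EW : (fun s => (s * u s - du s)%:E) = (EFin \o W) \o (fun s => upd i s x).
    by apply/funext => s /=; rewrite /W updE eqxx.
  rewrite EW funepos_comp funeneg_comp.
  have fin1 := integrable_pos_fin_num measurableT iw.
  have fin2 := integrable_neg_fin_num measurableT iw.
  rewrite EW funepos_comp in fin1; rewrite EW funeneg_comp in fin2.
  exact: sube_fin0.
rewrite (ge0_ae_eq_integral _ _ _ _ _ E)//; last 4 first.
- exact: (measurable_resample i mp (funepos_ge0 _)).
- exact: (measurable_resample i mn (funeneg_ge0 _)).
- by move=> x _; exact: integral_ge0.
- by move=> x _; exact: integral_ge0.
rewrite -(gaussian_resample i mn (funeneg_ge0 _)) subee//.
exact: (integrable_neg_fin_num measurableT iW).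
Qed.

(** Each summand of [efron_stein_gaussian] is already the left-hand side of [poincare_normal] on a
    line in direction i, and a second coordinate keeps almost all of these lines off the origin. *)
Lemma poincare_gaussian (k : V -> R) (g : 'I_n -> V -> R) (C : R) : (1 < n)%N ->
  measurable_fun setT k -> (forall x, `|k x| <= C) ->
  (forall x, x != 0 -> differentiable k x) ->
  (forall i, measurable_fun setT (g i)) ->
  (forall i x, x != 0 -> partial i k x = g i x) ->
  (forall i x, x != 0 -> {for x, continuous (g i)}) ->
  (\int[G]_x ((k x - \int[G]_y k y) ^+ 2)%:E <=
   \sum_(i < n) \int[G]_x (g i x ^+ 2)%:E)%E.
Proof.
move=> n1 mk kC dk mg pk cg; apply: (le_trans (efron_stein_gaussian mk kC)).
apply: lee_sum => i _.
have mg2 : measurable_fun setT (fun x => (g i x ^+ 2)%:E).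
  by apply/measurable_EFinP/measurable_funX.
have g20 x : (0 <= (g i x ^+ 2)%:E)%E by rewrite lee_fin sqr_ge0.
rewrite (gaussian_resample i mg2 g20).
have [j ji] : exists j : 'I_n, j != i.
  have [i0|i0] := eqVneq (i : nat) 0%N.
    by exists (Ordinal n1); rewrite -val_eqE/= i0.
  by exists (Ordinal (ltnW n1)); rewrite -val_eqE/= eq_sym.
apply: ae_ge0_le_integral => //.
- by move=> x _; apply: integral_ge0 => s _; rewrite lee_fin sqr_ge0.
- apply: (@measurable_fun_fubini_tonelli_F _ _ _ _ _ gam (fun p => ((k (upd i p.2 p.1) - k (upd i 0 p.1)) ^+ 2)%:E)) => //.
    apply/measurable_EFinP/measurable_funX/measurable_funB.
      by apply: (measurableT_comp mk); exact: measurable_upd.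
    by apply: (measurableT_comp mk); exact: measurable_upd.
  by move=> p; rewrite lee_fin sqr_ge0.
- by move=> x _; exact: integral_ge0.
- exact: (measurable_resample i mg2 g20).
have := ae_coord_neq0 j; apply: filterS => x xj _.
have x0 s : upd i s x != 0 by exact: upd_neq0 ji xj.
apply: (@poincare_normal R (fun s => k (upd i s x)) (fun s => g i (upd i s x))).
- by move=> s; rewrite -pk//; apply: slice_derive; exact: dk.
- move=> s; apply: continuous_comp; first exact: continuous_upd.
  exact: cg.
Qed.

End fixed_dim.
End gaussian_cV.

(** * Functions homogeneous of degree 0 *)

Section homogeneous.
Context {R : realType} {n : nat}.
Notation V := 'cV[R]_n.
Notation e i := (delta_mx i ord0 : V).
Implicit Types (f g k : V -> R) (x y v : V).

Lemma line_derive f (s : R) x v : differentiable f (s *: v + x) ->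
  is_derive s 1 (fun s => f (s *: v + x)) ('D_v f (s *: v + x)).
Proof.
move=> df; have := @diff_derivable _ _ _ _ _ v df; set y := s *: v + x => dky.
have E : (fun h => h^-1 *: (((fun s => f (s *: v + x)) \o shift s) (h *: 1) - f (s *: v + x))) =
  (fun h => h^-1 *: ((f \o shift y) (h *: v) - f y)) :> (R -> R).
  by apply/funext => h; rewrite /= /y addrA -scalerDl /GRing.scale/= mulr1.
by apply: DeriveDef; rewrite /derivable /derive E.
Qed.

(** Two uses of the mean value theorem: along [e i] for the increment of f in direction [e j], then
    along [e j] for the resulting [partial i f]. The nonvanishing hypothesis keeps the whole
    parallelogram where f is smooth. *)
Lemma mixed_difference f i j x (h : R) : 0 < h -> Cm 2 f ->
  (forall s t, 0 <= s <= h -> 0 <= t <= h -> s *: e i + (t *: e j + x) != 0) ->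
  exists s t, [/\ 0 <= s <= h, 0 <= t <= h &
    f (h *: e i + (h *: e j + x)) - f (h *: e i + x) - f (h *: e j + x) + f x =
    partial j (partial i f) (s *: e i + (t *: e j + x)) * h * h].
Proof.
move=> h0 [df pf] nz.
have nz1 s : 0 <= s <= h -> s *: e i + x != 0.
  by move=> sh; have := nz s 0 sh; rewrite scale0r add0r; apply; rewrite lexx ltW.
pose phi s := f (s *: e i + (h *: e j + x)) - f (s *: e i + x).
pose dphi s := partial i f (s *: e i + (h *: e j + x)) - partial i f (s *: e i + x).
have hh : 0 <= h <= h by rewrite lexx ltW.
have dphiP (s : R) : 0 <= s <= h -> is_derive s 1 phi (dphi s).
  move=> sh; have h1 := line_derive (df _ (nz s h sh hh)).
  have h2 := line_derive (df _ (nz1 s sh)).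
  exact: is_deriveB.
have [||s s01 E1] := @MVT R phi dphi 0 h h0.
- by move=> s; rewrite in_itv/= => /andP[s0 sh]; apply: dphiP; rewrite !ltW.
- apply: derivable_within_continuous => s; rewrite in_itv/= => sh.
  by have [] := dphiP s sh.
move: s01 E1; rewrite in_itv/= => /andP[s0 sh]; rewrite subr0 => E1.
have sh' : 0 <= s <= h by rewrite !ltW.
pose psi t := partial i f (t *: e j + (s *: e i + x)).
pose dpsi t := partial j (partial i f) (t *: e j + (s *: e i + x)).
have dpsiP (t : R) : 0 <= t <= h -> is_derive t 1 psi (dpsi t).
  move=> th; apply: line_derive; have [dpf _] := pf i; apply: dpf.
  by rewrite addrCA; exact: nz.
have [||t t01 E2] := @MVT R psi dpsi 0 h h0.
- by move=> t; rewrite in_itv/= => /andP[t0 th]; apply: dpsiP; rewrite !ltW.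
- apply: derivable_within_continuous => t; rewrite in_itv/= => th.
  by have [] := dpsiP t th.
move: t01 E2; rewrite in_itv/= => /andP[t0 th]; rewrite subr0 => E2.
exists s, t; rewrite !ltW//; split => //.
have E3 : psi h - psi 0 = dphi s.
  by rewrite /psi /dphi scale0r add0r (addrCA (h *: e j)).
rewrite (addrCA (s *: e i) (t *: e j) x) -/(dpsi t) -E2 E3 -E1 /phi.
rewrite !scale0r !add0r; ring.
Qed.

(** The second difference is symmetric in i and j, so [mixed_difference] gives points arbitrarily
    near x at which the two mixed derivatives coincide; continuity at x concludes. *)
Lemma partialC f i j x : Cm 2 f -> x != 0 ->
  partial i (partial j f) x = partial j (partial i f) x.
Proof.
move=> Cf x0; set a := partial i (partial j f); set b := partial j (partial i f).
have ca : {for x, continuous a}.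
  by have [_ /(_ j)[_ /(_ i)]] := Cf; apply.
have cb : {for x, continuous b}.
  by have [_ /(_ i)[_ /(_ j)]] := Cf; apply.
apply/eqP; apply: contraT => ab; pose d := `|a x - b x| / 2.
have d0 : 0 < d by rewrite divr_gt0// normr_gt0 subr_eq0.
have na : \forall y \near x, `|a x - a y| < d by move/cvgrPdist_lt : ca; apply.
have nb : \forall y \near x, `|b x - b y| < d by move/cvgrPdist_lt : cb; apply.
have : \forall y \near x, [/\ y != 0, `|a x - a y| < d & `|b x - b y| < d].
  by apply: filterS3 (near_neq0 x0) na nb => y *; split.
move=> /nbhs_ballP[rho /= rho0 Hr].
(* The parallelogram of side h stays within h c = rho / 2 of x; the summand 1 makes c visibly
   positive. *)
pose c := 1 + `|e i| + `|e j|.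
have c0 : 0 < c by rewrite /c -addrA ltr_pwDl// addr_ge0.
pose h := rho / (2 * c).
have h0 : 0 < h by rewrite divr_gt0// mulr_gt0.
have inb s t : 0 <= s <= h -> 0 <= t <= h -> ball x rho (s *: e i + (t *: e j + x)).
  move=> /andP[s0 sh] /andP[t0 th]; rewrite -ball_normE/= addrA opprD addrCA subrr addr0 normrN.
  apply: (le_lt_trans (ler_normD _ _)); rewrite !normrZ !ger0_norm//.
  apply: (@le_lt_trans _ _ (h * c)).
    have := ler_pM s0 (normr_ge0 (e i)) sh (lexx _); have := ler_pM t0 (normr_ge0 (e j)) th (lexx _).
    rewrite /c; nra.
  have -> : h * c = rho / 2 by rewrite /h; field; rewrite gt_eqF.
  lra.
have [s [t [s0 t0 E1]]] : exists s t, [/\ 0 <= s <= h, 0 <= t <= h &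
    f (h *: e i + (h *: e j + x)) - f (h *: e i + x) - f (h *: e j + x) + f x =
    b (s *: e i + (t *: e j + x)) * h * h].
  by apply: mixed_difference => // s t sh th; have [] := Hr _ (inb s t sh th).
have [t' [s' [t0' s0' E2]]] : exists t s, [/\ 0 <= t <= h, 0 <= s <= h &
    f (h *: e j + (h *: e i + x)) - f (h *: e j + x) - f (h *: e i + x) + f x =
    a (t *: e j + (s *: e i + x)) * h * h].
  apply: mixed_difference => // t' s' th sh; rewrite addrCA.
  by have [] := Hr _ (inb s' t' sh th).
clearbody a b.
have ab' : b (s *: e i + (t *: e j + x)) = a (s' *: e i + (t' *: e j + x)).
  have hn : h != 0 by rewrite gt_eqF.
  rewrite (addrCA (t' *: e j)) (addrCA (h *: e j)) in E2.
  apply: (mulIf hn); apply: (mulIf hn).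
  by rewrite -[LHS]E1 -[RHS]E2; ring.
have [_ _ h1] := Hr _ (inb s t s0 t0).
have [_ h2 _] := Hr _ (inb s' t' s0' t0').
rewrite ab' (distrC (b x)) in h1.
have := ler_distD (a (s' *: e i + (t' *: e j + x))) (a x) (b x).
move: h1 h2; rewrite /d; move: (`|a x - b x|) (`|_ - b x|) (`|_ - _|) => A B C; lra.
Qed.

Definition hom0 k := forall (c : R) x, 0 < c -> x != 0 -> k (c *: x) = k x.

Lemma partial_hom0 k i (c : R) x : hom0 k -> (forall x, x != 0 -> differentiable k x) ->
  0 < c -> x != 0 -> partial i k (c *: x) = c^-1 * partial i k x.
Proof.
move=> hk dk c0 x0.
have cx0 : c *: x != 0 by rewrite scaler_eq0 (gt_eqF c0).
have hk' y : k (c *: y) = k y.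
  by have [->|y0] := eqVneq y 0; [rewrite scaler0|exact: hk].
have h1 : is_derive (0 : R) 1 (fun s => k (s *: e i + c *: x)) (partial i k (0 *: e i + c *: x)).
  by apply: line_derive; rewrite scale0r add0r; exact: dk.
have h2 : is_derive (0 * c^-1 : R) 1 (fun s => k (s *: e i + x)) (partial i k ((0 * c^-1) *: e i + x)).
  by apply: line_derive; rewrite mul0r scale0r add0r; exact: dk.
have h3 : is_derive (0 : R) 1 (fun s => s * c^-1) c^-1.
  by apply: is_derive_eq; rewrite /GRing.scale/= mulr0 add0r mulr1.
have h4 := @is_derive1_comp _ (fun s => k (s *: e i + x)) (fun s => s * c^-1) 0 _ _ h2 h3.
have E : (fun s => k (s *: e i + x)) \o (fun s => s * c^-1) = (fun s => k (s *: e i + c *: x)).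
  apply/funext => s /=; rewrite -[LHS]hk' scalerDr scalerA mulrCA divff ?mulr1// gt_eqF//.
rewrite E in h4.
have := derive_val (is_derive := h4); rewrite (derive_val (is_derive := h1)).
by rewrite mul0r !scale0r !add0r mulrC.
Qed.

(** The sum is the derivative of k at x in the direction x, and k is constant on the ray through
    x. *)
Lemma euler_hom0 k x : hom0 k -> (forall x, x != 0 -> differentiable k x) ->
  x != 0 -> \sum_i x i ord0 * partial i k x = 0.
Proof.
move=> hk dk x0; have dx := dk x x0.
transitivity ('D_x k x).
  have E v : v = \sum_i v i ord0 *: e i.
    apply/colP => j; rewrite summxE (bigD1 j)//= !mxE !eqxx mulr1 big1 ?addr0// => l lj.
    by rewrite !mxE eq_sym (negbTE lj) mulr0.
  have dE v : 'd k x v = \sum_i v i ord0 * 'd k x (e i).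
    by rewrite {1}[v]E linear_sum; apply: eq_bigr => i _; rewrite linearZ.
  rewrite deriveE// dE; apply: eq_bigr => i _.
  by rewrite /partial deriveE.
have h1 : is_derive (1 : R) 1 (fun s => k (s *: x + 0)) ('D_x k (1 *: x + 0)).
  by apply: line_derive; rewrite scale1r addr0.
rewrite -[X in 'D_x k X]addr0 -[X in 'D_x k (X + 0)]scale1r -(@derive_val _ _ _ _ _ _ _ h1).
rewrite (near_eq_derive (g := cst (k x))) ?derive_cst//.
have : \forall s \near (1 : R), 0 < s by exact: lt_nbhsr.
by apply: filterS => s s0; rewrite addr0 hk.
Qed.

Lemma continuous_sqr_enorm : continuous (fun x => \sum_i (x i ord0) ^+ 2).
Proof. by move=> x; apply/differentiable_continuous/differentiable_sqr_enorm. Qed.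

Lemma continuous_trmx : continuous (fun x : 'rV[R]_n => x^T).
Proof.
move=> x A /nbhs_ballP[eps eps0 HA]; apply/nbhs_ballP; exists eps => // y [_ xy].
by apply: HA; split=> // i j; rewrite !mxE; exact: xy.
Qed.

(** Off 0 every value of k is taken on the unit sphere, which is compact; the value at 0 is covered
    by the maximum in C. Transposition puts the sphere among row vectors, where boundedness and
    closedness give compactness. *)
Lemma hom0_bounded k : measurable_fun setT k -> hom0 k -> Cm 0 k -> exists C, forall x, `|k x| <= C.
Proof.
move=> _ hk ck.
pose S : set 'rV[R]_n := [set r | \sum_i (r^T i ord0) ^+ 2 = 1].
have S0 r : S r -> r^T != 0.
  move=> Sr; apply/eqP => r0; move: Sr; rewrite /S /= r0 big1 => [|i _]; last by rewrite mxE expr0n.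
  by move=> /esym/eqP; rewrite oner_eq0.
have cS : compact S.
  apply: bounded_closed_compact.
    exists 1; split; first exact: num_real.
    move=> M M1 r Sr; apply: (le_trans _ (ltW M1)).
    rewrite [leLHS]/Num.norm/= mx_normrE; apply/bigmax_leP; split => // -[i j] _ /=.
    rewrite -(@ler_pXn2r _ 2)// ?nnegrE// expr1n -[leRHS]Sr real_normK ?num_real//.
    rewrite (bigD1 j)//= mxE (ord1 i) lerDl sumr_ge0// => l _; exact: sqr_ge0.
  apply: (@closed_comp _ _ (fun r : 'rV[R]_n => \sum_i (r^T i ord0) ^+ 2) [set 1]).
    move=> r _; exact: (cvg_comp _ _ (@continuous_trmx r) (@continuous_sqr_enorm _)).
  exact: closed_eq.
have : compact ((fun r => k r^T) @` S).
  apply: continuous_compact cS; apply: continuous_in_subspaceT => r; rewrite inE => /S0 r0.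
  by apply: continuous_comp; [exact: continuous_trmx|exact: ck].
move=> /compact_bounded[M [_ HM]].
pose C := Num.max (M + 1) `|k 0|; exists C => x.
have [->|x0] := eqVneq x 0; first by rewrite /C le_max lexx orbT.
have nx : 0 < enorm x by rewrite enorm_gt0.
rewrite /C le_max; apply/orP; left.
rewrite -(hk (enorm x)^-1)// ?invr_gt0//; apply: (HM (M + 1)); first by rewrite ltrDl.
exists ((enorm x)^-1 *: x)^T; last by rewrite trmxK.
rewrite /S /= trmxK; under eq_bigr do rewrite mxE exprMn.
rewrite -mulr_sumr -sqr_enorm exprVn mulVf// expf_eq0/= gt_eqF//.
Qed.

(** A pointwise limit of difference quotients with steps [harmonic m]. The factor |x| makes the
    sequence identically 0 at the origin, where k need not be differentiable. *)
Lemma measurable_enorm_partial k i : measurable_fun setT k ->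
  (forall x, x != 0 -> differentiable k x) ->
  measurable_fun setT (fun x => enorm x * partial i k x).
Proof.
move=> mk dk.
pose q (m : nat) x := enorm x * ((harmonic m)^-1 * (k (harmonic m *: e i + x) - k x)).
apply: (@measurable_fun_cvg _ _ _ _ q) => [m|x _].
  apply: measurable_funM; first exact: measurable_enorm.
  apply: measurable_funM => //; apply: measurable_funB => //.
  apply: (measurableT_comp mk); apply: measurable_fun_cV => j.
  under eq_fun do rewrite mxE; apply: measurable_funD => //.
  exact: measurable_coor.
have [->|x0] := eqVneq x 0.
  by rewrite /q enorm0 mul0r; under eq_fun do rewrite mul0r; exact: cvg_cst.
rewrite /q; apply: cvgMr.
have := @diff_derivable _ _ _ _ _ (e i) (dk x x0); rewrite /derivable => dkx.
have h0 : @harmonic R @ \oo --> 0^'.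
  move=> A; rewrite /dnbhs /within /= => nA.
  have h1 : \forall m \near \oo, (harmonic m : R) != 0 -> A (harmonic m) by exact: (@cvg_harmonic R _ nA).
  apply: filterS h1 => m Hm; apply: Hm.
  by rewrite /harmonic/= invr_eq0.
exact: (cvg_comp _ _ h0 dkx).
Qed.

(* C^oo functions on the sphere, as functions on R^n that are constant on rays;
   [rpartial i] stands for |x| times the i-th partial derivative, which keeps
   this homogeneity, and [dir x] is the unit vector x / |x| (0 at x = 0). *)
Definition smooth0 k := [/\ measurable_fun setT k, hom0 k & forall m, Cm m k].

Definition rpartial i k x := enorm x * partial i k x.
Definition dir i x := x i ord0 * inorm x.

Lemma smooth0_diff k x : smooth0 k -> x != 0 -> differentiable k x.
Proof. by move=> [_ _ /(_ 1%N)[dk _]]; exact: dk. Qed.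

Lemma smooth0_cst (c : R) : smooth0 (fun=> c).
Proof. by split => // m; exact: Cm_cst. Qed.

Lemma smooth0D f g : smooth0 f -> smooth0 g -> smooth0 (fun x => f x + g x).
Proof.
move=> [mf hf cf] [mg hg cg]; split; first exact: measurable_funD.
  by move=> c x c0 x0; rewrite hf// hg.
by move=> m; exact: CmD.
Qed.

Lemma smooth0M f g : smooth0 f -> smooth0 g -> smooth0 (fun x => f x * g x).
Proof.
move=> [mf hf cf] [mg hg cg]; split; first exact: measurable_funM.
  by move=> c x c0 x0; rewrite hf// hg.
by move=> m; exact: CmM.
Qed.

Lemma smooth0Z (c : R) f : smooth0 f -> smooth0 (fun x => c * f x).
Proof. by move=> sf; apply: smooth0M => //; exact: smooth0_cst. Qed.

Lemma smooth0B f g : smooth0 f -> smooth0 g -> smooth0 (fun x => f x - g x).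
Proof.
move=> sf sg; have := smooth0D sf (smooth0Z (-1) sg).
by under [X in _ -> smooth0 X]eq_fun do rewrite -mulN1r.
Qed.

Lemma smooth0_sum (I : Type) (s : seq I) (F : I -> V -> R) : (forall i, smooth0 (F i)) ->
  smooth0 (fun x => \sum_(i <- s) F i x).
Proof.
move=> sF; elim: s => [|a s IH].
  by under eq_fun do rewrite big_nil; exact: smooth0_cst.
by under eq_fun do rewrite big_cons; exact: smooth0D.
Qed.

Lemma smooth0_rpartial i k : smooth0 k -> smooth0 (rpartial i k).
Proof.
move=> sk; have [mk hk ck] := sk; split.
- by apply: measurable_enorm_partial => // x; exact: smooth0_diff.
- move=> c x c0 x0; rewrite /rpartial partial_hom0// => [|y]; last exact: smooth0_diff.
  by rewrite enormZ gtr0_norm// mulrACA divff ?gt_eqF// mul1r.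
- move=> m; have [_ pk] := ck m.+1.
  exact: (CmM (Cm_enorm m) (pk i)).
Qed.

Lemma smooth0_dir i : smooth0 (dir i).
Proof.
split.
- apply: measurable_funM; first exact: measurable_coor.
  exact: measurable_inorm.
- move=> c x c0 x0; rewrite /dir /inorm enormZ gtr0_norm// mxE invfM mulrACA.
  by rewrite divff ?gt_eqF// mul1r.
- by move=> m; apply: CmM; [exact: Cm_coord|exact: Cm_inorm].
Qed.

Lemma rpartialM i f g x : smooth0 f -> smooth0 g ->
  rpartial i (fun x => f x * g x) x = rpartial i f x * g x + f x * rpartial i g x.
Proof.
move=> sf sg; rewrite /rpartial; have [->|x0] := eqVneq x 0.
  by rewrite enorm0 !mul0r mulr0 addr0.
rewrite partialM//; [ring|exact: smooth0_diff|exact: smooth0_diff].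
Qed.

Lemma rpartial_dir i j x : x != 0 -> rpartial i (dir j) x = (i == j)%:R - dir i x * dir j x.
Proof.
move=> x0; have n0 : enorm x != 0 by rewrite enorm_eq0.
rewrite /rpartial /dir partialM//; [|exact: differentiable_coord|exact: differentiable_inorm].
rewrite partial_inorm// {1}/partial (@derive_val _ _ _ _ _ _ _ (coord_derive j x (e i))).
by rewrite !mxE eqxx andbT eq_sym /inorm; field.
Qed.

(** Ordinary partial derivatives commute, so only the derivative of the outer factor |x|
    survives. *)
Lemma rpartial_comm i j k x : smooth0 k -> x != 0 ->
  rpartial i (rpartial j k) x - rpartial j (rpartial i k) x = dir i x * rpartial j k x - dir j x * rpartial i k x.
Proof.
move=> [_ _ ck] x0; have n0 : enorm x != 0 by rewrite enorm_eq0.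
have [_ pk] := ck 2%N.
have dp l : differentiable (partial l k) x by have [+ _] := pk l; apply.
rewrite /rpartial !partialM//; try exact: differentiable_enorm.
rewrite !partial_enorm// (partialC i j (ck 2%N) x0).
by rewrite /dir /inorm; field.
Qed.

Lemma euler_rpartial k x : smooth0 k -> x != 0 -> \sum_i dir i x * rpartial i k x = 0.
Proof.
move=> sk x0; have [_ hk _] := sk.
have E : \sum_i x i ord0 * partial i k x = 0.
  by apply: euler_hom0 => // y; exact: smooth0_diff.
rewrite -[RHS]E; apply: eq_bigr => i _; rewrite /dir /rpartial /inorm; field.
by rewrite enorm_eq0.
Qed.

Lemma sum_dir_sqr x : x != 0 -> \sum_i dir i x * dir i x = 1.
Proof.
move=> x0; rewrite /dir; under eq_bigr do rewrite mulrACA -expr2.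
rewrite -mulr_suml -sqr_enorm /inorm; field.
by rewrite enorm_eq0.
Qed.

Lemma smooth0_bounded k : smooth0 k -> exists C, forall x, `|k x| <= C.
Proof. by move=> [mk hk ck]; apply: hom0_bounded => //; exact: ck. Qed.

End homogeneous.

(** * Integral identities on the sphere *)

Section real_expectation.
Context d (T : measurableType d) (R : realType) (P : probability T R).
Notation int f := (P.-integrable setT (EFin \o f)).
Implicit Types f g : T -> R.

Lemma integrable_funD f g : int f -> int g -> int (fun x => f x + g x).
Proof. by move=> fi gi; have := integrableD measurableT fi gi; apply: eq_integrable. Qed.

Lemma integrable_funB f g : int f -> int g -> int (fun x => f x - g x).
Proof. by move=> fi gi; have := integrableB measurableT fi gi; apply: eq_integrable. Qed.

Lemma integrable_funZ (c : R) f : int f -> int (fun x => c * f x).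
Proof. by move=> fi; have := integrableZl measurableT c fi; apply: eq_integrable. Qed.

Lemma integrable_fun_sum (I : Type) (s : seq I) (F : I -> T -> R) : (forall i, int (F i)) ->
  int (fun x => \sum_(i <- s) F i x).
Proof.
move=> iF; elim: s => [|a s IH].
  under eq_fun do rewrite big_nil; exact: integrable0.
by under eq_fun do rewrite big_cons; exact: integrable_funD.
Qed.

Lemma Rintegral_sum (I : Type) (s : seq I) (F : I -> T -> R) : (forall i, int (F i)) ->
  \int[P]_x (\sum_(i <- s) F i x) = \sum_(i <- s) \int[P]_x F i x.
Proof.
move=> iF; elim: s => [|a s IH].
  by under eq_Rintegral do rewrite big_nil; rewrite big_nil Rintegral_prob_cst.
under eq_Rintegral do rewrite big_cons; rewrite big_cons RintegralD// ?IH//.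
exact: integrable_fun_sum.
Qed.

Lemma Rintegral_eq0 f g : int f -> int g ->
  (\int[P]_x (f x - g x)%:E = 0)%E -> \int[P]_x f x = \int[P]_x g x.
Proof.
move=> fi gi h; apply/eqP; rewrite -subr_eq0 -RintegralB//.
by rewrite /Rintegral h.
Qed.

Lemma integral_EFin f : int f -> (\int[P]_x (f x)%:E = (\int[P]_x f x)%:E)%E.
Proof. by move=> fi; rewrite /Rintegral fineK//; exact: (integrable_fin_num measurableT fi). Qed.

End real_expectation.

Section gaussian_sphere.
Context {R : realType} {n : nat}.
Notation V := 'cV[R]_n.
Notation G := (gaussian R n).
Notation int f := (G.-integrable setT (EFin \o f)).
Implicit Types (f g k : V -> R) (x y : V).
Hypothesis n1 : (1 < n)%N.

Lemma other_coord (i : 'I_n) : exists j : 'I_n, j != i.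
Proof.
have [i0|i0] := eqVneq (i : nat) 0%N.
  by exists (Ordinal n1); rewrite -val_eqE/= i0.
by exists (Ordinal (ltnW n1)); rewrite -val_eqE/= eq_sym.
Qed.

Lemma ae_neq0 : {ae G, forall x, x != 0}.
Proof.
have := @ae_coord_neq0 R n (Ordinal n1); apply: filterS => x xj.
by apply/eqP => x0; rewrite x0 mxE eqxx in xj.
Qed.

Lemma eq_Rintegral_off0 f g : measurable_fun setT f -> measurable_fun setT g ->
  eq_off0 f g -> \int[G]_x f x = \int[G]_x g x.
Proof.
move=> mf mg fg; congr fine; apply: ae_eq_integral => //; try exact/measurable_EFinP.
by have := ae_neq0; apply: filterS => x x0 _; rewrite fg.
Qed.

Lemma smooth0_integrable k : smooth0 k -> int k.
Proof.
move=> sk; have [C kC] := smooth0_bounded sk; have [mk _ _] := sk.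
exact: bounded_integrable mk kC.
Qed.

Lemma Rintegral_smooth0B f g : smooth0 f -> smooth0 g ->
  \int[G]_x (f x - g x) = \int[G]_x f x - \int[G]_x g x.
Proof. by move=> sf sg; apply: RintegralB => //; exact: smooth0_integrable. Qed.

Lemma Rintegral_smooth0D f g : smooth0 f -> smooth0 g ->
  \int[G]_x (f x + g x) = \int[G]_x f x + \int[G]_x g x.
Proof. by move=> sf sg; apply: RintegralD => //; exact: smooth0_integrable. Qed.

Lemma Rintegral_smooth0Z (c : R) f : smooth0 f -> \int[G]_x (c * f x) = c * \int[G]_x f x.
Proof. by move=> sf; apply: RintegralZl => //; exact: smooth0_integrable. Qed.

Lemma eq_Rintegral_smooth0 f g : smooth0 f -> smooth0 g -> eq_off0 f g ->
  \int[G]_x f x = \int[G]_x g x.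
Proof. by move=> [mf _ _] [mg _ _]; exact: eq_Rintegral_off0. Qed.

Lemma smooth0_integrable_sqr k : smooth0 k -> int (fun x => enorm x ^+ 2 * k x).
Proof.
move=> sk; have [C kC] := smooth0_bounded sk; have [mk _ _] := sk.
apply: (dominated_integrable (g := fun x => C * enorm x ^+ 2)).
- by apply: measurable_funM => //; apply: measurable_funX; exact: measurable_enorm.
- by move=> x; rewrite normrM (ger0_norm (sqr_ge0 _)) mulrC ler_wpM2r// sqr_ge0.
- by apply: integrable_funZ; exact: integrable_enorm_sqr.
Qed.

(** Stein's identity for |x| k, which has linear growth since k is bounded, and whose i-th
    derivative is again constant on rays. *)
Lemma stein_enorm i k : smooth0 k ->
  \int[G]_x (enorm x ^+ 2 * (dir i x * k x)) = \int[G]_x (dir i x * k x + rpartial i k x).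
Proof.
move=> sk; have [mk _ ck] := sk.
have spsi : smooth0 (fun x => dir i x * k x + rpartial i k x).
  by apply: smooth0D; [exact: smooth0M (smooth0_dir i) sk|exact: smooth0_rpartial].
have [C kC] := smooth0_bounded sk; have [C' psiC'] := smooth0_bounded spsi.
have C0 : 0 <= C by apply: le_trans (kC 0).
have C'0 : 0 <= C' by apply: le_trans (psiC' 0).
have [j ji] := other_coord i.
have [] := @stein_gaussian R n i j (fun x => enorm x * k x) (fun x => dir i x * k x + rpartial i k x) (C + C') ji.
- by apply: measurable_funM => //; exact: measurable_enorm.
- by have [] := spsi.
- by move=> x x0; apply: differentiableM; [exact: differentiable_enorm|exact: smooth0_diff].
- move=> x x0; rewrite partialM//; [|exact: differentiable_enorm|exact: smooth0_diff].
  by rewrite partial_enorm.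
- by move=> x x0; have [_ _ /(_ 0%N)] := spsi; apply.
- move=> x; rewrite normrM (ger0_norm (enorm_ge0 x)).
  have := kC x; have := enorm_ge0 x; have := normr_ge0 (k x).
  move: (enorm x) (`|k x|) => N K K0 N0 KC; nra.
- move=> x; apply: (le_trans (psiC' x)); have := enorm_ge0 x; nra.
move=> _ h; apply: Rintegral_eq0.
- by apply: smooth0_integrable_sqr; exact: smooth0M (smooth0_dir i) sk.
- exact: smooth0_integrable.
rewrite -[RHS]h; apply: eq_integral => x _; congr (_ - _)%:E.
rewrite /dir /inorm; have [->|x0] := eqVneq x 0.
  by rewrite enorm0 mxE !(mul0r, expr0n).
by field; rewrite enorm_eq0.
Qed.

Lemma sum_rpartial_dir k x : smooth0 k -> x != 0 ->
  \sum_i (dir i x * (dir i x * k x) + rpartial i (fun x => dir i x * k x) x) = n%:R * k x.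
Proof.
move=> sk x0; under eq_bigr => i _.
  rewrite (rpartialM _ _ (smooth0_dir i) sk) rpartial_dir// eqxx/=.
  rewrite (_ : _ + _ = k x + dir i x * rpartial i k x); last by ring.
  over.
by rewrite big_split/= sumr_const card_ord euler_rpartial// addr0 mulr_natl.
Qed.

(** Plays the part of the independence of |x| and x / |x| together with E[|x|^2] = n. It comes from
    [stein_enorm] for the functions p_i k, summed over i: the p_i^2 add up to 1 on the left, and
    [sum_rpartial_dir] gives n k on the right. *)
Lemma Rintegral_enorm_sqr k : smooth0 k ->
  \int[G]_x (enorm x ^+ 2 * k x) = n%:R * \int[G]_x k x.
Proof.
move=> sk.
have spk i : smooth0 (fun x => dir i x * k x) by exact: smooth0M (smooth0_dir i) sk.
have sppk i : smooth0 (fun x => dir i x * (dir i x * k x)) by exact: smooth0M (smooth0_dir i) (spk i).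
transitivity (\int[G]_x (\sum_i enorm x ^+ 2 * (dir i x * (dir i x * k x)))).
  apply: eq_Rintegral => x _; have [->|x0] := eqVneq x 0.
    by rewrite enorm0 expr0n/= mul0r big1// => i _; rewrite mul0r.
  rewrite -mulr_sumr; under [in RHS]eq_bigr do rewrite mulrA.
  by rewrite -mulr_suml sum_dir_sqr// mul1r.
rewrite Rintegral_sum; last by move=> i; exact: smooth0_integrable_sqr.
under eq_bigr do rewrite stein_enorm//.
rewrite -Rintegral_sum; last first.
  by move=> i; apply: smooth0_integrable; apply: smooth0D => //; exact: smooth0_rpartial.
rewrite -RintegralZl//; last exact: smooth0_integrable.
apply: eq_Rintegral_off0.
- have [] // : smooth0 (fun x => \sum_i (dir i x * (dir i x * k x) + rpartial i (fun x => dir i x * k x) x)).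
  by apply: smooth0_sum => i; apply: smooth0D => //; exact: smooth0_rpartial.
- by have [] := smooth0Z n%:R sk.
by move=> x x0; rewrite sum_rpartial_dir.
Qed.

(** In [stein_enorm] the weight |x|^2 now counts as the factor n, and one copy of E[p_i k] is
    subtracted from n of them. *)
Lemma Rintegral_rpartial i k : smooth0 k ->
  \int[G]_x rpartial i k x = (n%:R - 1) * \int[G]_x (dir i x * k x).
Proof.
move=> sk; have spk : smooth0 (fun x => dir i x * k x) by exact: smooth0M (smooth0_dir i) sk.
have := stein_enorm i sk; rewrite Rintegral_enorm_sqr// RintegralD//.
- lra.
- exact: smooth0_integrable.
- by apply: smooth0_integrable; exact: smooth0_rpartial.
Qed.

Lemma Rintegral_by_parts i f g : smooth0 f -> smooth0 g ->
  \int[G]_x (rpartial i f x * g x) =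
  (n%:R - 1) * \int[G]_x (dir i x * (f x * g x)) - \int[G]_x (f x * rpartial i g x).
Proof.
move=> sf sg; have sfg := smooth0M sf sg.
rewrite -Rintegral_rpartial//; have sDf := smooth0_rpartial i sf; have sDg := smooth0_rpartial i sg.
under [X in _ = X - _]eq_Rintegral do rewrite rpartialM//.
rewrite RintegralD ?addrK//; apply: smooth0_integrable; exact: smooth0M.
Qed.

(** The elimination behind [sphere_bilinear]. With p_i for [dir i], the letters are the means A of
    p_i f p_j g, B of f g, C of p_i f D_j g, D of p_j f D_i g, P of f D_i (p_j g), X of f D_i D_j g
    and Y of f D_j D_i g. Both sides equal (N - 2) (C - D). *)
Lemma bilinear_algebra (N dl A B C D P X Y : R) : X - Y = C - D -> P = dl * B - A + D ->
  (N - 1) * C - X - ((N - 1) * D - Y) =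
  (N - 2) * (C + ((N - 1) * A - P) - N * A + dl * B).
Proof.
move=> h1 ->; have -> : X = Y + (C - D) by rewrite -h1; ring.
ring.
Qed.

(* Integrating by parts moves both derivatives onto g; the two resulting second-order terms differ by [rpartial_comm]. *)
Lemma sphere_bilinear i j f g : smooth0 f -> smooth0 g ->
  \int[G]_x (rpartial i f x * rpartial j g x) - \int[G]_x (rpartial j f x * rpartial i g x) =
  (n%:R - 2) * (\int[G]_x (dir i x * f x * rpartial j g x) + \int[G]_x (rpartial i f x * (dir j x * g x))
    - n%:R * \int[G]_x (dir i x * f x * (dir j x * g x)) + (i == j)%:R * \int[G]_x (f x * g x)).
Proof.
move=> sf sg.
have si := smooth0_dir (R := R) i; have sj := smooth0_dir (R := R) j.
have sDig := smooth0_rpartial i sg; have sDjg := smooth0_rpartial j sg.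
have sDif := smooth0_rpartial i sf; have sDjf := smooth0_rpartial j sf.
have spjg := smooth0M sj sg; have spif := smooth0M si sf; have spig := smooth0M si sg.
rewrite (Rintegral_by_parts i sf sDjg) (Rintegral_by_parts j sf sDig) (Rintegral_by_parts i sf spjg).
have -> : \int[G]_x (dir i x * (f x * rpartial j g x)) = \int[G]_x (dir i x * f x * rpartial j g x).
  by apply: eq_Rintegral => x _; rewrite mulrA.
have -> : \int[G]_x (dir i x * (f x * (dir j x * g x))) = \int[G]_x (dir i x * f x * (dir j x * g x)).
  by apply: eq_Rintegral => x _; rewrite mulrA.
have h1 : \int[G]_x (f x * rpartial i (rpartial j g) x) - \int[G]_x (f x * rpartial j (rpartial i g) x) =
    \int[G]_x (dir i x * f x * rpartial j g x) - \int[G]_x (dir j x * (f x * rpartial i g x)).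
  have sDD := smooth0_rpartial i sDjg; have sDD' := smooth0_rpartial j sDig.
  have a1 := smooth0M sf sDD; have a2 := smooth0M sf sDD'.
  have a3 := smooth0M spif sDjg; have a4 := smooth0M sj (smooth0M sf sDig).
  apply: (etrans (esym (Rintegral_smooth0B a1 a2))); apply: (etrans _ (Rintegral_smooth0B a3 a4)).
  apply: (eq_Rintegral_smooth0 (smooth0B a1 a2) (smooth0B a3 a4)) => x x0.
  by rewrite -mulrBr rpartial_comm//; ring.
have h2 : \int[G]_x (f x * rpartial i (fun x => dir j x * g x) x) =
   (i == j)%:R * \int[G]_x (f x * g x) - \int[G]_x (dir i x * f x * (dir j x * g x))
   + \int[G]_x (dir j x * (f x * rpartial i g x)).
  have a1 := smooth0M sf sg; have a2 := smooth0M spif spjg.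
  have a3 := smooth0M sj (smooth0M sf sDig); have a4 := smooth0Z (i == j)%:R a1.
  have e1 := Rintegral_smooth0Z (i == j)%:R a1; have e2 := Rintegral_smooth0B a4 a2.
  have e3 := Rintegral_smooth0D (smooth0B a4 a2) a3.
  apply: (etrans _ (etrans e3 _)); last by rewrite e2 e1.
  apply: (eq_Rintegral_smooth0 (smooth0M sf (smooth0_rpartial i spjg)) (smooth0D (smooth0B a4 a2) a3)) => x x0.
  by rewrite rpartialM// rpartial_dir//; ring.
exact: bilinear_algebra h1 h2.
Qed.

(* regularizes 1 / |x|^2 *)
Definition wgt (eps : R) x := (enorm x ^+ 2 + eps)^-1.

Lemma wgt_bound (eps : R) x : 0 < eps ->
  [/\ 0 < wgt eps x, wgt eps x <= eps^-1 & enorm x ^+ 2 * wgt eps x <= 1].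
Proof.
move=> e0; have q0 : 0 <= enorm x ^+ 2 by exact: sqr_ge0.
have qe : 0 < enorm x ^+ 2 + eps by lra.
split; first by rewrite invr_gt0.
- by rewrite lef_pV2// ?posrE//; lra.
- by rewrite ler_pdivrMr//; lra.
Qed.

Lemma differentiable_enorm2 x : differentiable (fun x => enorm x ^+ 2) x.
Proof.
rewrite (_ : (fun x => _) = fun x => \sum_i (x i ord0) ^+ 2).
  exact: differentiable_sqr_enorm.
by apply/funext => y; rewrite sqr_enorm.
Qed.

Lemma partial_enorm2 i x : partial i (fun x => enorm x ^+ 2) x = 2 * x i ord0.
Proof.
rewrite (_ : (fun x => _) = fun x => \sum_i (x i ord0) ^+ 2).
  exact: partial_sqr_enorm.
by apply/funext => y; rewrite sqr_enorm.
Qed.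

Lemma differentiable_wgt (eps : R) x : 0 < eps -> differentiable (wgt eps) x.
Proof.
move=> e0; apply: differentiableV.
  by apply: (@differentiableD _ _ R^o); [exact: differentiable_enorm2|exact: differentiable_cst].
by rewrite gt_eqF// ltr_wpDl// sqr_ge0.
Qed.

Lemma partial_wgt (eps : R) i x : 0 < eps ->
  partial i (wgt eps) x = - (2 * x i ord0 * wgt eps x ^+ 2).
Proof.
move=> e0; have q0 : enorm x ^+ 2 + eps != 0 by rewrite gt_eqF// ltr_wpDl// sqr_ge0.
have d1 : differentiable (fun x => enorm x ^+ 2 + eps) x.
  by apply: (@differentiableD _ _ R^o); [exact: differentiable_enorm2|exact: differentiable_cst].
rewrite /partial deriveV//; last exact: diff_derivable.
rewrite -[X in _ *: X]/(partial i (fun x => enorm x ^+ 2 + eps) x).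
have -> : partial i (fun x => enorm x ^+ 2 + eps) x = 2 * x i ord0.
  rewrite [LHS](partialD i (differentiable_enorm2 x) (differentiable_cst eps x)).
  by rewrite partial_enorm2 {1}/partial derive_cst addr0.
rewrite /GRing.scale/= /wgt.
by field.
Qed.

Lemma measurable_wgt (eps : R) : 0 < eps -> measurable_fun setT (wgt eps : V -> R).
Proof.
move=> e0; rewrite /wgt; under eq_fun => x.
  rewrite -powR_inv1; last by rewrite addr_ge0 ?sqr_ge0// ltW.
  over.
apply: (@measurableT_comp _ _ _ _ _ _ (fun a : R => a `^ (-1))) => //.
by apply: measurable_funD => //; apply: measurable_funX; exact: measurable_enorm.
Qed.

(* off 0, the i-th partial derivative of x_i k wgt *)
Definition partial_wgtM (eps : R) i k x := k x * wgt eps x + dir i x * rpartial i k x * wgt eps x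
  - 2 * (dir i x * dir i x) * (enorm x ^+ 2 * wgt eps x) * (k x * wgt eps x).

(** The field x k / (|x|^2 + eps) regularizes x k / |x|^2, whose divergence off 0 is (n - 2) k /
    |x|^2 when k is constant on rays. The regularization gives bounds that hold up to the origin. *)
Lemma stein_wgt (eps : R) i k : 0 < eps -> smooth0 k ->
  int (fun x => x i ord0 * (x i ord0 * (k x * wgt eps x)) - partial_wgtM eps i k x) /\
  (\int[G]_x (x i ord0 * (x i ord0 * (k x * wgt eps x)) - partial_wgtM eps i k x)%:E = 0)%E.
Proof.
move=> e0 sk; have [mk _ ck] := sk.
have [C kC] := smooth0_bounded sk.
have spD := smooth0M (smooth0_dir (R := R) i) (smooth0_rpartial i sk).
have spp := smooth0M (smooth0_dir (R := R) i) (smooth0_dir (R := R) i).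
have [C1 kC1] := smooth0_bounded spD; have [C2 kC2] := smooth0_bounded spp.
have C0 : 0 <= C by apply: le_trans (kC 0).
have C10 : 0 <= C1 by apply: le_trans (kC1 0).
have C20 : 0 <= C2 by apply: le_trans (kC2 0).
have [j ji] := other_coord i.
have [mspD _ _] := spD; have [mspp _ _] := spp.
have mw := measurable_wgt e0.
(* One summand for each term of [partial_wgtM], from [wgt] <= 1 / eps and |x|^2 [wgt] <= 1; the
   first also bounds the growth of x_i k [wgt]. *)
pose A := (C + C1 + 2 * C2 * C) * eps^-1.
have ei : 0 < eps^-1 by rewrite invr_gt0.
have dkw x : x != 0 -> differentiable (fun x => k x * wgt eps x) x.
  by move=> x0; apply: differentiableM; [exact: smooth0_diff|exact: differentiable_wgt].
have nw x : `|wgt eps x| <= eps^-1.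
  by have [w0 we _] := wgt_bound x e0; rewrite gtr0_norm.
have nkw x : `|k x * wgt eps x| <= C * eps^-1 by rewrite normrM ler_pM.
apply: (@stein_gaussian R n i j (fun x => x i ord0 * (k x * wgt eps x)) (partial_wgtM eps i k) A ji).
- apply: measurable_funM; first exact: measurable_coor.
  exact: measurable_funM.
- apply: measurable_funB.
    by apply: measurable_funD; apply: measurable_funM.
  apply: measurable_funM; last exact: measurable_funM.
  apply: measurable_funM; first exact: measurable_funM.
  by apply: measurable_funM => //; apply: measurable_funX; exact: measurable_enorm.
- by move=> x x0; apply: differentiableM; [exact: differentiable_coord|exact: dkw].
- move=> x x0; rewrite partialM//; [|exact: differentiable_coord|exact: dkw].
  rewrite partialM//; [|exact: smooth0_diff|exact: differentiable_wgt].
  rewrite partial_wgt// {1}/partial (derive_val (is_derive := coord_derive i x _)).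
  rewrite mxE !eqxx/= /partial_wgtM /dir /rpartial /inorm; field.
  by rewrite enorm_eq0.
- have cw : Cm 0 (wgt eps) by move=> x _; apply/differentiable_continuous/differentiable_wgt.
  have cq : Cm 0 (fun x => enorm x ^+ 2) by move=> x _; apply/differentiable_continuous/differentiable_enorm2.
  have [_ _ cpD] := spD; have [_ _ cpp] := spp.
  have := CmD (CmD (CmM (ck 0%N) cw) (CmM (cpD 0%N) cw))
    (CmM (CmM (CmM (Cm_cst _ (- 2)) (cpp 0%N)) (CmM cq cw)) (CmM (ck 0%N) cw)).
  move=> h x x0; have := h x x0; congr (continuous_at _ _); apply/funext => y.
  by rewrite /partial_wgtM !mulNr.
- move=> x; rewrite normrM.
  have := nkw x; have := enorm_coord i x; have := normr_ge0 (x i ord0); have := normr_ge0 (k x * wgt eps x).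
  have := enorm_ge0 x; move: (enorm x) (`|x i ord0|) (`|k x * wgt eps x|) => N a b N0 b0 a0 aN bC.
  have h0 : a * b <= N * (C * eps^-1) by rewrite ler_pM.
  have h1 : 0 <= (C1 + 2 * C2 * C) * eps^-1 by apply: mulr_ge0; [rewrite addr_ge0// !mulr_ge0|exact: ltW].
  have h2 : 0 <= C * eps^-1 by rewrite mulr_ge0// ltW.
  apply: (le_trans h0); rewrite /A; nra.
- move=> x; have [w0 we qw] := wgt_bound x e0.
  have qw0 : 0 <= enorm x ^+ 2 * wgt eps x by rewrite mulr_ge0 ?sqr_ge0// ltW.
  apply: (@le_trans _ _ A); last first.
    rewrite ler_peMr ?lerDl ?enorm_ge0//; apply: mulr_ge0; [|exact: ltW].
    by rewrite !addr_ge0// !mulr_ge0.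
  have -> : A = C * eps^-1 + C1 * eps^-1 + 2 * C2 * 1 * (C * eps^-1) by rewrite /A; ring.
  apply: (le_trans (ler_normB _ _)); apply: lerD.
    apply: (le_trans (ler_normD _ _)); apply: lerD => //.
    by rewrite normrM ler_pM.
  rewrite normrM; apply: ler_pM => //; rewrite normrM; apply: ler_pM => //.
    by rewrite normrM ger0_norm// ler_wpM2l.
  by rewrite ger0_norm.
Qed.

(** Summed over i, [stein_wgt] gives a function S of mean 0. With q = |x|^2 [wgt] <= 1, off 0 it
    satisfies k - S = (1 - q) k + (n - 2 q) k [wgt] >= (n - 2) k [wgt]. *)
Lemma wgt_radial_le (eps : R) k : 0 < eps -> smooth0 k -> (forall x, 0 <= k x) -> (2 < n)%N ->
  \int[G]_x (k x * wgt eps x) <= (n%:R - 2)^-1 * \int[G]_x k x.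
Proof.
move=> e0 sk k0 n2; have [mk _ _] := sk; have mw := measurable_wgt e0.
have [C kC] := smooth0_bounded sk.
have n20 : 0 < n%:R - 2 :> R by rewrite subr_gt0 ltr_nat.
have ik := smooth0_integrable sk.
have C0 : 0 <= C by apply: le_trans (kC 0).
have ikw : int (fun x => k x * wgt eps x).
  apply: (@bounded_integrable _ _ _ _ _ (C * eps^-1)) => [|x]; first exact: measurable_funM.
  by have [w0 we _] := wgt_bound x e0; rewrite normrM ler_pM// gtr0_norm.
rewrite ler_pdivlMl// -RintegralZl//.
pose S x := \sum_(i < n) (x i ord0 * (x i ord0 * (k x * wgt eps x)) - partial_wgtM eps i k x).
have ES : (\int[G]_x (S x)%:E = 0)%E.
  rewrite /S; under eq_integral do rewrite -sumEFin.
  rewrite integral_sum//; last by move=> i; have [] := stein_wgt i e0 sk.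
  by rewrite big1// => i _; have [] := stein_wgt i e0 sk.
have iS : int S by apply: integrable_fun_sum => i; have [] := stein_wgt i e0 sk.
have SE x : x != 0 -> S x = enorm x ^+ 2 * wgt eps x * k x - n%:R * (k x * wgt eps x)
    + 2 * (enorm x ^+ 2 * wgt eps x) * (k x * wgt eps x).
  move=> x0; rewrite /S /partial_wgtM !big_split/= sumrN !big_split/= sumrN.
  under eq_bigr do rewrite mulrA -expr2.
  rewrite -mulr_suml -sqr_enorm sumr_const card_ord -[X in X + _ - _]mulr_natl -mulr_suml euler_rpartial//.
  rewrite -mulr_suml -mulr_suml -mulr_sumr sum_dir_sqr//; ring.
apply: (@le_trans _ _ (\int[G]_x (k x - S x))); last first.
  by rewrite RintegralB// [X in _ - X]/Rintegral ES subr0.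
rewrite -subr_ge0 -RintegralB//; [|exact: integrable_funB|exact: integrable_funZ].
rewrite fine_ge0//.
have mS : measurable_fun setT (fun x => (k x - S x - (n%:R - 2) * (k x * wgt eps x))%:E).
  by apply: (@measurable_int _ _ _ G); apply: integrable_funB; [exact: integrable_funB|exact: integrable_funZ].
(* The inequality is known off 0 only, so the integrand is replaced by its positive part, to which
   it is equal almost everywhere. *)
have -> : (\int[G]_x (k x - S x - (n%:R - 2) * (k x * wgt eps x))%:E =
  \int[G]_x (fun x => (k x - S x - (n%:R - 2) * (k x * wgt eps x))%:E)^\+ x)%E; last exact: integral_ge0.
apply: ae_eq_integral => //; first exact: measurable_funepos.
have := ae_neq0; apply: filterS => x x0 _; rewrite funeposE max_l// lee_fin SE//.
have [w0 we qw] := wgt_bound x e0; have := k0 x.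
have := mulr_ge0 (k0 x) (ltW w0).
move: (k x * wgt eps x) (enorm x ^+ 2 * wgt eps x) qw (sqr_ge0 (enorm x)) => kw q qw _ kw0 kx0.
nra.
Qed.

(** Monotone convergence with eps = [harmonic m] decreasing to 0. The condition at the origin gives
    convergence there too: [wgt] blows up, while [inorm] is 0. *)
Lemma inorm_sqr_le k : smooth0 k -> (forall x, 0 <= k x) -> k 0 = 0 -> (2 < n)%N ->
  (\int[G]_x (k x * inorm x ^+ 2)%:E <= ((n%:R - 2)^-1 * \int[G]_x k x)%:E)%E.
Proof.
move=> sk k0 k00 n2; have [mk _ _] := sk.
have h0 m : 0 < (harmonic m : R) by exact: harmonic_gt0.
have cvg x : (k x * wgt (harmonic m) x)%:E @[m --> \oo] --> (k x * inorm x ^+ 2)%:E.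
  have [->|x0] := eqVneq x 0.
    by rewrite k00 mul0r; under eq_fun do rewrite mul0r; exact: cvg_cst.
  apply: cvg_EFin; first exact: nearW.
  have cw : wgt (harmonic m) x @[m --> \oo] --> inorm x ^+ 2.
    rewrite /wgt /inorm exprVn; apply: cvgV; first by rewrite expf_eq0/= enorm_eq0.
    by rewrite -[X in _ --> X]addr0; apply: cvgD; [exact: cvg_cst|exact: cvg_harmonic].
  have h : k x * wgt (harmonic m) x @[m --> \oo] --> k x * inorm x ^+ 2.
    by apply: cvgMr; exact: cw.
  exact: h.
have -> : (\int[G]_x (k x * inorm x ^+ 2)%:E = \int[G]_x limn (fun m => (k x * wgt (harmonic m) x)%:E))%E.
  by apply: eq_integral => x _; apply/esym/cvg_lim => //; exact: cvg.
have cm : (\int[G]_x (k x * wgt (harmonic m) x)%:E)%E @[m --> \oo] -->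
    (\int[G]_x limn (fun m => (k x * wgt (harmonic m) x)%:E))%E.
  apply: (@cvg_monotone_convergence _ _ _ G setT measurableT (fun m x => (k x * wgt (harmonic m) x)%:E)).
  - by move=> m; apply/measurable_EFinP/measurable_funM => //; exact: measurable_wgt.
  - move=> m x _; have [w0 _ _] := wgt_bound x (h0 m).
    by rewrite lee_fin mulr_ge0// ltW.
  - move=> x _ m m' mm; rewrite lee_fin ler_wpM2l// /wgt.
    have hh : harmonic m' <= harmonic m :> R by rewrite /harmonic/= lef_pV2 ?posrE// ler_nat.
    have q0 := sqr_ge0 (enorm x); have := h0 m; have := h0 m' => a b.
    by rewrite lef_pV2 ?posrE; lra.
apply: (cvge_to_le cm).
apply: nearW => m; rewrite integral_EFin; first by rewrite lee_fin wgt_radial_le.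
have [C kC] := smooth0_bounded sk.
have C0 : 0 <= C by apply: le_trans (kC 0).
apply: (@bounded_integrable _ _ _ _ _ (C * (harmonic m)^-1)) => [|x].
  by apply: measurable_funM => //; exact: measurable_wgt.
by have [w0 we _] := wgt_bound x (h0 m); rewrite normrM ler_pM// gtr0_norm.
Qed.

Lemma sphere_poincare k : smooth0 k -> (2 < n)%N ->
  \int[G]_x (k x ^+ 2) - (\int[G]_x k x) ^+ 2 <=
  (n%:R - 2)^-1 * \sum_i \int[G]_x (rpartial i k x ^+ 2).
Proof.
move=> sk n2; have [mk _ _] := sk; have [C kC] := smooth0_bounded sk.
(* Off 0 this is [partial i k], in a form whose measurability on the whole space is at hand and
   whose square is ready for [inorm_sqr_le]. *)
pose g i x := inorm x * rpartial i k x.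
have mg i : measurable_fun setT (g i).
  have [mD _ _] := smooth0_rpartial i sk; apply: measurable_funM => //.
  exact: measurable_inorm.
have := @poincare_gaussian R n k g C n1 mk kC.
have sD2 i : smooth0 (fun x => rpartial i k x ^+ 2).
  by have := smooth0M (smooth0_rpartial i sk) (smooth0_rpartial i sk).
rewrite (integral_sqr_sub _ _ mk kC) => H.
have : ((\int[G]_x (k x ^+ 2) - 2 * (\int[G]_y k y) * (\int[G]_x k x) + (\int[G]_y k y) ^+ 2)%:E <=
   \sum_(i < n) ((n%:R - 2)^-1 * \int[G]_x (rpartial i k x ^+ 2))%:E)%E.
  apply: (le_trans (H _ mg _ _)).
  - by move=> x; exact: smooth0_diff.
  - by move=> i x x0; rewrite /g /rpartial /inorm mulrA mulVf ?mul1r// enorm_eq0.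
  - move=> i x x0; have [_ _ cD] := smooth0_rpartial i sk.
    exact: (CmM (Cm_inorm 0) (cD 0%N)).
  apply: lee_sum => i _; apply: le_trans (inorm_sqr_le (sD2 i) _ _ n2).
  - by under eq_integral do rewrite /g exprMn mulrC.
  - by move=> x; exact: sqr_ge0.
  - by rewrite /rpartial enorm0 mul0r expr0n.
rewrite sumEFin lee_fin -mulr_sumr; apply: le_trans.
by rewrite le_eqVlt; apply/orP; left; apply/eqP; ring.
Qed.

End gaussian_sphere.

(** * Convergence in L1 and L2 *)

Section convergence.
Context d (T : measurableType d) (R : realType) (P : probability T R).
Notation int f := (P.-integrable setT (EFin \o f)).
Notation E f := (\int[P]_x f x).
Implicit Types f g v w a : T -> R.

Lemma integrable_fun_norm f : int f -> int (fun x => `|f x|).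
Proof. by move=> fi; exact: (integrable_norm fi). Qed.

Lemma integrable_fun_measurable f : int f -> measurable_fun setT f.
Proof. by move=> fi; apply/measurable_EFinP; exact: (measurable_int P fi). Qed.

Lemma le_RintegralT f g : int f -> int g -> (forall x, f x <= g x) -> E f <= E g.
Proof. by move=> fi gi fg; apply: le_Rintegral. Qed.

Lemma le_normr_RintegralT f : int f -> `|E f| <= E (fun x => `|f x|).
Proof. by move=> fi; exact: le_normr_Rintegral. Qed.

Lemma integrable_mul_sqr f g : measurable_fun setT f -> measurable_fun setT g ->
  int (fun x => f x ^+ 2) -> int (fun x => g x ^+ 2) -> int (fun x => f x * g x).
Proof.
move=> mf mg f2 g2; apply: (dominated_integrable (g := fun x => f x ^+ 2 + g x ^+ 2)).
- exact: measurable_funM.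
- move=> x; rewrite normrM -(real_normK (num_real (f x))) -(real_normK (num_real (g x))).
  have := sqr_ge0 (`|f x| - `|g x|); have := mulr_ge0 (normr_ge0 (f x)) (normr_ge0 (g x)); nra.
- exact: integrable_funD.
Qed.

Lemma integrable_mul_bounded f a (A : R) : int f -> measurable_fun setT a ->
  (forall x, `|a x| <= A) -> int (fun x => a x * f x).
Proof.
move=> fi ma aA; apply: (dominated_integrable (g := fun x => A * `|f x|)).
- by apply: measurable_funM => //; exact: integrable_fun_measurable.
- by move=> x; rewrite normrM ler_wpM2r.
- by apply: integrable_funZ; exact: integrable_fun_norm.
Qed.

Lemma squeeze0 (a b : nat -> R) : (forall m, `|a m| <= b m) -> b @ \oo --> 0 -> a @ \oo --> 0.
Proof.
move=> ab b0; apply: (@squeeze_cvgr _ _ _ _ (fun m => - b m) b) => //.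
  by apply: nearW => m; rewrite -ler_norml.
by rewrite -[X in _ --> X]oppr0; apply: (@cvgN _ R^o).
Qed.

Lemma cvgZ0 (c : R) (b : nat -> R) : b @ \oo --> 0 -> (fun m => c * b m) @ \oo --> 0.
Proof. by move=> b0; rewrite -[X in _ --> X](mulr0 c); apply: cvgMr. Qed.

Lemma cvg_sub0 (a : nat -> R) (l : R) : (fun m => a m - l) @ \oo --> 0 -> a @ \oo --> l.
Proof.
move=> h; rewrite -[X in _ --> X]add0r.
have -> : a = (fun m => (a m - l) + l) by apply/funext => m; rewrite subrK.
by apply: (@cvgD _ R^o) => //; exact: cvg_cst.
Qed.

Definition L1cvg (u : nat -> T -> R) v := [/\ forall m, int (u m), int v &
  (fun m => E (fun x => `|u m x - v x|)) @ \oo --> 0].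

Definition L2 v := measurable_fun setT v /\ int (fun x => v x ^+ 2).

Definition L2cvg (u : nat -> T -> R) v :=
  [/\ forall m, L2 (u m), L2 v & (fun m => E (fun x => (u m x - v x) ^+ 2)) @ \oo --> 0].

Lemma L1cvg_E u v a (A : R) : L1cvg u v -> measurable_fun setT a ->
  (forall x, `|a x| <= A) -> (fun m => E (fun x => a x * u m x)) @ \oo --> E (fun x => a x * v x).
Proof.
move=> [iu iv c0] ma aA; apply: cvg_sub0; apply: squeeze0 (cvgZ0 A c0) => m.
have i1 := integrable_mul_bounded (iu m) ma aA; have i2 := integrable_mul_bounded iv ma aA.
have id := integrable_fun_norm (integrable_funB (iu m) iv).
rewrite -RintegralB// (le_trans (le_normr_RintegralT (integrable_funB i1 i2)))//.
rewrite -RintegralZl//; apply: le_RintegralT => [||x].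
- exact: integrable_fun_norm (integrable_funB i1 i2).
- exact: integrable_funZ.
- by rewrite -mulrBr normrM ler_wpM2r.
Qed.

Lemma L2_mul f g : L2 f -> L2 g -> int (fun x => f x * g x).
Proof. by move=> [mf f2] [mg g2]; exact: integrable_mul_sqr. Qed.

Lemma L2_bounded f (A : R) : measurable_fun setT f -> (forall x, `|f x| <= A) -> L2 f.
Proof.
move=> mf fA; split => //; apply: (@bounded_integrable _ _ _ _ _ (A ^+ 2)).
  exact: measurable_funX.
by move=> x; rewrite normrX lerXn2r// ?nnegrE// (le_trans _ (fA x)).
Qed.

Lemma L2_int f : L2 f -> int f.
Proof.
move=> f2; have h := L2_mul (L2_bounded (A := 1) (measurable_cst (1 : R)) _) f2.
have : int (fun x => cst 1 x * f x) by apply: h => x; rewrite normr1.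
by under [X in EFin \o X]eq_fun do rewrite /= mul1r.
Qed.

Lemma L2D f g : L2 f -> L2 g -> L2 (fun x => f x + g x).
Proof.
move=> f2 g2; have [mf if2] := f2; have [mg ig2] := g2; split; first exact: measurable_funD.
have := integrable_funD (integrable_funD if2 ig2) (integrable_funZ 2 (L2_mul f2 g2)).
by apply: eq_integrable => // x _; rewrite /=; congr (_%:E); ring.
Qed.

Lemma L2M a f (A : R) : L2 f -> measurable_fun setT a -> (forall x, `|a x| <= A) ->
  L2 (fun x => a x * f x).
Proof.
move=> [mf f2] ma aA; split; first exact: measurable_funM.
under [X in EFin \o X]eq_fun do rewrite exprMn.
apply: (@integrable_mul_bounded _ _ (A ^+ 2)) => //; first exact: measurable_funX.
by move=> x; rewrite normrX lerXn2r// ?nnegrE// (le_trans _ (aA x)).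
Qed.

Lemma L2Z (c : R) f : L2 f -> L2 (fun x => c * f x).
Proof. by move=> f2; apply: (@L2M (cst c) f `|c|) => //. Qed.

Lemma L2B f g : L2 f -> L2 g -> L2 (fun x => f x - g x).
Proof.
move=> f2 g2; have := L2D f2 (L2Z (-1) g2).
by under eq_fun do rewrite mulN1r.
Qed.

Lemma L2_sum (I : Type) (s : seq I) (F : I -> T -> R) : (forall i, L2 (F i)) ->
  L2 (fun x => \sum_(i <- s) F i x).
Proof.
move=> iF; elim: s => [|a s IH].
  by under eq_fun do rewrite big_nil; apply: (@L2_bounded _ 0) => // x; rewrite normr0.
by under eq_fun do rewrite big_cons; exact: L2D.
Qed.

Lemma L2cvgM u v a (A : R) : L2cvg u v -> measurable_fun setT a -> (forall x, `|a x| <= A) ->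
  L2cvg (fun m x => a x * u m x) (fun x => a x * v x).
Proof.
move=> [u2 v2 c0] ma aA; split; [by move=> m; exact: L2M (u2 m) ma aA|exact: L2M v2 ma aA|].
apply: squeeze0 (cvgZ0 (A ^+ 2) c0) => m.
have [_ d2] := L2B (u2 m) v2; have [_ ad2] := L2M (L2B (u2 m) v2) ma aA.
have E1 : (fun x => (a x * u m x - a x * v x) ^+ 2) = (fun x => (a x * (u m x - v x)) ^+ 2).
  by apply/funext => x; rewrite mulrBr.
rewrite E1 ger0_norm; last by apply: Rintegral_ge0 => x _; exact: sqr_ge0.
rewrite -RintegralZl//; apply: le_RintegralT => // [|x]; first exact: integrable_funZ.
rewrite exprMn ler_wpM2r ?sqr_ge0// -(real_normK (num_real (a x))) lerXn2r ?nnegrE//.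
by rewrite (le_trans _ (aA x)).
Qed.

Lemma L2cvgD u v u' v' : L2cvg u v -> L2cvg u' v' ->
  L2cvg (fun m x => u m x + u' m x) (fun x => v x + v' x).
Proof.
move=> [u2 v2 c0] [u2' v2' c0']; split; [by move=> m; exact: L2D|exact: L2D|].
have cs : (fun m => 2 * E (fun x => (u m x - v x) ^+ 2) + 2 * E (fun x => (u' m x - v' x) ^+ 2)) @ \oo --> 0.
  by rewrite -[X in _ --> X]addr0; apply: (@cvgD _ R^o); exact: cvgZ0.
apply: squeeze0 cs => m.
have [_ d2] := L2B (u2 m) v2; have [_ d2'] := L2B (u2' m) v2'.
have [_ dd] := L2D (L2B (u2 m) v2) (L2B (u2' m) v2').
have E1 : (fun x => (u m x + u' m x - (v x + v' x)) ^+ 2) = (fun x => (u m x - v x + (u' m x - v' x)) ^+ 2).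
  by apply/funext => x; congr (_ ^+ 2); ring.
rewrite E1 ger0_norm; last by apply: Rintegral_ge0 => x _; exact: sqr_ge0.
have i1 := integrable_funZ 2 d2; have i2 := integrable_funZ 2 d2'.
rewrite -!RintegralZl// -RintegralD//; apply: le_RintegralT => // [|x]; first exact: integrable_funD.
have := sqr_ge0 (u m x - v x - (u' m x - v' x)); nra.
Qed.

Lemma L2cvgZ (c : R) u v : L2cvg u v -> L2cvg (fun m x => c * u m x) (fun x => c * v x).
Proof. by move=> cuv; apply: (@L2cvgM _ _ (cst c) `|c|). Qed.

Lemma L2cvgB u v u' v' : L2cvg u v -> L2cvg u' v' ->
  L2cvg (fun m x => u m x - u' m x) (fun x => v x - v' x).
Proof.
move=> c1 c2; have := L2cvgD c1 (L2cvgZ (-1) c2).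
have -> : (fun x => v x + -1 * v' x) = (fun x => v x - v' x) by apply/funext => x; rewrite mulN1r.
have -> // : (fun m x => u m x + -1 * u' m x) = (fun m x => u m x - u' m x).
by apply/funext => m; apply/funext => x; rewrite mulN1r.
Qed.

(** Young's inequality with a free parameter dl bounds |u^2 - v^2| by (1 + 1 / dl) (u - v)^2 + dl
    v^2: the last term is made small first, then m is taken large. *)
Lemma L2cvg_sqr u v : L2cvg u v -> (fun m => E (fun x => u m x ^+ 2)) @ \oo --> E (fun x => v x ^+ 2).
Proof.
move=> [u2 v2 c0]; set V := E (fun x => v x ^+ 2).
have V0 : 0 <= V by apply: Rintegral_ge0 => x _; exact: sqr_ge0.
have [mv iv] := v2.
have bd m (dl : R) : 0 < dl -> `|E (fun x => u m x ^+ 2) - V| <=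
    (1 + dl^-1) * E (fun x => (u m x - v x) ^+ 2) + dl * V.
  move=> dl0; have [mu iu] := u2 m; have [_ id] := L2B (u2 m) v2.
  have i1 := integrable_funZ (1 + dl^-1) id; have i2 := integrable_funZ dl iv.
  rewrite /V -RintegralB// (le_trans (le_normr_RintegralT (integrable_funB iu iv)))//.
  rewrite -!RintegralZl// -RintegralD//; apply: le_RintegralT => [||x].
  - exact: integrable_fun_norm (integrable_funB iu iv).
  - exact: integrable_funD.
  have -> : u m x ^+ 2 - v x ^+ 2 = (u m x - v x) ^+ 2 + 2 * v x * (u m x - v x) by ring.
  set a := u m x - v x; set b := v x.
  have h : 2 * `|b| * `|a| <= dl * b ^+ 2 + dl^-1 * a ^+ 2.
    rewrite -subr_ge0 -(real_normK (num_real a)) -(real_normK (num_real b)).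
    have -> : dl * `|b| ^+ 2 + dl^-1 * `|a| ^+ 2 - 2 * `|b| * `|a| = dl^-1 * (dl * `|b| - `|a|) ^+ 2.
      by field; rewrite gt_eqF.
    by rewrite mulr_ge0 ?sqr_ge0// invr_ge0 ltW.
  apply: (le_trans (ler_normD _ _)); rewrite (ger0_norm (sqr_ge0 a)) !normrM normr_nat; lra.
apply/cvgrPdist_lt => eta eta0.
(* This choice gives dl V <= eta / 2, and V + 1 keeps the denominator positive when V = 0. *)
pose dl := eta / (2 * (V + 1)).
have V1 : 0 < V + 1 by lra.
have dl0 : 0 < dl by rewrite divr_gt0// mulr_gt0.
have c1 := cvgZ0 (1 + dl^-1) c0.
have : \forall m \near \oo, `|0 - (1 + dl^-1) * E (fun x => (u m x - v x) ^+ 2)| < eta / 2.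
  by move/cvgrPdist_lt : c1; apply; rewrite divr_gt0.
apply: filterS => m; rewrite sub0r normrN => /(le_lt_trans (ler_norm _)) h.
rewrite distrC (le_lt_trans (bd m dl dl0))//.
have : dl * V <= eta / 2.
  apply: (@le_trans _ _ (dl * (V + 1))); first by rewrite ler_wpM2l ?ltW//; lra.
  by rewrite le_eqVlt; apply/orP; left; apply/eqP; rewrite /dl; field; rewrite gt_eqF.
lra.
Qed.

(** Polarization reduces products to the squares of sums and differences. *)
Lemma L2cvg_mul u v u' v' : L2cvg u v -> L2cvg u' v' ->
  (fun m => E (fun x => u m x * u' m x)) @ \oo --> E (fun x => v x * v' x).
Proof.
move=> c1 c2; have s1 := L2cvg_sqr (L2cvgD c1 c2); have s2 := L2cvg_sqr (L2cvgB c1 c2).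
have pol f g : L2 f -> L2 g -> E (fun x => f x * g x) =
    4^-1 * (E (fun x => (f x + g x) ^+ 2) - E (fun x => (f x - g x) ^+ 2)).
  move=> f2 g2; have [_ i1] := L2D f2 g2; have [_ i2] := L2B f2 g2.
  rewrite -RintegralB// -RintegralZl//; last exact: integrable_funB.
  by apply: eq_Rintegral => x _; field.
have [u2 v2 _] := c1; have [u2' v2' _] := c2.
rewrite pol//; under eq_fun do rewrite pol//.
by apply: cvgMr; apply: (@cvgB _ R^o).
Qed.

Lemma L2cvg_cst v : L2 v -> L2cvg (fun=> v) v.
Proof.
move=> v2; split => //.
have -> : (fun m : nat => E (fun x => (v x - v x) ^+ 2)) = cst 0.
  apply/funext => m /=; under eq_Rintegral do rewrite subrr expr0n/=.
  by rewrite Rintegral_prob_cst.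
exact: cvg_cst.
Qed.

Lemma L2cvg_E u v : L2cvg u v -> (fun m => E (u m)) @ \oo --> E v.
Proof.
move=> c; have one2 : L2 (fun=> 1) by apply: (@L2_bounded _ 1) => // x; rewrite normr1.
have := L2cvg_mul (L2cvg_cst one2) c.
have e f : E (fun x => 1 * f x) = E f by apply: eq_Rintegral => x _; rewrite mul1r.
by rewrite e; under eq_fun do rewrite e.
Qed.

End convergence.

Lemma cvge0_lt1 (R : realType) (a : nat -> \bar R) : a @ \oo --> 0%E ->
  \forall m \near \oo, (a m < 1)%E.
Proof.
move=> /fine_cvgP[af /cvgrPdist_lt/(_ _ ltr01)]; apply: filterS2 af => m af.
rewrite sub0r normrN => /(le_lt_trans (ler_norm _)) h.
by rewrite -(fineK af) lte_fin.
Qed.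

Section limits_of_bounded_functions.
Context d (T : measurableType d) (R : realType) (P : probability T R).
Variables (u : nat -> T -> R) (v : T -> R).
Hypotheses (mu : forall m, measurable_fun setT (u m)) (bu : forall m, exists C, forall x, `|u m x| <= C)
  (mv : measurable_fun setT v).

(** The limit v is only assumed measurable; its integrability follows from one index at which the
    distance from a bounded function is below 1. The L2 version below argues alike. *)
Lemma L1cvg_bounded : (\int[P]_x (`|u m x - v x|)%:E)%E @[m --> \oo] --> 0%E -> L1cvg P u v.
Proof.
move=> c0; have iu m : P.-integrable setT (EFin \o u m).
  by have [C uC] := bu m; exact: bounded_integrable (mu m) uC.
have [m0 Hm] : exists m, (\int[P]_x (`|u m x - v x|)%:E < 1%:E)%E.
  by have /filter_ex := cvge0_lt1 c0.
have iv : P.-integrable setT (EFin \o v).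
  have id : P.-integrable setT (EFin \o (fun x => u m0 x - v x)).
    apply/integrableP; split; first by apply/measurable_EFinP/measurable_funB.
    by apply: le_lt_trans (ltry 1); apply/ltW.
  apply: eq_integrable (integrable_funB (iu m0) id) => // x _ /=.
  by rewrite opprB addrC subrK.
by have c1 := fine_cvg c0; split => //; exact: c1.
Qed.

Lemma L2cvg_bounded : (\int[P]_x ((u m x - v x) ^+ 2)%:E)%E @[m --> \oo] --> 0%E -> L2cvg P u v.
Proof.
move=> c0; have iu m : L2 P (u m) by have [C uC] := bu m; exact: L2_bounded (mu m) uC.
have [m0 Hm] : exists m, (\int[P]_x ((u m x - v x) ^+ 2)%:E < 1%:E)%E.
  by have /filter_ex := cvge0_lt1 c0.
have iv : L2 P v.
  have id : L2 P (fun x => u m0 x - v x).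
    split; first exact: measurable_funB.
    apply/integrableP; split; first by apply/measurable_EFinP/measurable_funX/measurable_funB.
    under eq_integral do rewrite /= ger0_norm ?sqr_ge0//.
    by apply: le_lt_trans (ltry 1); apply/ltW.
  have := L2B (iu m0) id; congr (L2 P _); apply/funext => x.
  by rewrite opprB addrC subrK.
by have c1 := fine_cvg c0; split => //; exact: c1.
Qed.

End limits_of_bounded_functions.

(** * Passage to Sobolev functions *)

Section sobolev_gaussian.
Context {R : realType} {n : nat} (r : R).
Notation V := 'cV[R]_n.
Notation G := (gaussian R n).
Notation Tm := (@to_sphere R n r).
Implicit Types (h k : V -> R) (x y : V).
Hypotheses (n1 : (1 < n)%N) (r0 : 0 < r).

Lemma to_sphere_coord i x : Tm x i ord0 = r * dir i x.
Proof. by rewrite mxE /dir /inorm; ring. Qed.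

Lemma to_sphereZ (c : R) x : 0 < c -> Tm (c *: x) = Tm x.
Proof.
move=> c0; apply/colP => i; rewrite !mxE enormZ gtr0_norm//.
by rewrite invfM; move: (enorm x)^-1 => y; field; rewrite gt_eqF.
Qed.

Lemma enorm_to_sphere x : x != 0 -> enorm (Tm x) = r.
Proof.
move=> x0; have e0 := enorm_gt0 x; rewrite x0 in e0.
by rewrite enormZ gtr0_norm ?divr_gt0// divfK// gt_eqF.
Qed.

Lemma smooth0_sphere_ext h : sphere_smooth r h -> smooth0 (sphere_ext r h).
Proof.
move=> [mh dh]; split.
- by apply: measurableT_comp => //; exact: measurable_to_sphere.
- by move=> c x c0 x0; rewrite /sphere_ext /= to_sphereZ.
- exact: Cm_foldr.
Qed.

Lemma sphere_grad_to_sphere h i x : sphere_smooth r h -> x != 0 ->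
  sphere_grad r h (Tm x) i ord0 = r^-1 * rpartial i (sphere_ext r h) x.
Proof.
move=> sh x0; have sk := smooth0_sphere_ext sh; have [_ hk _] := sk.
have e0 := enorm_gt0 x; rewrite x0 in e0.
rewrite mxE /to_sphere partial_hom0 ?divr_gt0// => [|y]; last exact: smooth0_diff.
by rewrite invf_div /rpartial; ring.
Qed.

(* r times the tangential part of g at the projection of x to the sphere; for the
   gradient of h this is [rpartial i] of its extension, see [rpartial_tangent]. *)
Definition tangent (g : V -> V) i x := r * \sum_j ((i == j)%:R - dir i x * dir j x) * g (Tm x) j ord0.

(** By Euler's relation the gradient of a function constant on rays has no radial part, so the
    projection in [tangent] leaves it unchanged. In this form the identity can pass to the limit
    gradients. *)
Lemma rpartial_tangent h i x : sphere_smooth r h -> x != 0 ->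
  rpartial i (sphere_ext r h) x = tangent (sphere_grad r h) i x.
Proof.
move=> sh x0; have sk := smooth0_sphere_ext sh.
rewrite /tangent; under eq_bigr do rewrite sphere_grad_to_sphere// mulrCA.
rewrite -mulr_sumr mulrA divff ?gt_eqF// mul1r.
under eq_bigr do rewrite mulrBl.
rewrite sumrB; under [X in _ - X]eq_bigr do rewrite -mulrA.
rewrite -mulr_sumr euler_rpartial// mulr0 subr0 (bigD1 i)//= eqxx mul1r big1 ?addr0// => j ji.
by rewrite eq_sym (negbTE ji) mul0r.
Qed.

Lemma normr_dir_le1 i x : `|dir i x| <= 1.
Proof.
have [->|x0] := eqVneq x 0; first by rewrite /dir mxE mul0r normr0.
have e0 := enorm_gt0 x; rewrite x0 in e0.
by rewrite /dir normrM /inorm normfV (gtr0_norm e0) ler_pdivrMr// mul1r enorm_coord.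
Qed.

(** A coarse Lipschitz bound, used only for limits: each of the n coefficients of the projection is
    at most 2 in absolute value. *)
Lemma tangentB_le (g g' : V -> V) i x :
  `|tangent g i x - tangent g' i x| <= r * (n%:R * 2) * enorm (g (Tm x) - g' (Tm x)).
Proof.
rewrite /tangent -mulrBr -sumrB normrM gtr0_norm// -mulrA ler_wpM2l//; first exact: ltW.
apply: (le_trans (ler_norm_sum _ _ _)).
apply: (@le_trans _ _ (\sum_(j < n) 2 * enorm (g (Tm x) - g' (Tm x)))); last first.
  by rewrite sumr_const card_ord -[leLHS]mulr_natl mulrA.
apply: ler_sum => j _; rewrite -mulrBr normrM ler_pM//; last first.
  by have := enorm_coord j (g (Tm x) - g' (Tm x)); rewrite !mxE.
apply: (le_trans (ler_normB _ _)); apply: lerD; first by case: eqP; rewrite ?normr1 ?normr0.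
by rewrite normrM mulr_ile1// normr_dir_le1.
Qed.

Lemma measurable_tangent g i : measurable_fun setT g -> measurable_fun setT (tangent g i).
Proof.
move=> mg; apply: measurable_funM => //; apply: measurable_sum => j.
have [mi _ _] := smooth0_dir (R := R) i; have [mj _ _] := smooth0_dir (R := R) j.
apply: measurable_funM; first by apply: measurable_funB => //; exact: measurable_funM.
apply: (measurableT_comp (@measurable_coor R n j)).
apply: measurableT_comp mg _; exact: measurable_to_sphere.
Qed.

Lemma measurable_sphere_grad h : sphere_smooth r h -> measurable_fun setT (sphere_grad r h).
Proof.
move=> sh; have sk := smooth0_sphere_ext sh; apply: measurable_fun_cV => i.
have [mD _ _] := smooth0_rpartial i sk.
(* The value at the origin carries no information, so it is split off as a constant; elsewhere the
   gradient is a product of measurable functions. *)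
have -> : (fun x => sphere_grad r h x i ord0) = (fun x => if enorm x == 0 then
    partial i (sphere_ext r h) 0 else inorm x * rpartial i (sphere_ext r h) x).
  apply/funext => x; rewrite mxE enorm_eq0; case: eqP => [->//|/eqP x0].
  by rewrite /rpartial /inorm mulrA mulVf ?mul1r// enorm_eq0.
apply: measurable_fun_ifT => //.
- by apply: measurable_fun_eqr => //; exact: measurable_enorm.
- apply: measurable_funM => //.
  exact: measurable_inorm.
Qed.

Lemma poweR_le (a : \bar R) (alpha : R) : (0 <= a <= 1)%E -> 1 <= alpha -> (a `^ alpha <= a)%E.
Proof.
case: a => [a| |]; rewrite ?leye_eq ?andbF//.
rewrite !lee_fin => /andP[a0 a1] al.
have [->|an0] := eqVneq a 0; first by rewrite powR0// gt_eqF// (lt_le_trans ltr01).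
rewrite -[leRHS]powRr1//; apply: ger_powR => //.
by rewrite a1 andbT lt_neqAle eq_sym an0.
Qed.

Lemma Lnorm_cvg0 (alpha : R) (w : nat -> V -> R) : 1 <= alpha ->
  (forall m, measurable_fun setT (w m)) ->
  (forall m x, 0 <= w m x) ->
  (Lnorm_fun r alpha (w m) @[m --> \oo] --> 0)%E ->
  (\int[G]_x (w m (Tm x) `^ alpha)%:E)%E @[m --> \oo] --> 0%E.
Proof.
move=> al mw w0 c0; have an0 : alpha != 0 by rewrite gt_eqF// (lt_le_trans ltr01).
have E1 m : (\int[G]_x (w m (Tm x) `^ alpha)%:E = Lnorm_fun r alpha (w m) `^ alpha)%E.
  rewrite /Lnorm_fun powR_Lnorm// [RHS]ge0_integral_distribution.
  - by apply: eq_integral => x _; rewrite /= ger0_norm// poweR_EFin.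
  - apply: (@measurableT_comp _ _ _ _ _ _ (fun a : \bar R => (a `^ alpha)%E)).
      exact: measurable_poweR.
    by apply: measurableT_comp => //; exact/measurable_EFinP.
  - by move=> y; exact: poweR_ge0.
under eq_fun do rewrite E1.
(* Once the norm is below 1, its power with exponent alpha >= 1 is at most the norm itself. *)
apply: (squeeze_cvge _ (cvg_cst 0%E) c0).
have := cvge0_lt1 c0.
apply: filterS => m Hm; rewrite poweR_ge0/=; apply: poweR_le => //.
by rewrite Lnorm_ge0 ltW.
Qed.

(** Turns the completion data into Gaussian integrals of functions constant on rays. Convergence of
    the full gradients gives that of each [rpartial i] through [rpartial_tangent] and
    [tangentB_le]. *)
Lemma sobolev_approx (alpha : R) (f : sobolev n r alpha) : 1 <= alpha ->
  exists k : nat -> V -> R, [/\ forall m, smooth0 (k m),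
    (\int[G]_x (`|k m x - f (Tm x)| `^ alpha)%:E)%E @[m --> \oo] --> 0%E &
    forall i, (\int[G]_x (`|rpartial i (k m) x - tangent (sobolev_grad f) i x| `^ alpha)%:E)%E
      @[m --> \oo] --> 0%E].
Proof.
move=> al; have [h [sh _ cf cg]] := sobolev_completion f.
have mf := measurable_sobolev_fun f; have mg := measurable_sobolev_grad f.
have al0 : 0 <= alpha by rewrite (le_trans ler01).
exists (fun m => sphere_ext r (h m)); split; first by move=> m; exact: smooth0_sphere_ext.
  apply: (@Lnorm_cvg0 alpha (fun m x => `|h m x - f x|)) => //.
    by move=> m; apply: measurableT_comp => //; have [mh _] := sh m; exact: measurable_funB.
  have -> // : (fun m => Lnorm_fun r alpha (fun x => `|h m x - f x|)) = (fun m => Lnorm_fun r alpha (h m \- f)).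
  by apply/funext => m; rewrite /Lnorm_fun -[RHS]Lnorm_abse.
move=> i.
have mw m : measurable_fun setT (fun x => enorm (sphere_grad r (h m) x - sobolev_grad f x)).
  apply: measurableT_comp; first exact: measurable_enorm.
  apply: measurable_fun_cV => j; under eq_fun do rewrite mxE [X in _ + X]mxE.
  apply: measurable_funB; apply: (measurableT_comp (@measurable_coor R n j)) => //.
  exact: measurable_sphere_grad.
have c1 := @Lnorm_cvg0 alpha (fun m x => enorm (sphere_grad r (h m) x - sobolev_grad f x)) al mw
  (fun m x => enorm_ge0 _) cg.
pose C := r * (n%:R * 2).
have C0 : 0 <= C by rewrite mulr_ge0// ?ltW// mulr_ge0.
have c2 : ((C `^ alpha)%:E * \int[G]_x (enorm (sphere_grad r (h m) (Tm x) - sobolev_grad f (Tm x)) `^ alpha)%:E)%E @[m --> \oo] --> 0%E.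
  by rewrite -[X in _ --> X](mule0 (C `^ alpha)%:E); exact: cvgeZl.
apply: (squeeze_cvge _ (cvg_cst 0%E) c2); apply: nearW => m.
have [mD _ _] := smooth0_rpartial i (smooth0_sphere_ext (sh m)).
have mwT : measurable_fun setT (fun x => (enorm (sphere_grad r (h m) (Tm x) - sobolev_grad f (Tm x)) `^ alpha)%:E).
  apply/measurable_EFinP; apply: (measurableT_comp (measurable_powR alpha)).
  by apply: (measurableT_comp (mw m)); exact: measurable_to_sphere.
rewrite integral_ge0 => [/=|x _]; last by rewrite lee_fin powR_ge0.
rewrite -ge0_integralZl_EFin// ?powR_ge0//; last by move=> x _; rewrite lee_fin powR_ge0.
apply: ae_ge0_le_integral => //.
- apply/measurable_EFinP; apply: (measurableT_comp (measurable_powR alpha)).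
  apply: measurableT_comp => //; apply: measurable_funB => //; exact: measurable_tangent.
- by move=> x _; rewrite mule_ge0 ?lee_fin ?powR_ge0.
- exact: measurable_funeM.
have := ae_neq0 (R := R) n1; apply: filterS => x x0 _.
rewrite -EFinM lee_fin -powRM ?enorm_ge0//; apply: ge0_ler_powR => //.
- by rewrite nnegrE mulr_ge0 ?enorm_ge0.
- by rewrite (rpartial_tangent _ (sh m) x0); exact: tangentB_le.
Qed.

Lemma smooth0_L1cvg (k : nat -> V -> R) (v : V -> R) : (forall m, smooth0 (k m)) -> measurable_fun setT v ->
  (\int[G]_x (`|k m x - v x| `^ 1)%:E)%E @[m --> \oo] --> 0%E -> L1cvg G k v.
Proof.
move=> sk mv c0; apply: L1cvg_bounded => //.
- by move=> m; have [] := sk m.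
- by move=> m; exact: smooth0_bounded.
- have E1 : (fun m => (\int[G]_x (`|k m x - v x| `^ 1)%:E)%E) = (fun m => (\int[G]_x (`|k m x - v x|)%:E)%E).
    by apply/funext => m; apply: eq_integral => x _; rewrite powRr1.
  by rewrite -E1.
Qed.

Lemma smooth0_L2cvg (k : nat -> V -> R) (v : V -> R) : (forall m, smooth0 (k m)) -> measurable_fun setT v ->
  (\int[G]_x (`|k m x - v x| `^ 2)%:E)%E @[m --> \oo] --> 0%E -> L2cvg G k v.
Proof.
move=> sk mv c0; apply: L2cvg_bounded => //.
- by move=> m; have [] := sk m.
- by move=> m; exact: smooth0_bounded.
- have E1 : (fun m => (\int[G]_x (`|k m x - v x| `^ 2)%:E)%E) = (fun m => (\int[G]_x ((k m x - v x) ^+ 2)%:E)%E).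
    by apply/funext => m; apply: eq_integral => x _; rewrite powR_mulrn// real_normK ?num_real.
  by rewrite -E1.
Qed.

Lemma measurable_sobolev_to_sphere alpha (f : sobolev n r alpha) : measurable_fun setT (fun x => f (Tm x)).
Proof. by apply: (measurableT_comp (measurable_sobolev_fun f)); exact: measurable_to_sphere. Qed.

Lemma sobolev_L1cvg (f : sobolev n r 1) : exists k : nat -> V -> R, [/\ forall m, smooth0 (k m),
  L1cvg G k (fun x => f (Tm x)) & forall i, L1cvg G (fun m => rpartial i (k m)) (tangent (sobolev_grad f) i)].
Proof.
have [k [sk cf cD]] := sobolev_approx f (lexx 1); exists k; split => //.
- by apply: smooth0_L1cvg => //; exact: measurable_sobolev_to_sphere.
- move=> i; exact: (smooth0_L1cvg (fun m => smooth0_rpartial i (sk m))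
    (measurable_tangent i (measurable_sobolev_grad f)) (cD i)).
Qed.

Lemma sobolev_L2cvg (f : sobolev n r 2) : exists k : nat -> V -> R, [/\ forall m, smooth0 (k m),
  L2cvg G k (fun x => f (Tm x)) & forall i, L2cvg G (fun m => rpartial i (k m)) (tangent (sobolev_grad f) i)].
Proof.
have [k [sk cf cD]] := sobolev_approx f (ler1n R 2); exists k; split => //.
- by apply: smooth0_L2cvg => //; exact: measurable_sobolev_to_sphere.
- move=> i; exact: (smooth0_L2cvg (fun m => smooth0_rpartial i (sk m))
    (measurable_tangent i (measurable_sobolev_grad f)) (cD i)).
Qed.

End sobolev_gaussian.

Lemma cvg_sumr (R : realType) (I : Type) (s : seq I) (a : I -> nat -> R) (l : I -> R) :
  (forall i, a i @ \oo --> l i) -> \sum_(i <- s) a i m @[m --> \oo] --> \sum_(i <- s) l i.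
Proof.
move=> al; elim: s => [|i s IH].
  by rewrite big_nil; under eq_fun do rewrite big_nil; exact: cvg_cst.
by rewrite big_cons; under eq_fun do rewrite big_cons; apply: (@cvgD _ R^o).
Qed.

Section sobolev_identities.
Context {R : realType} {n : nat} (r : R).
Notation V := 'cV[R]_n.
Notation G := (gaussian R n).
Notation Tm := (@to_sphere R n r).
Hypotheses (n1 : (1 < n)%N) (r0 : 0 < r).
Notation Q f := (tangent r (sobolev_grad f)).

Lemma sobolev_stein (f : sobolev n r 1) i :
  \int[G]_x Q f i x = (n%:R - 1) * \int[G]_x (dir i x * f (Tm x)).
Proof.
have [k [sk ck cD]] := sobolev_L1cvg n1 r0 f.
have [mp _ _] := smooth0_dir (R := R) i.
have c1 := @L1cvg_E _ _ _ _ _ _ (fun=> 1) 1 (cD i) (measurable_cst _) (fun x => _).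
have c2 := @L1cvg_E _ _ _ _ _ _ (dir i) 1 ck mp (normr_dir_le1 i).
have e1 (h : V -> R) : \int[G]_x (1 * h x) = \int[G]_x h x.
  by apply: eq_Rintegral => x _; rewrite mul1r.
have {}c1 : \int[G]_x rpartial i (k m) x @[m --> \oo] --> \int[G]_x Q f i x.
  rewrite -e1; under eq_fun do rewrite -e1; apply: c1 => x; by rewrite normr1.
apply: (cvg_unique (@Rhausdorff R) c1).
have -> : (fun m => \int[G]_x rpartial i (k m) x) = (fun m => (n%:R - 1) * \int[G]_x (dir i x * k m x)).
  by apply/funext => m; exact: Rintegral_rpartial.
exact: cvgMr.
Qed.

Lemma sobolev_L2 (f : sobolev n r 2) : L2 G (fun x => f (Tm x)) /\ forall i, L2 G (Q f i).
Proof.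
have [k [sk [_ h _] cD]] := sobolev_L2cvg n1 r0 f; split => // i.
by have [] := cD i.
Qed.

Lemma sobolev_poincare (f : sobolev n r 2) : (2 < n)%N ->
  \int[G]_x (f (Tm x) ^+ 2) - (\int[G]_x f (Tm x)) ^+ 2 <=
  (n%:R - 2)^-1 * \sum_i \int[G]_x (Q f i x ^+ 2).
Proof.
move=> n2; have [k [sk ck cD]] := sobolev_L2cvg n1 r0 f.
have c1 := L2cvg_sqr ck; have c2 := L2cvg_E ck; have c3 i := L2cvg_sqr (cD i).
have cl : \int[G]_x (k m x ^+ 2) - (\int[G]_x k m x) ^+ 2 @[m --> \oo] -->
    \int[G]_x (f (Tm x) ^+ 2) - (\int[G]_x f (Tm x)) ^+ 2.
  by apply: (@cvgB _ R^o) => //; apply: cvgM.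
have cr : (n%:R - 2)^-1 * \sum_i \int[G]_x (rpartial i (k m) x ^+ 2) @[m --> \oo] -->
    (n%:R - 2)^-1 * \sum_i \int[G]_x (Q f i x ^+ 2).
  by apply: cvgMr; exact: cvg_sumr.
by apply: (ler_cvg_to cl cr); apply: nearW => m; exact: sphere_poincare.
Qed.

Lemma sobolev_bilinear (f g : sobolev n r 2) i j :
  \int[G]_x (Q f i x * Q g j x) - \int[G]_x (Q f j x * Q g i x) =
  (n%:R - 2) * (\int[G]_x (dir i x * f (Tm x) * Q g j x) + \int[G]_x (Q f i x * (dir j x * g (Tm x)))
    - n%:R * \int[G]_x (dir i x * f (Tm x) * (dir j x * g (Tm x)))
    + (i == j)%:R * \int[G]_x (f (Tm x) * g (Tm x))).
Proof.
have [k [sk ck cD]] := sobolev_L2cvg n1 r0 f; have [l [sl cl cE]] := sobolev_L2cvg n1 r0 g.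
have [mi _ _] := smooth0_dir (R := R) i; have [mj _ _] := smooth0_dir (R := R) j.
have cpk := L2cvgM ck mi (normr_dir_le1 i); have cpl := L2cvgM cl mj (normr_dir_le1 j).
have L : \int[G]_x (rpartial i (k m) x * rpartial j (l m) x) - \int[G]_x (rpartial j (k m) x * rpartial i (l m) x) @[m --> \oo]
    --> \int[G]_x (Q f i x * Q g j x) - \int[G]_x (Q f j x * Q g i x).
  exact: (@cvgB _ R^o _ _ _ _ _ _ _ (L2cvg_mul (cD i) (cE j)) (L2cvg_mul (cD j) (cE i))).
have E m := sphere_bilinear n1 i j (sk m) (sl m).
move: L; rewrite (eq_cvg _ _ E) => L; apply: (cvg_unique (@Rhausdorff R) L).
apply: cvgMr; apply: (@cvgD _ R^o); last by apply: cvgMr; exact: L2cvg_mul.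
apply: (@cvgB _ R^o); last by apply: cvgMr; exact: (L2cvg_mul cpk cpl).
apply: (@cvgD _ R^o); first exact: (L2cvg_mul cpk (cE j)).
exact: (L2cvg_mul (cD i) cpl).
Qed.

(** The first index selects the component of f, the second the direction of differentiation. At x =
    0 the equation holds as well, the rank-one terms of both projections being 0 there. *)
Lemma sobolev_gradmx_proj alpha (f : 'I_n -> sobolev n r alpha) x j k :
  ((sobolev_gradmx f (Tm x))^T *m proj_perp (Tm x)) j k = r^-1 * Q (f j) k x.
Proof.
rewrite mxE /tangent mulrA mulVf ?gt_eqF// mul1r; apply: eq_bigr => l _.
rewrite mxE mxE mulrC; congr (_ * _); rewrite 3!mxE; congr (_ + _).
  by rewrite eq_sym.
congr (- _); rewrite mxE [(_ *m _) _ _]mxE big_ord1 [_^T _ _]mxE !to_sphere_coord.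
have [->|x0] := eqVneq x 0; first by rewrite /dir !mxE !mul0r mulr0 mul0r mulr0.
by rewrite enorm_to_sphere//; field; rewrite gt_eqF.
Qed.

Lemma measurable_gradmx_proj alpha (f : 'I_n -> sobolev n r alpha) j k :
  measurable_fun setT (fun y : V => ((sobolev_gradmx f y)^T *m proj_perp y) j k).
Proof.
under eq_fun do rewrite mxE; apply: measurable_sum => l; apply: measurable_funM.
  under eq_fun do rewrite mxE mxE.
  by apply: (measurableT_comp (@measurable_coor R n l)); exact: measurable_sobolev_grad.
under eq_fun do rewrite 3!mxE.
apply: measurable_funB; first exact: measurable_cst.
under eq_fun => y do rewrite mxE mxE big_ord1 mxE -exprVn.
apply: measurable_funM; last by apply: measurable_funM; exact: measurable_coor.
by apply: measurable_funX; exact: measurable_inorm.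
Qed.

End sobolev_identities.

(** * From the law of z to Gaussian integrals, and the final assembly *)

Lemma expectation_unif_sphere d (T : measurableType d) (R : realType) (P : probability T R)
    (n : nat) (r : R) (z : {RV P >-> 'cV[R]_n}) (phi : 'cV[R]_n -> R) :
  is_unif_sphere z r -> measurable_fun setT phi ->
  (gaussian R n).-integrable setT (EFin \o (fun x => phi (to_sphere r x))) ->
  'E_P[fun w => phi (z w)]%E = (\int[gaussian R n]_x phi (to_sphere r x))%:E.
Proof.
move=> hz mphi iphi; have mE : measurable_fun setT (EFin \o phi) by exact/measurable_EFinP.
(* Equality of laws on measurable sets gives equal integrals of nonnegative functions; positive and
   negative parts extend this to phi. *)
have ge0E (psi : 'cV[R]_n -> \bar R) : measurable_fun setT psi -> (forall y, 0 <= psi y)%E ->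
    (\int[P]_w psi (z w) = \int[gaussian R n]_x psi (to_sphere r x))%E.
  move=> mpsi psi0; rewrite -[LHS](ge0_integral_distribution z)//.
  rewrite (eq_measure_integral (unif_sphere n r)) => [|A mA _]; last exact: hz.
  by rewrite [LHS]ge0_integral_distribution.
rewrite -integral_EFin// expectation.unlock integralE [RHS]integralE.
congr (_ - _)%E.
- rewrite (funepos_comp (EFin \o phi) z) (funepos_comp (EFin \o phi) (to_sphere r)).
  exact: (ge0E _ (measurable_funepos mE) (funepos_ge0 _)).
- rewrite (funeneg_comp (EFin \o phi) z) (funeneg_comp (EFin \o phi) (to_sphere r)).
  exact: (ge0E _ (measurable_funeneg mE) (funeneg_ge0 _)).
Qed.

(** Meant for U i = p_i f_i and Q i j = D_j f_i. Summing the hypothesis over i and j expresses the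
    mean of (sum U) (trace Q); inserted into the expanded square, it cancels the N^2 terms and
    leaves the coefficient 1 - N / (N - 2) = - 2 / (N - 2) for the squared trace. *)
Lemma second_moment_bilinear d (T : measurableType d) (R : realType) (P : probability T R) (n : nat)
    (N : R) (F U : 'I_n -> T -> R) (Q : 'I_n -> 'I_n -> T -> R) : N - 2 != 0 ->
  (forall i, L2 P (F i)) -> (forall i, L2 P (U i)) -> (forall i j, L2 P (Q i j)) ->
  (forall i j, \int[P]_x (Q i i x * Q j j x) - \int[P]_x (Q i j x * Q j i x) =
    (N - 2) * (\int[P]_x (U i x * Q j j x) + \int[P]_x (Q i i x * U j x)
      - N * \int[P]_x (U i x * U j x) + (i == j)%:R * \int[P]_x (F i x * F j x))) ->
  \int[P]_x ((N * (\sum_i U i x) - \sum_i Q i i x) ^+ 2) =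
  N * \int[P]_x (\sum_i F i x ^+ 2) + N / (N - 2) * \int[P]_x (\sum_i \sum_j Q i j x * Q j i x)
   - 2 / (N - 2) * \int[P]_x ((\sum_i Q i i x) ^+ 2).
Proof.
move=> N2 LF LU LQ H.
pose SU x := \sum_i U i x; pose SQ x := \sum_i Q i i x.
have LSU : L2 P SU by exact: L2_sum.
have LSQ : L2 P SQ by apply: (L2_sum _ (F := fun i => Q i i)) => i.
have sum2 (a b : 'I_n -> T -> R) : (forall i, L2 P (a i)) -> (forall i, L2 P (b i)) ->
    \int[P]_x ((\sum_i a i x) * (\sum_j b j x)) = \sum_i \sum_j \int[P]_x (a i x * b j x).
  move=> La Lb; under eq_Rintegral do rewrite big_distrlr/=.
  rewrite Rintegral_sum => [|i]; last by apply: integrable_fun_sum => j; exact: L2_mul.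
  by apply: eq_bigr => i _; rewrite Rintegral_sum// => j; exact: L2_mul.
have EUU := sum2 U U LU LU; have EQQ := sum2 (fun i => Q i i) (fun i => Q i i) (fun i => LQ i i) (fun i => LQ i i).
have EUQ := sum2 U (fun i => Q i i) LU (fun i => LQ i i).
have EQU := sum2 (fun i => Q i i) U (fun i => LQ i i) LU.
have EM : \int[P]_x (\sum_i \sum_j Q i j x * Q j i x) = \sum_i \sum_j \int[P]_x (Q i j x * Q j i x).
  rewrite Rintegral_sum => [|i]; last by apply: integrable_fun_sum => j; exact: L2_mul.
  by apply: eq_bigr => i _; rewrite Rintegral_sum// => j; exact: L2_mul.
have EF : \int[P]_x (\sum_i F i x ^+ 2) = \sum_i \sum_j (i == j)%:R * \int[P]_x (F i x * F j x).
  rewrite Rintegral_sum => [|i]; last by have [] := LF i.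
  apply: eq_bigr => i _; rewrite (bigD1 i)//= eqxx mul1r big1 ?addr0// => j ji.
  by rewrite eq_sym (negbTE ji) mul0r.
have S : \int[P]_x (SQ x * SQ x) - \int[P]_x (\sum_i \sum_j Q i j x * Q j i x) =
    (N - 2) * (\int[P]_x (SU x * SQ x) + \int[P]_x (SQ x * SU x) - N * \int[P]_x (SU x * SU x)
      + \int[P]_x (\sum_i F i x ^+ 2)).
  rewrite EQQ EM EUQ EQU EUU EF -sumrB mulrDr mulrBr mulrDr !mulr_sumr -!big_split -!sumrB/=.
  rewrite -big_split/=; apply: eq_bigr => i _.
  rewrite !mulr_sumr -!big_split -!sumrB/= -big_split/=; apply: eq_bigr => j _.
  rewrite H; ring.
have iUU := L2_mul LSU LSU; have iUQ := L2_mul LSU LSQ; have iQQ := L2_mul LSQ LSQ.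
have -> : \int[P]_x ((N * (\sum_i U i x) - \sum_i Q i i x) ^+ 2) =
    N ^+ 2 * \int[P]_x (SU x * SU x) - 2 * N * \int[P]_x (SU x * SQ x) + \int[P]_x (SQ x * SQ x).
  have i1 := integrable_funZ (N ^+ 2) iUU; have i2 := integrable_funZ (2 * N) iUQ.
  rewrite -!RintegralZl// -RintegralB// -RintegralD//; last exact: integrable_funB.
  by apply: eq_Rintegral => x _; rewrite /SU /SQ; ring.
have -> : \int[P]_x ((\sum_i Q i i x) ^+ 2) = \int[P]_x (SQ x * SQ x) by [].
have C : \int[P]_x (SQ x * SU x) = \int[P]_x (SU x * SQ x).
  by apply: eq_Rintegral => x _; rewrite mulrC.
rewrite C in S; have -> : \int[P]_x (\sum_i \sum_j Q i j x * Q j i x) = \int[P]_x (SQ x * SQ x) -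
    (N - 2) * (\int[P]_x (SU x * SQ x) + \int[P]_x (SU x * SQ x) - N * \int[P]_x (SU x * SU x)
      + \int[P]_x (\sum_i F i x ^+ 2)) by rewrite -S; ring.
by field.
Qed.

Section sphere_expectations.
Context d (T : measurableType d) (R : realType) (P : probability T R).
Variables (n : nat) (r : R) (z : {RV P >-> 'cV[R]_n}).
Hypotheses (n1 : (1 < n)%N) (r0 : 0 < r) (hz : is_unif_sphere z r).
Notation V := 'cV[R]_n.
Notation G := (gaussian R n).
Notation Tm := (@to_sphere R n r).

Lemma expectation_to_sphere (phi psi : V -> R) : measurable_fun setT phi ->
  (forall x, phi (Tm x) = psi x) -> G.-integrable setT (EFin \o psi) ->
  'E_P[fun w => phi (z w)]%E = (\int[G]_x psi x)%:E.
Proof.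
move=> mphi phiE ipsi; have E : (fun x => phi (Tm x)) = psi by exact/funext.
by rewrite -E; apply: expectation_unif_sphere => //; rewrite E.
Qed.

Variables (alpha : R) (f : 'I_n -> sobolev n r alpha).
Let M y := (sobolev_gradmx f y)^T *m proj_perp y.
Let Q i := tangent r (sobolev_grad (f i)).

Lemma measurable_dotp : measurable_fun setT (fun y => dotp (sobolev_vec f y) y).
Proof.
rewrite /dotp; under eq_fun do rewrite mxE; apply: measurable_sum => i.
under eq_fun do rewrite mxE mxE; apply: measurable_funM; last exact: measurable_coor.
exact: measurable_sobolev_fun.
Qed.

Lemma dotp_to_sphere x :
  dotp (sobolev_vec f (Tm x)) (Tm x) = r * \sum_i dir i x * f i (Tm x).
Proof.
rewrite /dotp mxE mulr_sumr; apply: eq_bigr => i _.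
by rewrite mxE mxE to_sphere_coord; ring.
Qed.

Lemma measurable_trace : measurable_fun setT (fun y => \tr (M y)).
Proof. by apply: measurable_sum => i; exact: measurable_gradmx_proj. Qed.

Lemma trace_to_sphere x : \tr (M (Tm x)) = r^-1 * \sum_i Q i i x.
Proof. by rewrite mulr_sumr; apply: eq_bigr => i _; exact: sobolev_gradmx_proj. Qed.

Lemma trace_sqr_to_sphere x :
  \tr (M (Tm x) *m M (Tm x)) = r^-1 ^+ 2 * \sum_i \sum_j Q i j x * Q j i x.
Proof.
rewrite mulr_sumr; apply: eq_bigr => i _; rewrite mxE mulr_sumr; apply: eq_bigr => j _.
by rewrite !sobolev_gradmx_proj//; rewrite /Q; ring.
Qed.

Lemma frob_to_sphere x : frob (M (Tm x)) ^+ 2 = r^-1 ^+ 2 * \sum_i \sum_j Q i j x ^+ 2.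
Proof.
rewrite sqr_sqrtr; last by apply: sumr_ge0 => i _; apply: sumr_ge0 => j _; exact: sqr_ge0.
rewrite mulr_sumr; apply: eq_bigr => i _; rewrite mulr_sumr; apply: eq_bigr => j _.
by rewrite sobolev_gradmx_proj// exprMn.
Qed.

Lemma measurable_trace_sqr : measurable_fun setT (fun y => \tr (M y *m M y)).
Proof.
apply: measurable_sum => i; under eq_fun do rewrite mxE; apply: measurable_sum => j.
by apply: measurable_funM; exact: measurable_gradmx_proj.
Qed.

Lemma measurable_frob_sqr : measurable_fun setT (fun y => frob (M y) ^+ 2).
Proof.
rewrite /frob; under eq_fun => y.
  rewrite sqr_sqrtr; last by apply: sumr_ge0 => i _; apply: sumr_ge0 => j _; exact: sqr_ge0.
  over.
apply: measurable_sum => i; apply: measurable_sum => j.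
by apply: measurable_funX; exact: measurable_gradmx_proj.
Qed.

Lemma measurable_enorm_sobolev_sqr (c : V) :
  measurable_fun setT (fun y => enorm (sobolev_vec f y - c) ^+ 2).
Proof.
apply: measurable_funX; apply: measurableT_comp; first exact: measurable_enorm.
apply: measurable_fun_cV => i; under eq_fun do rewrite mxE mxE.
by apply: measurable_funD => //; exact: measurable_sobolev_fun.
Qed.

End sphere_expectations.

Theorem lemmaB1 (R : realType) (n : nat) (r : R) (hn : (3 <= n)%N) (hr : 0 < r)
    (d : measure_display) (T : measurableType d) (P : probability T R)
    (z : {RV P >-> 'cV[R]_n}) (hz : is_unif_sphere z r) :
  (forall f : 'I_n -> sobolev n r 1,
    let F w := sobolev_vec f (z w) in
    let M w := (sobolev_gradmx f (z w))^T *m proj_perp (z w) in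
    'E_P[fun w => (dotp (F w) (z w))%R] =
      ((n%:R - 1)^-1 * r ^+ 2)%:E * 'E_P[fun w => (\tr (M w))%R])%E /\
  (forall f : 'I_n -> sobolev n r 2,
    let F w := sobolev_vec f (z w) in
    let M w := (sobolev_gradmx f (z w))^T *m proj_perp (z w) in
    [/\ 'E_P[fun w => (enorm (F w - expectation_vec P F) ^+ 2)%R] <=
          ((n%:R - 2)^-1 * r ^+ 2)%:E * 'E_P[fun w => (frob (M w) ^+ 2)%R],
        'E_P[fun w => ((n%:R * r ^- 2 * dotp (F w) (z w) - \tr (M w)) ^+ 2)%R] =
          (n%:R * r ^- 2)%:E * 'E_P[fun w => (enorm (F w) ^+ 2)%R] +
          (n%:R / (n%:R - 2))%:E * 'E_P[fun w => (\tr (M w *m M w))%R] -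
          (2 / (n%:R - 2))%:E * 'E_P[fun w => ((\tr (M w)) ^+ 2)%R] &
        (n%:R * r ^- 2)%:E * 'E_P[fun w => (enorm (F w) ^+ 2)%R] +
          (n%:R / (n%:R - 2))%:E * 'E_P[fun w => (\tr (M w *m M w))%R] -
          (2 / (n%:R - 2))%:E * 'E_P[fun w => ((\tr (M w)) ^+ 2)%R] <=
        (n%:R * r ^- 2)%:E * 'E_P[fun w => (enorm (F w) ^+ 2)%R] +
          ((1 - 2 / n%:R)^-1)%:E * 'E_P[fun w => (frob (M w) ^+ 2)%R]])%E.

Proof.
have n1 : (1 < n)%N by exact: ltnW.
have n20 : 0 < n%:R - 2 :> R by rewrite subr_gt0 ltr_nat.
have n10 : n%:R - 1 != 0 :> R by rewrite subr_eq0 pnatr_eq1 gtn_eqF.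
have rn0 : r != 0 by rewrite gt_eqF.
have mp i := let: And3 h _ _ := smooth0_dir (R := R) (n := n) i in h.
pose G := gaussian R n; pose Tm := @to_sphere R n r.
pose U alpha (f : 'I_n -> sobolev n r alpha) i x := dir i x * f i (Tm x).
pose Q alpha (f : 'I_n -> sobolev n r alpha) i := tangent r (sobolev_grad (f i)).
split=> f F M.
  have iU i : G.-integrable setT (EFin \o U 1 f i).
    have [k [_ [_ h _] _]] := sobolev_L1cvg n1 hr (f i).
    exact: integrable_mul_bounded h (mp i) (normr_dir_le1 i).
  have iQ i : G.-integrable setT (EFin \o Q 1 f i i).
    by have [k [_ _ /(_ i)[]]] := sobolev_L1cvg n1 hr (f i).
  rewrite (expectation_to_sphere hz (measurable_dotp f) (dotp_to_sphere f) (integrable_funZ r (integrable_fun_sum _ iU))).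
  rewrite (expectation_to_sphere hz (measurable_trace f) (trace_to_sphere hr f) (integrable_funZ r^-1 (integrable_fun_sum _ iQ))).
  rewrite -EFinM; congr EFin.
  rewrite (RintegralZl _ _ (integrable_fun_sum _ iU))// (RintegralZl _ _ (integrable_fun_sum _ iQ))//.
  rewrite (Rintegral_sum _ iU) (Rintegral_sum _ iQ).
  (* Stein's identity for each diagonal entry; the factor r of the inner product and the factor 1 /
     r of the trace account for r^2. *)
  have -> : \sum_i \int[G]_x Q 1 f i i x = (n%:R - 1) * \sum_i \int[G]_x U 1 f i x.
    by rewrite mulr_sumr; apply: eq_bigr => i _; exact: sobolev_stein.
  by field; rewrite n10 rn0.
have LF i : L2 G (fun x => f i (Tm x)) by have [] := sobolev_L2 n1 hr (f i).
have LQ i j : L2 G (Q 2 f i j) by have [_] := sobolev_L2 n1 hr (f i); apply.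
have LU i : L2 G (U 2 f i) by exact: L2M (LF i) (mp i) (normr_dir_le1 i).
have iF2 i : G.-integrable setT (EFin \o (fun x => f i (Tm x) ^+ 2)) by have [] := LF i.
have iQ2 i j : G.-integrable setT (EFin \o (fun x => Q 2 f i j x ^+ 2)) by have [] := LQ i j.
have iQQ i j : G.-integrable setT (EFin \o (fun x => Q 2 f i j x * Q 2 f j i x)) by exact: L2_mul.
have LSU := L2_sum (index_enum 'I_n) LU.
have LSQ := L2_sum (index_enum 'I_n) (fun i => LQ i i).
have iSF := integrable_fun_sum (index_enum 'I_n) iF2.
have iSQ2 := integrable_fun_sum (index_enum 'I_n) (fun i => integrable_fun_sum (index_enum 'I_n) (iQ2 i)).
have iSQQ := integrable_fun_sum (index_enum 'I_n) (fun i => integrable_fun_sum (index_enum 'I_n) (iQQ i)).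
pose c := expectation_vec P F.
have cE i : c i ord0 = \int[G]_x f i (Tm x).
  rewrite mxE (_ : (fun w => F w i ord0) = (fun w => f i (z w))); last first.
    by apply/funext => w; rewrite mxE.
  by rewrite (expectation_to_sphere hz (measurable_sobolev_fun (f i)) (fun=> erefl) (L2_int (LF i))).
have enE (x : 'cV[R]_n) (b : 'cV[R]_n) : enorm (sobolev_vec f (Tm x) - b) ^+ 2 = \sum_i (f i (Tm x) - b i ord0) ^+ 2.
  by rewrite sqr_enorm; apply: eq_bigr => i _; rewrite !mxE.
have LFc i (b : R) : L2 G (fun x => f i (Tm x) - b).
  by apply: L2B => //; exact: (@L2_bounded _ _ _ G (fun=> b) `|b|).
have EF : 'E_P[fun w => (enorm (F w) ^+ 2)%R]%E = (\int[G]_x (\sum_i f i (Tm x) ^+ 2))%:E.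
  have -> : (fun w => enorm (F w) ^+ 2) = (fun w => enorm (sobolev_vec f (z w) - 0) ^+ 2).
    by apply/funext => w; rewrite subr0.
  apply: (expectation_to_sphere hz (measurable_enorm_sobolev_sqr f 0) _ iSF) => x.
  by rewrite enE; apply: eq_bigr => i _; rewrite mxE subr0.
have EFc : 'E_P[fun w => (enorm (F w - c) ^+ 2)%R]%E =
    (\sum_i (\int[G]_x (f i (Tm x) ^+ 2) - (\int[G]_x f i (Tm x)) ^+ 2))%:E.
  have iFc i : G.-integrable setT (EFin \o (fun x => (f i (Tm x) - c i ord0) ^+ 2)) by have [] := LFc i (c i ord0).
  rewrite (expectation_to_sphere hz (measurable_enorm_sobolev_sqr f c) (enE^~ c) (integrable_fun_sum _ iFc)).
  rewrite (Rintegral_sum _ iFc); congr EFin; apply: eq_bigr => i _; rewrite cE.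
  set b := \int[G]_x f i (Tm x).
  have iL := L2_int (LF i); have ib : G.-integrable setT (EFin \o (fun=> b ^+ 2)).
    exact: (@bounded_integrable _ _ _ G (fun=> b ^+ 2) `|b ^+ 2|).
  transitivity (\int[G]_x (f i (Tm x) ^+ 2 - 2 * b * f i (Tm x) + b ^+ 2)).
    by apply: eq_Rintegral => x _; ring.
  have i1 := integrable_funZ (2 * b) iL.
  rewrite RintegralD//; last exact: integrable_funB.
  by rewrite RintegralB// RintegralZl// Rintegral_prob_cst -/b; ring.
have Efrob : 'E_P[fun w => (frob (M w) ^+ 2)%R]%E = ((r^-1 ^+ 2) * \int[G]_x (\sum_i \sum_j Q 2 f i j x ^+ 2))%:E.
  rewrite (expectation_to_sphere hz (measurable_frob_sqr f) (frob_to_sphere hr f) (integrable_funZ _ iSQ2)).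
  by rewrite RintegralZl.
have Etr2 : 'E_P[fun w => (\tr (M w *m M w))%R]%E = ((r^-1 ^+ 2) * \int[G]_x (\sum_i \sum_j Q 2 f i j x * Q 2 f j i x))%:E.
  rewrite (expectation_to_sphere hz (measurable_trace_sqr f) (trace_sqr_to_sphere hr f) (integrable_funZ _ iSQQ)).
  by rewrite RintegralZl.
have Etrsq : 'E_P[fun w => ((\tr (M w)) ^+ 2)%R]%E = ((r^-1 ^+ 2) * \int[G]_x ((\sum_i Q 2 f i i x) ^+ 2))%:E.
  have [_ iS] := LSQ; rewrite -(RintegralZl _ _ iS)//.
  apply: (expectation_to_sphere hz (phi := fun y => (\tr ((sobolev_gradmx f y)^T *m proj_perp y)) ^+ 2) _ _ (integrable_funZ _ iS)).
    by apply: measurable_funX; exact: measurable_trace.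
  by move=> x; rewrite trace_to_sphere// exprMn.
have Emom : 'E_P[fun w => ((n%:R * r ^- 2 * dotp (F w) (z w) - \tr (M w)) ^+ 2)%R]%E =
    ((r^-1 ^+ 2) * \int[G]_x ((n%:R * (\sum_i U 2 f i x) - \sum_i Q 2 f i i x) ^+ 2))%:E.
  have [_ iS] := L2B (L2Z n%:R LSU) LSQ; rewrite -(RintegralZl _ _ iS)//.
  apply: (expectation_to_sphere hz (phi := fun y => (n%:R * r ^- 2 * dotp (sobolev_vec f y) y -
    \tr ((sobolev_gradmx f y)^T *m proj_perp y)) ^+ 2) _ _ (integrable_funZ _ iS)).
    apply: measurable_funX; apply: measurable_funB; last exact: measurable_trace.
    by apply: measurable_funM => //; exact: measurable_dotp.
  by move=> x; rewrite trace_to_sphere// dotp_to_sphere; field.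
(* The trace of a squared matrix is at most its squared Frobenius norm: the off-diagonal products
   are symmetrized and 2 a b <= a^2 + b^2 is applied to each pair. *)
have tr_le : \int[G]_x (\sum_i \sum_j Q 2 f i j x * Q 2 f j i x) <= \int[G]_x (\sum_i \sum_j Q 2 f i j x ^+ 2).
  rewrite (Rintegral_sum _ (fun i => integrable_fun_sum _ (iQQ i))) (Rintegral_sum _ (fun i => integrable_fun_sum _ (iQ2 i))).
  under eq_bigr do rewrite (Rintegral_sum _ (iQQ _)).
  under [leRHS]eq_bigr do rewrite (Rintegral_sum _ (iQ2 _)).
  set S := leRHS; have -> : S = 2^-1 * \sum_i \sum_j (\int[G]_x (Q 2 f i j x ^+ 2) + \int[G]_x (Q 2 f j i x ^+ 2)).
    under eq_bigr do rewrite big_split/=.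
    by rewrite big_split/= [X in _ * (_ + X)]exchange_big/= -/S; field.
  rewrite mulr_sumr; apply: ler_sum => i _; rewrite mulr_sumr; apply: ler_sum => j _.
  rewrite -RintegralD// -RintegralZl//; last exact: integrable_funD.
  apply: le_RintegralT => // [|x]; first by apply: integrable_funZ; exact: integrable_funD.
  by have := sqr_ge0 (Q 2 f i j x - Q 2 f j i x); nra.
have n0 : n%:R != 0 :> R by rewrite pnatr_eq0 gtn_eqF// ltnW.
split.
- rewrite EFc Efrob -EFinM lee_fin.
  have -> : (n%:R - 2)^-1 * r ^+ 2 * (r^-1 ^+ 2 * \int[G]_x (\sum_i \sum_j Q 2 f i j x ^+ 2)) =
      \sum_i (n%:R - 2)^-1 * \sum_j \int[G]_x (Q 2 f i j x ^+ 2).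
    rewrite -mulr_sumr; under [in RHS]eq_bigr do rewrite -(Rintegral_sum _ (iQ2 _)).
    rewrite -(Rintegral_sum _ (fun i => integrable_fun_sum _ (iQ2 i))); field.
    by rewrite rn0 gt_eqF.
  (* The variance of the vector is the sum of the variances of its components, each bounded
     separately. *)
  by apply: ler_sum => i _; exact: sobolev_poincare.
- rewrite Emom EF Etr2 Etrsq -!EFinM -EFinN -!EFinD; congr EFin.
  rewrite (second_moment_bilinear (N := n%:R) (F := fun i x => f i (Tm x)) (Q := Q 2 f) _ LF LU LQ).
  + by field; rewrite rn0 gt_eqF.
  + by rewrite gt_eqF.
  + by move=> i j; exact: sobolev_bilinear.
- rewrite EF Etr2 Etrsq Efrob -!EFinM -EFinN -!EFinD lee_fin.
  have -> : (1 - 2 / n%:R)^-1 = n%:R / (n%:R - 2) :> R.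
    by field; rewrite n0 gt_eqF.
  set A := \int[G]_x (\sum_i f i _ ^+ 2).
  (* The subtracted squared trace is nonnegative, so dropping it can only increase the right-hand
     side; [tr_le] then finishes. *)
  have h1 : 0 <= 2 / (n%:R - 2) * (r^-1 ^+ 2 * \int[G]_x ((\sum_i Q 2 f i i x) ^+ 2)).
    apply: mulr_ge0; first by rewrite divr_ge0// ltW.
    by rewrite mulr_ge0 ?sqr_ge0//; apply: Rintegral_ge0 => x _; exact: sqr_ge0.
  have h2 : n%:R / (n%:R - 2) * (r^-1 ^+ 2 * \int[G]_x (\sum_i \sum_j Q 2 f i j x * Q 2 f j i x)) <=
      n%:R / (n%:R - 2) * (r^-1 ^+ 2 * \int[G]_x (\sum_i \sum_j Q 2 f i j x ^+ 2)).
    apply: ler_wpM2l; first by rewrite divr_ge0// ltW.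
    by apply: ler_wpM2l => //; exact: sqr_ge0.
  by rewrite -addrA lerD2l lerBlDr; apply: (le_trans h2); rewrite lerDl.
Qed.
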